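(* Let $1\leqslant p\leqslant d-1$ be integers and let $\alpha_1,\ldots,\alpha_p$ and $\beta_1,\ldots,\beta_{d-p}$ be positive integers. Let $$\Lambda_n^0=\mathrm{diag}(\alpha_1,\ldots,\alpha_p,\beta_1n,\ldots,\beta_{d-p}n),\quad A=\mathrm{diag}(\alpha_1,\ldots,\alpha_p),\quad B=\mathrm{diag}(\beta_1,\ldots,\beta_{d-p}).$$ Let $\det^\ast\Delta_{\mathbb{Z}^d/\Lambda_n^0\mathbb{Z}^d}$ be the product of the non-zero eigenvalues of the Laplacian on the discrete torus $\mathbb{Z}^d/\Lambda_n^0\mathbb{Z}^d$. Then as $n\rightarrow\infty$ $$\log\det{}^\ast\Delta_{\mathbb{Z}^d/\Lambda_n^0\mathbb{Z}^d}=n^{d-p}\det(B)\sum_{j=0}^{\det(A)-1}\int_0^\infty\left(e^{-t}-I_0(2t)^{d-p}e^{-(2(d-p)+\lambda_j)t}\right)\frac{dt}{t}+2\log n-\zeta'_{\mathbb{R}^{d-p}/B\mathbb{Z}^{d-p}}(0)+o(1),$$ where $\lambda_j$, $j=0,1,\ldots,\det(A)-1$, are the eigenvalues (listed with multiplicity) of the Laplacian on $\mathbb{Z}^p/A\mathbb{Z}^p$, given by $$\{\lambda_j\}_j=\Big\{2p-2\sum_{i=1}^p\cos(2\pi j_i/\alpha_i):\ j_i=0,1,\ldots,\alpha_i-1,\ i=1,\ldots,p\Big\}.$$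
   Context: For a positive diagonal integer matrix $M=\mathrm{diag}(m_1,\ldots,m_d)$, the discrete torus $\mathbb{Z}^d/M\mathbb{Z}^d$ is the Cayley graph of the group $\mathbb{Z}^d/M\mathbb{Z}^d$ with respect to the standard basis vectors $e_1,\ldots,e_d$ of $\mathbb{Z}^d$; its combinatorial Laplacian is $\Delta f(x)=\sum_{i=1}^d(2f(x)-f(x+e_i)-f(x-e_i))$, with eigenvalues (with multiplicity) $2d-2\sum_{i=1}^d\cos(2\pi j_i/m_i)$, $0\leqslant j_i<m_i$. $I_0$ is the modified Bessel function of the first kind of order zero, $I_0(t)=\frac1{2\pi}\int_{-\pi}^{\pi}e^{t\cos\theta}d\theta$. For an $r\times r$ positive diagonal real matrix $M=\mathrm{diag}(m_1,\ldots,m_r)$, the spectral (Epstein) zeta function of the real torus $\mathbb{R}^r/M\mathbb{Z}^r$ is, for $\mathrm{Re}(s)>r/2$, $$\zeta_{\mathbb{R}^r/M\mathbb{Z}^r}(s)=\frac{1}{(2\pi)^{2s}}\sum_{k\in\mathbb{Z}^r\setminus\{0\}}\left(\sum_{i=1}^r\frac{k_i^2}{m_i^2}\right)^{-s};$$ it has an analytic continuation to the whole complex plane except for a simple pole at $s=r/2$, and $\zeta'_{\mathbb{R}^r/M\mathbb{Z}^r}(0)$ denotes the derivative at $s=0$ of this continuation. *)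

(* Defs.v *)
From HB Require Import structures.
From mathcomp Require Export all_boot all_order all_algebra.
From mathcomp Require Export all_classical all_reals all_analysis.
From mathcomp Require Export complex.
From mathcomp Require summability.

Set Implicit Arguments.
Unset Strict Implicit.
Unset Printing Implicit Defensive.

Import Order.TTheory GRing.Theory Num.Theory.
Import numFieldNormedType.Exports.

Local Open Scope classical_set_scope.
Local Open Scope ring_scope.
Local Open Scope complex_scope.

(* A diagonal matrix diag(m_1, ..., m_r) with natural number entries is
   represented by the function m : 'I_r -> nat of its diagonal entries. *)

Definition diag_det (R : realType) (r : nat) (m : 'I_r -> nat) : R :=
  \det (diag_mx (\row_i ((m i)%:R : R))).

(* Z^r / diag(m) Z^r, each class being represented by its unique element with
   0 <= x_i < m_i for all i. *)
Definition torus (r : nat) (m : 'I_r -> nat) : finType :=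
  {dffun forall i : 'I_r, 'I_(m i)}.

(* x + e_i and x - e_i: ordS and ord_pred are the successor and the predecessor
   modulo m i. *)
Definition torus_add (r : nat) (m : 'I_r -> nat) (i : 'I_r) (x : torus m) :
    torus m :=
  finfun (fun j => if j == i then ordS (x j) else x j).

Definition torus_sub (r : nat) (m : 'I_r -> nat) (i : 'I_r) (x : torus m) :
    torus m :=
  finfun (fun j => if j == i then ord_pred (x j) else x j).

Definition laplacian (R : realType) (r : nat) (m : 'I_r -> nat)
    (f : torus m -> R) (x : torus m) : R :=
  \sum_(i < r) (2 * f x - f (torus_add i x) - f (torus_sub i x)).

(* The matrix of the Laplacian in the basis of the indicator functions of the
   vertices. *)
Definition laplacian_mx (R : realType) (r : nat) (m : 'I_r -> nat) :
    'M[R]_#|torus m| :=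
  \matrix_(i, j) laplacian (fun y => (y == enum_val j)%:R) (enum_val i).

(* The product of the nonzero eigenvalues, with algebraic multiplicity. *)
Definition det_star (R : realType) (n : nat) (A : 'M[R]_n) : R :=
  \big[*%R/1]_(x \in [set x | eigenvalue A x && (x != 0)])
     x ^+ mup x (char_poly A).

Definition torus_eigenvalue (R : realType) (r : nat) (m : 'I_r -> nat)
    (j : torus m) : R :=
  2 * r%:R - 2 * \sum_(i < r) cos (2 * pi * (j i)%:R / (m i)%:R).

(* diag(a_1, ..., a_p, b_1 n, ..., b_(d-p) n). *)
Definition Lambda0 (d p : nat) (a : p.-tuple nat) (b : (d - p).-tuple nat)
    (n : nat) : 'I_d -> nat :=
  fun i => nth 0%N (a ++ [seq (x * n)%N | x <- b]) i.

Definition bessel_I0 (R : realType) (t : R) : R :=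
  (2 * pi)^-1 *
  \int[lebesgue_measure]_(x in `[- pi, pi]) expR (t * cos x).

(* x ^ s = exp (s ln x), for x > 0 real and s complex. *)
Definition cpow (R : realType) (x : R) (s : R[i]) : R[i] :=
  (expR (complex.Re s * ln x))%:C *
  (cos (complex.Im s * ln x) +i* sin (complex.Im s * ln x)).

(* The type R[i]^o is R[i] with its topology and its structure of normed module
   over itself. The series over Z^r \ {0} is summed unconditionally, as the
   limit of its sums over finite sets; it is the zeta function only for
   r / 2 < Re s. *)
Definition epstein_series (R : realType) (r : nat) (m : 'I_r -> nat)
    (s : R[i]) : R[i]^o :=
  cpow (2 * pi) (- (2 * s)) *
  summability.sum (fun k : {k : 'rV[int]_r | k != 0} =>
    cpow (\sum_(i < r) ((val k 0 i)%:~R ^+ 2 / (m i)%:R ^+ 2)) (- s) : R[i]^o).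

Definition analytic_at (R : realType) (f : R[i]^o -> R[i]^o) (z : R[i]^o) :=
  exists c : nat -> R[i]^o, \forall s \near z,
    series (fun n => c n * (s - z) ^+ n) @ \oo --> f s.

(* Since the plane minus r / 2 is connected, this determines Z at every point
   other than r / 2. *)
Definition epstein_continuation (R : realType) (r : nat) (m : 'I_r -> nat)
    (Z : R[i]^o -> R[i]^o) :=
  (forall s : R[i], r%:R / 2 < complex.Re s -> Z s = epstein_series m s) /\
  (forall s : R[i], s != r%:R / 2 -> analytic_at Z s).

(* Main.v *)
(** Write q = d - p and t = e^v. Since ln x is the integral over v of
    exp(- e^v) - exp(- x e^v), ln det* is the integral of a multiple of
    exp(- e^v) minus the heat trace of the torus, which is a product of heat
    traces of cycles. The heat trace of a cycle of length m differs from m times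
    the return probability e^(-2t) I_0(2t) of the line by O((t / m^2)^K) for
    every K: compare both with a lazy random walk and its generating function.
    Hence, after the substitution t -> n^2 t, dominated convergence applies to
    what is left of ln det* once the two main terms are removed; the limit is
    - H, with H the integral of theta - 1 + exp(- e^v) - c e^(- q v / 2), where
    theta is the theta function of R^q / B Z^q and c e^(- q v / 2) its leading
    term as v tends to - oo.

    On the other side Gamma(s) Z(s) is the Mellin transform of theta - 1 for
    Re s > q / 2. Removing the main terms of theta at both ends gives a relation
    between Gamma(s), Z(s) and a Mellin transform converging for Re s > -1. Both
    sides are real analytic on the lines Im s = y with y <> 0, which avoid the
    pole q / 2, so the relation holds for Re s > 0, Im s <> 0. Letting s tend to
    0 along (1 + i) / n yields Z(0) = -1 and Z'(0) = H. *)
Require Import Defs.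
From mathcomp Require Import ring lra zify measurable_realfun.

Set Implicit Arguments.
Unset Strict Implicit.
Unset Printing Implicit Defensive.

Import Order.TTheory GRing.Theory Num.Theory.
Import numFieldNormedType.Exports.

Local Open Scope classical_set_scope.
Local Open Scope ring_scope.
Local Open Scope complex_scope.

(** * Integration over the line *)

Section integration.
Variable R : realType.
Implicit Types f g : R -> R.

(** In v = ln t scaling becomes translation, and the integrands decay exponentially at both ends of
    the line.

    Small times are the obstacle: as v tends to - oo a product of q cycle traces grows like e^(- q v
    / 2), and the line has to match this growth uniformly in n. The walk on a cycle is the walk on Z
    folded modulo m, so the two return probabilities differ by the images of the origin; an
    exponential moment makes these smaller than any power of t / m^2, and the power q + 1 beats the
    growth. In the limit n -> oo the same estimate gives the behaviour of theta at - oo, in place of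
    Poisson summation.

    Z is known only through local power series and its values for Re s > q / 2. On a horizontal line
    its continuation is a matter of real power series in one variable; near 0 the relation is then
    available only off the real axis, whence the approach along a diagonal. The Gaussian constant in
    c stays symbolic: at s = 0 the polar term c / (s - q / 2) cancels the integral of c e^(- q v /
    2) over v >= 0. *)

Definition L1 f : Prop := (@lebesgue_measure R).-integrable setT (EFin \o f).

Definition intR f : R := (\int[lebesgue_measure]_x f x)%R.

Lemma L1_measurable f : L1 f -> measurable_fun setT f.
Proof. by move=> /(measurable_int lebesgue_measure)/measurable_EFinP. Qed.

Lemma L1_dom g f : L1 g -> measurable_fun setT f ->
  (forall x, `|f x| <= g x) -> L1 f.
Proof.
move=> g1 mf fg; apply: (le_integrable measurableT _ _ g1).
  exact/measurable_EFinP.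
by move=> x _ /=; rewrite lee_fin (le_trans (fg x))// ler_norm.
Qed.

Lemma L1D f g : L1 f -> L1 g -> L1 (fun x => f x + g x).
Proof. by move=> f1 g1; exact: (integrableD measurableT f1 g1). Qed.

Lemma L1B f g : L1 f -> L1 g -> L1 (fun x => f x - g x).
Proof. by move=> f1 g1; exact: (integrableB measurableT f1 g1). Qed.

Lemma L1Z k f : L1 f -> L1 (fun x => k * f x).
Proof. by move=> f1; exact: (integrableZl measurableT k f1). Qed.

Lemma L1_norm f : L1 f -> L1 (fun x => `|f x|).
Proof. exact: integrable_norm. Qed.

Lemma L1_0 : L1 (fun=> 0).
Proof. exact: integrable0. Qed.

Lemma L1_sum (I : Type) (r : seq I) (P : pred I) (F : I -> R -> R) :
  (forall i, P i -> L1 (F i)) -> L1 (fun x => \sum_(i <- r | P i) F i x).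
Proof.
move=> h; elim: r => [|i r ih].
  by under eq_fun do rewrite big_nil; exact: L1_0.
under eq_fun do rewrite big_cons.
by case Pi: (P i) => //; apply: L1D => //; exact: h.
Qed.

Lemma intRD f g : L1 f -> L1 g -> intR (fun x => f x + g x) = intR f + intR g.
Proof. exact: RintegralD. Qed.

Lemma intRB f g : L1 f -> L1 g -> intR (fun x => f x - g x) = intR f - intR g.
Proof. exact: RintegralB. Qed.

Lemma intRZ k f : L1 f -> intR (fun x => k * f x) = k * intR f.
Proof. exact: RintegralZl. Qed.

Lemma intR0 : intR (fun=> 0) = 0.
Proof. by rewrite /intR Rintegral_cst// mul0r. Qed.

Lemma intR_sum (I : Type) (r : seq I) (P : pred I) (F : I -> R -> R) :
  (forall i, P i -> L1 (F i)) ->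
  intR (fun x => \sum_(i <- r | P i) F i x) = \sum_(i <- r | P i) intR (F i).
Proof.
move=> h; elim: r => [|i r ih].
  by under eq_fun do rewrite big_nil; rewrite big_nil intR0.
under eq_fun do rewrite big_cons; rewrite big_cons.
by case Pi: (P i) => //; rewrite -ih intRD//; [exact: h|exact: L1_sum].
Qed.

Lemma le_intR f g : L1 f -> L1 g -> (forall x, f x <= g x) ->
  intR f <= intR g.
Proof. by move=> f1 g1 fg; apply: le_Rintegral. Qed.

Lemma intR_ge0 f : (forall x, 0 <= f x) -> 0 <= intR f.
Proof. by move=> f0; apply: Rintegral_ge0. Qed.

Lemma norm_intR f : L1 f -> `|intR f| <= intR (fun x => `|f x|).
Proof. exact: le_normr_Rintegral. Qed.

Lemma intR_dct (f_ : nat -> R -> R) f g : L1 g ->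
  (forall n, measurable_fun setT (f_ n)) ->
  (forall x, (f_ ^~ x @ \oo) --> f x) ->
  (forall n x, `|f_ n x| <= g x) -> intR (f_ n) @[n --> \oo] --> intR f.
Proof.
move=> g1 mf ff fg.
have mf' : measurable_fun setT f.
  by apply: (measurable_fun_cvg mf) => x _; exact: ff.
have fgl x : `|f x| <= g x.
  have /cvg_lim <- // : `|f_ n x| @[n --> \oo] --> `|f x| by apply: cvg_norm.
  apply: limr_le; first by apply: is_cvg_norm; apply/cvg_ex; exists (f x).
  by apply: nearW.
have f1 : L1 f by exact: L1_dom fgl.
apply: fine_cvg; rewrite fineK; last exact: integrable_fin_num f1.
have := @dominated_cvg _ _ R lebesgue_measure setT measurableT
  (fun n x => (f_ n x)%:E) (EFin \o f) (EFin \o g); apply => //=.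
- by move=> n; apply/measurable_EFinP; exact: mf.
- by move=> x _; apply: cvg_EFin; [exact: nearW|exact: ff].
- by move=> n x _; rewrite lee_fin.
Qed.

Lemma measurable_shift (h : R) :
  measurable_fun setT (fun x : measurableTypeR R => (x + h : measurableTypeR R)).
Proof. exact: measurable_funD. Qed.

Lemma lebesgue_measure_shift (h : R) (A : set (measurableTypeR R)) :
  measurable A ->
  pushforward lebesgue_measure
    (fun x : measurableTypeR R => (x + h : measurableTypeR R)) A =
  lebesgue_measure A.
Proof.
move=> mA; have mh := measurable_shift h.
apply/esym/lebesgue_measure_unique => //= _ [[a b]] _ <-.
rewrite /pushforward.
have -> : (fun x => x + h) @^-1` `]a, b] = `]a - h, b - h]%classic.
  by apply/seteqP; split => x /=; rewrite !in_itv/= ltrBlDr lerBrDr.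
rewrite !lebesgue_measure_itv/= !lte_fin ltrD2r.
by case: ifP => // _; rewrite -!EFinD; congr EFin; ring.
Qed.

Lemma L1_shift (h : R) f : L1 f -> L1 (fun x => f (x + h)).
Proof.
move=> f1; have mf := L1_measurable f1.
have mfh : measurable_fun setT (fun x : R => f (x + h)).
  exact: (measurableT_comp mf (measurable_shift h)).
move/integrableP : f1 => [m1 i1].
apply/integrableP; split; first exact/measurable_EFinP.
apply: le_lt_trans i1.
have := @ge0_integral_pushforward _ _ _ _ R _ (measurable_shift h)
  lebesgue_measure setT (fun x => `|(f x)%:E|%E) measurableT.
move=> <- //; last first.
  by apply/measurable_EFinP; apply: measurableT_comp => //.
rewrite le_eqVlt; apply/orP; left; apply/eqP.
apply: eq_measure_integral => [|mh A mA _]; first exact: measurable_shift.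
exact: lebesgue_measure_shift.
Qed.

Lemma intR_shift (h : R) f : L1 f -> intR (fun x => f (x + h)) = intR f.
Proof.
move=> f1; have mf := L1_measurable f1.
congr fine.
have := @integral_pushforward _ _ _ _ R _ (measurable_shift h) lebesgue_measure
  setT (fun x => (f x)%:E) _ (L1_shift h f1) measurableT.
move=> /(_ _)/= <-; last exact/measurable_EFinP.
apply: eq_measure_integral => [|mh A mA _]; first exact: measurable_shift.
exact: lebesgue_measure_shift.
Qed.

Lemma is_derive_expRM (c x : R) :
  is_derive x 1 (fun x => expR (c * x)) (c * expR (c * x)).
Proof.
have h := @is_derive1_comp R expR (fun x => c * x) x _ _ (is_derive_expR _) _.
by apply: (is_derive_eq (h _ _)); rewrite /GRing.scale/= mulr1 mulrC.
Qed.

Lemma L1_expRNabs (a : R) : 0 < a -> L1 (fun x => expR (- (a * `|x|))).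
Proof.
move=> a0.
have cf : continuous (fun x : R => expR (- (a * `|x|))).
  move=> x; apply: continuous_comp; last exact: continuous_expR.
  apply: continuousN; apply: continuousM; first exact: cvg_cst.
  exact: norm_continuous.
apply/integrableP; split.
  by apply/measurable_EFinP; exact: continuous_measurable_fun.
under eq_integral => x _ do rewrite /= ger0_norm ?expR_ge0//.
rewrite ge0_symfun_integralT//=; last by move=> x; rewrite /= normrN.
  rewrite -set_itvcy.
  have hd (x : R) : is_derive x 1 (fun x : R => - a^-1 * expR (- (a * x))) (expR (- (a * x))).
    rewrite (_ : (fun _ => _) = (- a^-1) *: (fun x => expR (- a * x))); last first.
      by apply/funext => y; rewrite -[- (a * y)]mulNr.
    apply: (is_derive_eq (is_deriveZ _ (is_derive_expRM _ _))).
    by rewrite /GRing.scale/= mulrA mulrNN mulVf ?gt_eqF// mul1r mulNr.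
  rewrite (_ : (\int[_]_(x in _) _ = \int[lebesgue_measure]_(x in `[0%R, +oo[) (expR (- (a * x)))%:E)%E); last first.
    by apply: eq_integral => x; rewrite inE/= in_itv/= andbT => x0; rewrite ger0_norm.
  rewrite (@ge0_continuous_FTC2y _ _ (fun x => - a^-1 * expR (- (a * x))) 0 0)//.
  - by rewrite -EFinB -EFinM ltry.
  - apply: continuous_subspaceT => x; apply: continuous_comp; last exact: continuous_expR.
    by apply: continuousN; apply: continuousM; [exact: cvg_cst|exact: cvg_id].
  - rewrite -[X in _ --> X](mulr0 (- a^-1)); apply: cvgMr.
    have /cvg_comp : (fun x : R => a * x) x @[x --> +oo] --> +oo.
      by apply: gt0_cvgMry => //; exact: cvg_id.
    by move=> /(_ _ _ _ (@cvgr_expR R)).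
  - apply: cvgM; first exact: cvg_cst.
    apply: (@cvg_at_right_filter _ _ (fun x => expR (- (a * x)))).
    apply: continuous_comp; last exact: continuous_expR.
    by apply: continuousN; apply: continuousM; [exact: cvg_cst|exact: cvg_id].
  - by move=> x _; rewrite derive1E; case: (hd x).
Qed.

(** Substitution on the compact intervals [e^(- n), e^n] and [- n, n], followed by monotone
    convergence; with H >= 0 both sides may be infinite. *)
Lemma ge0_integral_expR (H : R -> R) :
  (forall t, 0 < t -> {for t, continuous H}) -> (forall t, 0 < t -> 0 <= H t) ->
  (\int[lebesgue_measure]_(t in `]0%R, +oo[) (H t / t)%:E =
   \int[lebesgue_measure]_v (H (expR v))%:E)%E.
Proof.
move=> cH H0.
have cG t : 0 < t -> {for t, continuous (fun t => H t / t)}.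
  move=> t0; apply: continuousM; first exact: cH.
  by apply: continuousV => //; rewrite gt_eqF.
have [U1 U2] : \bigcup_n `[expR (- n%:R : R), expR n%:R]%classic = `]0, +oo[%classic
  /\ \bigcup_n `[- n%:R : R, n%:R]%classic = setT.
  have key (v : R) : exists n : nat, - n%:R <= v <= n%:R.
    exists (Num.bound `|v|); have := archi_boundP (normr_ge0 v).
    by rewrite -ler_norml; exact: ltW.
  split; apply/seteqP; split => //.
  - by move=> x [n _] /=; rewrite !in_itv/= andbT => /andP[+ _]; apply: lt_le_trans; exact: expR_gt0.
  - move=> x /=; rewrite in_itv/= andbT => x0.
    have [n /andP[n1 n2]] := key (ln x).
    by exists n => //=; rewrite in_itv/= -(lnK x0) !ler_expR n1 n2.
  - by move=> x _; have [n ?] := key x; exists n => //=; rewrite in_itv.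
have mG : measurable_fun (`]0, +oo[%classic : set R) (fun t => H t / t).
  apply: open_continuous_measurable_fun => // t.
  by rewrite inE/= in_itv/= andbT => /cG.
have L : (fun n => \int[lebesgue_measure]_(t in `[expR (- n%:R : R), expR n%:R]) (H t / t)%:E)%E
   @ \oo --> (\int[lebesgue_measure]_(t in `]0%R, +oo[) (H t / t)%:E)%E.
  rewrite -U1; apply: ge0_nondecreasing_set_cvg_integral => //.
  - move=> n m nm; apply/subsetPset => x /=; rewrite !in_itv/= => /andP[nx xn].
    by rewrite (le_trans _ nx) ?(le_trans xn)// ler_expR ?lerN2 ler_nat.
  - move=> n; apply/measurable_EFinP; apply: measurable_funS mG => // x /=; rewrite !in_itv/= andbT => /andP[+ _].
    by apply: lt_le_trans; exact: expR_gt0.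
  - move=> n x /=; rewrite in_itv/= => /andP[nx _].
    have x0 : 0 < x by apply: lt_le_trans nx; exact: expR_gt0.
    by rewrite lee_fin divr_ge0 ?H0 ?ltW.
have cHe : continuous (fun v => H (expR v)).
  move=> v; apply: continuous_comp; first exact: continuous_expR.
  exact/cH/expR_gt0.
pose I (n : nat) : set R := `[- n%:R, n%:R]%classic.
have L' : (fun n => \int[lebesgue_measure]_(v in I n) (H (expR v))%:E)%E
   @ \oo --> (\int[lebesgue_measure]_v (H (expR v))%:E)%E.
  rewrite -U2; apply: ge0_nondecreasing_set_cvg_integral => //.
  - move=> n m nm; apply/subsetPset => x; rewrite /I /= !in_itv/= => /andP[nx xn].
    by rewrite (le_trans _ nx) ?(le_trans xn)// ?lerN2 ler_nat.
  - by move=> n; exact: measurable_itv.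
  - by move=> n; apply/measurable_EFinP/measurable_funTS; exact: continuous_measurable_fun.
  - by move=> n x _; rewrite lee_fin H0 ?expR_gt0.
suff EI : (fun n => \int[lebesgue_measure]_(t in `[expR (- n%:R : R), expR n%:R]) (H t / t)%:E)%E
    = (fun n => \int[lebesgue_measure]_(v in I n) (H (expR v))%:E)%E.
  by rewrite EI in L; exact: (cvg_unique (@ereal_hausdorff R) L L').
apply/funext => n.
have dE : derive1 (@expR R) = expR by apply/funext => x; rewrite derive1E derive_val.
rewrite (@integration_by_substitution_increasing _ expR (fun t => H t / t) (- n%:R) n%:R)//.
- apply: eq_integral => v _; rewrite dE /=.
  by rewrite fctE mulfVK// gt_eqF ?expR_gt0.
- by rewrite -subr_ge0 opprK addr_ge0.
- by move=> x y _ _; rewrite ltr_expR.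
- by rewrite dE => x _; exact: continuous_expR.
- by rewrite dE; apply/cvg_ex; exists (expR (- n%:R)); apply: cvg_at_right_filter; exact: continuous_expR.
- by rewrite dE; apply/cvg_ex; exists (expR n%:R); apply: cvg_at_left_filter; exact: continuous_expR.
- split.
  + by move=> x _.
  + by apply: cvg_at_right_filter; exact: continuous_expR.
  + by apply: cvg_at_left_filter; exact: continuous_expR.
- apply: continuous_in_subspaceT => t; rewrite inE/= in_itv/= => /andP[nt _].
  by apply: cG; apply: lt_le_trans nt; exact: expR_gt0.
Qed.

(** Positive and negative parts are substituted separately, so the equality holds whether or not the
    integrals converge. *)
Lemma Rintegral_expR (F : R -> R) : (forall t, 0 < t -> {for t, continuous F}) ->
  (\int[lebesgue_measure]_(t in `]0%R, +oo[) (F t / t))%R =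
  intR (fun v => F (expR v)).
Proof.
move=> cF; congr fine; rewrite [LHS]integralE [RHS]integralE.
have h1 := @ge0_integral_expR (fun t => Num.max (F t) 0).
have h2 := @ge0_integral_expR (fun t => Num.max (- F t) 0).
congr (_ - _)%E.
- apply: (etrans _ (etrans (h1 _ _) _)).
  + apply: eq_integral => t; rewrite inE/= in_itv/= andbT => t0.
    by rewrite funeposE -EFin_max maxr_pMl ?mul0r// ?invr_ge0 ?ltW.
  + by move=> t t0; apply: continuous_max; [exact: cF|exact: cvg_cst].
  + by move=> t t0; rewrite le_max lexx orbT.
  + by apply: eq_integral => t _; rewrite funeposE -EFin_max.
- apply: (etrans _ (etrans (h2 _ _) _)).
  + apply: eq_integral => t; rewrite inE/= in_itv/= andbT => t0.
    by rewrite funenegE -EFinN -EFin_max -mulNr maxr_pMl ?mul0r// ?invr_ge0 ?ltW.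
  + move=> t t0; apply: continuous_max; last exact: cvg_cst.
    by apply: continuousN; exact: cF.
  + by move=> t t0; rewrite le_max lexx orbT.
  + by apply: eq_integral => t _; rewrite funenegE -EFinN -EFin_max.
Qed.

Lemma measurable_lt (a : R) :
  measurable_fun setT (fun v : R => (v < a)%R%:R : R).
Proof.
rewrite (_ : (fun _ => _) = \1_(`]-oo, a[%classic : set R)); last first.
  by apply/funext => v; rewrite indicE mem_setE.
exact: measurable_indic.
Qed.

Lemma itv_indicE (a b : R) :
  (fun v : R => (a <= v < b)%R%:R : R) = \1_(`[a, b[%classic : set R).
Proof. by apply/funext => v; rewrite indicE mem_setE. Qed.

Lemma L1_itv (a b : R) : L1 (fun v => (a <= v < b)%R%:R).
Proof. by rewrite itv_indicE; exact: integrable_indic_itv. Qed.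

Lemma intR_itv (a b : R) : a <= b -> intR (fun v => (a <= v < b)%R%:R) = b - a.
Proof.
move=> ab; rewrite itv_indicE /intR /Rintegral integral_indic// setIT.
rewrite (etrans (congr1 fine (lebesgue_measure_itv _)) erefl)/= lte_fin.
case: ltP => //=.
by move=> ba; apply/esym/eqP; rewrite subr_eq0 eq_le ba ab.
Qed.

(* With v = ln t these are e^-t and e^-t - 1_{t < 1}: the Mellin transform of Gum
   is Gamma, and Gum0 is integrable with respect to dv. *)
Definition Gum (v : R) := expR (- expR v).

Definition Gum0 (v : R) := Gum v - (v < 0)%R%:R.

Lemma continuous_Gum : continuous Gum.
Proof.
move=> x; apply: continuous_comp; last exact: continuous_expR.
by apply: continuousN; exact: continuous_expR.
Qed.

Lemma Gum0_le v : `|Gum0 v| <= expR (- `|v|).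
Proof.
have h := expR_ge1Dx (- expR v); have h1 : Gum v <= 1.
  by rewrite /Gum expR_le1 oppr_le0 expR_ge0.
rewrite /Gum0; have [v0|v0] := ltP v 0.
  rewrite /= ler0_norm ?subr_le0// [`|v|]ltr0_norm// opprK opprB /Gum.
  lra.
rewrite subr0 !ger0_norm ?expR_ge0// /Gum ler_expR lerN2.
by have := expR_ge1Dx v; lra.
Qed.

Lemma L1_Gum0 : L1 Gum0.
Proof.
apply: (@L1_dom (fun v => expR (- (1 * `|v|)))); first exact: L1_expRNabs.
  apply: measurable_funB; last exact: measurable_lt.
  by apply: continuous_measurable_fun; exact: continuous_Gum.
by move=> v; rewrite mul1r Gum0_le.
Qed.

(** Frullani's integral: with h = ln x the second term is [Gum (v + h)]. The two translates of
    [Gum0] have equal integrals and cancel; what remains is the signed indicator of the interval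
    between - h and 0, of integral h. *)
Lemma ln_intR (x : R) : 0 < x ->
  L1 (fun v => Gum v - expR (- (x * expR v))) /\
  intR (fun v => Gum v - expR (- (x * expR v))) = ln x.
Proof.
move=> x0; set h := ln x.
have E v : Gum v - expR (- (x * expR v)) =
   (Gum0 v - Gum0 (v + h)) + ((- h <= v < 0)%R%:R - (0 <= v < - h)%R%:R).
  rewrite /Gum0 /Gum expRD lnK// [expR v * x]mulrC.
  have [v0|v0] := ltP v 0; have [vh|vh] := ltP (v + h) 0.
  - rewrite -ltrBrDr sub0r in vh; rewrite [- h <= _]leNgt vh/=.
    lra.
  - rewrite -lerBlDr sub0r in vh. rewrite vh/=; lra.
  - rewrite -ltrBrDr sub0r in vh. rewrite vh andbF/=; lra.
  - rewrite -lerBlDr sub0r in vh. rewrite andbF ltNge vh/=; lra.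
have i1 := L1_Gum0; have i2 := L1_shift h L1_Gum0.
have i3 := L1B i1 i2.
have i4 := L1B (L1_itv (- h) 0) (L1_itv 0 (- h)).
rewrite (funext E); split; first exact: L1D.
rewrite (intRD i3 i4) (intRB i1 i2) intR_shift// (intRB (L1_itv _ _) (L1_itv _ _)).
rewrite subrr add0r; have [h0|h0] := leP 0 h.
  rewrite intR_itv ?oppr_le0// (_ : (fun v => (0 <= v < - h)%R%:R) = fun=> 0) ?intR0; first by ring.
  apply/funext => v; case: (lerP 0 v) => //= v0.
  by rewrite (_ : (v < - h)%R = false)//; apply/negbTE; rewrite -leNgt; lra.
rewrite [X in _ - X]intR_itv; last by rewrite oppr_ge0 ltW.
rewrite (_ : (fun v => (- h <= v < 0)%R%:R) = fun=> 0) ?intR0; first by ring.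
apply/funext => v; case: (lerP (- h) v) => //= v0.
by rewrite (_ : (v < 0)%R = false)//; apply/negbTE; rewrite -leNgt; lra.
Qed.

End integration.

(** * Lazy random walk *)

Section lazy_walk.
Variable R : realType.
Implicit Types (tau w : R) (c : nat -> R).

(* The law of the distance to the origin of a lazy random walk on Z, each value
   k > 0 being counted once instead of twice. *)
Fixpoint lazy_walk tau (N k : nat) {struct N} : R :=
  if N is N'.+1 then
    if k is k'.+1 then (1 - 2 * tau) * lazy_walk tau N' k +
        tau * (lazy_walk tau N' k' + lazy_walk tau N' k.+1)
    else (1 - 2 * tau) * lazy_walk tau N' 0 + 2 * tau * lazy_walk tau N' 1
  else (k == 0%N)%:R.

Lemma lazy_walk_out tau N k : (N < k)%N -> lazy_walk tau N k = 0.
Proof.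
elim: N k => [|N ih] [|k]//= Nk.
by rewrite !ih ?(addr0, mulr0)//; lia.
Qed.

Lemma lazy_walk_ge0 tau N k : 0 <= tau <= 3^-1 -> 0 <= lazy_walk tau N k.
Proof.
move=> /andP[t0 t3]; elim: N k => [|N ih] [|k]//=.
  by apply: addr_ge0; apply: mulr_ge0 => //; lra.
apply: addr_ge0; apply: mulr_ge0 => //; first lra.
exact: addr_ge0.
Qed.

(** One step preserves monotonicity. The bound 1/3 comes from the origin, where the new difference
    is (1 - 3 tau) (p 0 - p 1) + tau (p 1 - p 2); for k > 0 the bound 1/2 would do. *)
Lemma lazy_walk_le1 tau N k : 0 <= tau <= 3^-1 ->
  lazy_walk tau N k.+1 <= lazy_walk tau N k.
Proof.
move=> /andP[t0 t3]; elim: N k => [|N ih] [|k]//=.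
  by have h1 := ih 0%N; have h2 := ih 1%N; nra.
by have h0 := ih k; have h1 := ih k.+1; have h2 := ih k.+2; nra.
Qed.

Lemma lazy_walk_le tau N k l : 0 <= tau <= 3^-1 -> (k <= l)%N ->
  lazy_walk tau N l <= lazy_walk tau N k.
Proof.
move=> t03 /subnK <-; elim: (l - k)%N => // j ih.
by rewrite addSn (le_trans _ ih)// lazy_walk_le1.
Qed.

(** The even extension of c to Z is an eigenvector of the one-step operator, with eigenvalue 1 - 2
    tau + tau w; [2 * c 1 = w * c 0] is the recurrence at 0. Cosines give the characteristic
    function of the walk, and y^k + y^(- k) its exponential moments. M is any cutoff beyond the
    support. *)
Lemma lazy_walk_gf tau c w N M :
  (forall k, c k.+2 + c k = w * c k.+1) -> 2 * c 1%N = w * c 0%N -> (N <= M)%N ->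
  lazy_walk tau N 0 * c 0%N + 2 * \sum_(k < M) lazy_walk tau N k.+1 * c k.+1 =
  c 0%N * (1 - 2 * tau + tau * w) ^+ N.
Proof.
move=> cS c1; elim: N => [|N ih] NM.
  rewrite big1; last by move=> i _; rewrite lazy_walk_out// mul0r.
  by rewrite /= mulr0 addr0 expr0 mulr1 mul1r.
have {}ih := ih (ltnW NM).
rewrite exprSr mulrA -ih.
case: M NM ih => // M NM _; set p := lazy_walk tau N.
have E1 : \sum_(k < M.+1) p k * c k.+1 = p 0%N * c 1%N + \sum_(k < M.+1) p k.+1 * c k.+2.
  rewrite big_ord_recl/= [in RHS]big_ord_recr/= [p M.+1]lazy_walk_out; last lia.
  by rewrite mul0r addr0.
have E2 : \sum_(k < M.+1) p k.+1 * c k = p 1%N * c 0%N + \sum_(k < M.+1) p k.+2 * c k.+1.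
  rewrite big_ord_recl/= [in RHS]big_ord_recr/= [p M.+2]lazy_walk_out; last lia.
  by rewrite mul0r addr0.
have E3 : \sum_(k < M.+1) p k.+1 * c k.+2 + \sum_(k < M.+1) p k.+1 * c k =
    w * \sum_(k < M.+1) p k.+1 * c k.+1.
  by rewrite -big_split mulr_sumr; apply: eq_bigr => i _ /=; rewrite -mulrDr cS; ring.
rewrite [\sum_(k < M.+1) lazy_walk tau N.+1 k.+1 * c k.+1](_ : _ =
    (1 - 2 * tau) * \sum_(k < M.+1) p k.+1 * c k.+1 +
    tau * (\sum_(k < M.+1) p k * c k.+1 + \sum_(k < M.+1) p k.+2 * c k.+1)); last first.
  rewrite -big_split/= !mulr_sumr -big_split; apply: eq_bigr => i _ /=.
  by rewrite -/p; ring.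
rewrite /= -/p.
have -> : \sum_(k < M.+1) p k * c k.+1 + \sum_(k < M.+1) p k.+2 * c k.+1 =
   p 0%N * c 1%N - p 1%N * c 0%N + w * \sum_(k < M.+1) p k.+1 * c k.+1.
  by rewrite -E3 E1 E2; ring.
have c1' : c 1%N = w * c 0%N / 2 by rewrite -c1; field.
by rewrite c1'; field.
Qed.

Lemma lazy_walk_cos tau (x : R) N M : (N <= M)%N ->
  lazy_walk tau N 0 + 2 * \sum_(k < M) lazy_walk tau N k.+1 * cos (k.+1%:R * x) =
  (1 - tau * (2 - 2 * cos x)) ^+ N.
Proof.
move=> NM; have := @lazy_walk_gf tau (fun k => cos (k%:R * x)) (2 * cos x) N M _ _ NM.
rewrite !(mul0r, cos0, mulr1, mul1r) => -> //.
- by congr (_ ^+ _); ring.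
- move=> k; have -> : k.+2%:R * x = k.+1%:R * x + x by rewrite -natr1; ring.
  have -> : k%:R * x = k.+1%:R * x - x by rewrite -natr1; ring.
  by rewrite cosD cosB; ring.
Qed.

Lemma lazy_walk_exp tau (y : R) N M : 0 < y -> (N <= M)%N ->
  lazy_walk tau N 0 + \sum_(k < M) lazy_walk tau N k.+1 * (y ^+ k.+1 + y ^- k.+1) =
  (1 + tau * (y + y^-1 - 2)) ^+ N.
Proof.
move=> y0 NM.
have := @lazy_walk_gf tau (fun k => y ^+ k + y ^- k) (y + y^-1) N M _ _ NM.
rewrite expr0 invr1 => h.
(* Here c 0 = 1 + 1, so the general identity is twice the wanted one. *)
suff : 2 * (lazy_walk tau N 0 + \sum_(k < M) lazy_walk tau N k.+1 * (y ^+ k.+1 + y ^- k.+1)) =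
   2 * (1 + tau * (y + y^-1 - 2)) ^+ N by apply: mulfI.
rewrite mulrDr mulrC -[2]/(1+1) h.
- by congr (_ * _ ^+ _); ring.
- by move=> k; rewrite !exprS; field; rewrite expf_neq0 gt_eqF.
- by rewrite expr1; ring.
Qed.

Lemma sum_blocks (F : nat -> R) h J :
  \sum_(j < J) \sum_(i < h) F (h * j + i)%N = \sum_(k < h * J) F k.
Proof.
elim: J => [|J ih]; first by rewrite muln0 !big_ord0.
by rewrite big_ord_recr/= ih mulnS addnC big_split_ord.
Qed.

(** Chernoff's bound, sharpened by monotonicity: with h = m./2 the value at m (j + 1) is at most
    each of the h values from h (j + 1) on. These blocks are disjoint and lie beyond h, so h times
    the sum is at most the mass beyond h, which the weight y^k controls. The factor m./2 so gained
    pays for the factor m of [lazy_walk_avg]. *)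
Lemma lazy_walk_tail tau (y : R) N m J : (1 < m)%N -> 0 <= tau <= 3^-1 -> 1 <= y ->
  (m./2)%:R * \sum_(j < J) lazy_walk tau N (m * j.+1)%N <=
  y ^- m./2 * expR (N%:R * tau * (y + y^-1 - 2)).
Proof.
move=> m1 t03 y1; have y0 : 0 < y by lra.
set h := m./2; have h0 : (0 < h)%N by rewrite /h; lia.
set p := lazy_walk tau N; have p0 k : 0 <= p k by exact: lazy_walk_ge0.
have S1 : h%:R * \sum_(j < J) p (m * j.+1)%N <= \sum_(k < h * J) p (h + k)%N.
  rewrite mulr_sumr -(sum_blocks (fun k => p (h + k)%N)); apply: ler_sum => j _.
  rewrite mulr_natl -[h in X in X <= _]card_ord -sumr_const; apply: ler_sum => i _.
  apply: lazy_walk_le => //; have := ltn_ord i; rewrite /h; nia.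
apply: (le_trans S1).
have S2 : \sum_(k < h * J) p (h + k)%N <=
    y ^- h * \sum_(k < h * J) p (h + k)%N * (y ^+ (h + k) + y ^- (h + k)).
  rewrite mulr_sumr; apply: ler_sum => k _.
  have -> : y ^- h * (p (h + k)%N * (y ^+ (h + k) + y ^- (h + k))) =
     p (h + k)%N * (y ^+ k + y ^- h * y ^- (h + k)).
    by rewrite exprD; field; rewrite !expf_neq0 ?gt_eqF.
  rewrite ler_peMr// (le_trans (_ : 1 <= y ^+ k)) ?exprn_ege1// lerDl.
  by rewrite mulr_ge0// invr_ge0 exprn_ge0// ltW.
apply: (le_trans S2); apply: ler_wpM2l.
  by rewrite invr_ge0 exprn_ge0// ltW.
set M := (N + h + h * J)%N.
have S3 : \sum_(k < h * J) p (h + k)%N * (y ^+ (h + k) + y ^- (h + k)) <=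
    \sum_(k < M) p k.+1 * (y ^+ k.+1 + y ^- k.+1).
  set F := fun k => p k * (y ^+ k + y ^- k).
  have F0 k : 0 <= F k by rewrite mulr_ge0// addr_ge0// ?invr_ge0 exprn_ge0// ltW.
  rewrite -[X in X <= _]/(\sum_(k < h * J) F (h + k)%N) -[X in _ <= X]/(\sum_(k < M) F k.+1).
  rewrite -(big_mkord xpredT (fun k => F (h + k)%N)) -(big_mkord xpredT (fun k => F k.+1)).
  rewrite (_ : \sum_(0 <= i < h * J) F (h + i)%N = \sum_(h.-1 <= i < h.-1 + h * J) F i.+1); last first.
    rewrite [RHS](_ : _ = \sum_(0 + h.-1 <= i < h.-1 + h * J) F i.+1)%R//.
    by rewrite big_addn addKn; apply: eq_bigr => i _; congr F; lia.
  rewrite (@big_cat_nat _ _ _ h.-1 0 M)//=; last by rewrite /M; lia.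
  rewrite (@big_cat_nat _ _ _ (h.-1 + h * J)%N h.-1 M)//=; [|lia|by rewrite /M; lia].
  by rewrite addrCA lerDl addr_ge0// sumr_ge0.
apply: (le_trans S3).
have NM : (N <= M)%N by rewrite /M; lia.
have := lazy_walk_exp tau y0 NM; rewrite -/p => E.
have : \sum_(k < M) p k.+1 * (y ^+ k.+1 + y ^- k.+1) <= (1 + tau * (y + y^-1 - 2)) ^+ N.
  by rewrite -E lerDr.
move=> /le_trans; apply.
rewrite -mulrA expRM_natl lerXn2r ?nnegrE ?expR_ge0//; last exact: expR_ge1Dx.
rewrite addr_ge0// mulr_ge0//; first by case/andP: t03.
have -> : y + y^-1 - 2 = (y - 1) ^+ 2 / y by field; rewrite gt_eqF.
by rewrite divr_ge0 ?sqr_ge0// ltW.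
Qed.

(** * Characters of the cycle and the method of images *)

Lemma cosD2piMn (x : R) (k : nat) : cos (x + k%:R * (2 * pi)) = cos x.
Proof. by rewrite [2 * pi]mulr_natl mulr_natl; exact: (periodicn (@cosD2pi R)). Qed.

Lemma sinD2piMn (x : R) (k : nat) : sin (x + k%:R * (2 * pi)) = sin x.
Proof. by rewrite [2 * pi]mulr_natl mulr_natl; exact: (periodicn (@sinD2pi R)). Qed.

(** Rotation by x permutes the m summands cyclically, hence fixes the vector (C, S); a rotation with
    cos x != 1 fixes only 0. *)
Lemma sum_cos_sin_eq0 (x : R) m : cos x != 1 -> cos (m%:R * x) = 1 ->
  \sum_(a < m) cos (a%:R * x) = 0 /\ \sum_(a < m) sin (a%:R * x) = 0.
Proof.
move=> x1 mx; have smx : sin (m%:R * x) = 0.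
  by apply: cos1sin0; rewrite mx normr1.
set C := \sum_(a < m) _; set S := \sum_(a < m) _.
have EC : C = C * cos x - S * sin x.
  have -> : C * cos x - S * sin x = \sum_(a < m) cos (a.+1%:R * x).
    rewrite !mulr_suml -sumrB; apply: eq_bigr => i _.
    by rewrite -natr1 mulrDl mul1r cosD.
  have : \sum_(a < m.+1) cos (a%:R * x) = \sum_(a < m.+1) cos (a%:R * x) by [].
  by rewrite {1}big_ord_recr big_ord_recl/= mx mul0r cos0 addrC => /addrI.
have ES : S = S * cos x + C * sin x.
  have -> : S * cos x + C * sin x = \sum_(a < m) sin (a.+1%:R * x).
    rewrite !mulr_suml -big_split; apply: eq_bigr => i _ /=.
    by rewrite -natr1 mulrDl mul1r sinD.
  have : \sum_(a < m.+1) sin (a%:R * x) = \sum_(a < m.+1) sin (a%:R * x) by [].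
  by rewrite {1}big_ord_recr big_ord_recl/= smx mul0r sin0 addrC => /addrI.
have : (C ^+ 2 + S ^+ 2) * (1 - cos x) = 0.
  have e1 : C * (C * cos x - S * sin x) = C * C by rewrite -EC.
  have e2 : S * (S * cos x + C * sin x) = S * S by rewrite -ES.
  nra.
move/eqP; rewrite mulf_eq0 subr_eq0 eq_sym [1 == _]eq_sym (negbTE x1) orbF eq_sym.
by rewrite paddr_eq0 ?sqr_ge0// !sqrf_eq0 => /andP[/eqP -> /eqP ->].
Qed.

Lemma cos_neq1 (x : R) : 0 < x < 2 * pi -> cos x != 1.
Proof.
move=> x02; have : 0 < sin (x / 2) by apply: sin_gt0_pi; lra.
have -> : cos x = 1 - 2 * sin (x / 2) ^+ 2.
  have -> : cos x = cos (x / 2 + x / 2) by congr cos; field.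
  by rewrite cosD -!expr2 cos2sin2; ring.
by move=> s0; rewrite lt_eqF//; have := exprn_gt0 2 s0; lra.
Qed.

Lemma sum_cos_nat m k : (0 < m)%N ->
  \sum_(a < m) cos (k%:R * (2 * pi * a%:R / m%:R)) = (m %| k)%N%:R * m%:R :> R.
Proof.
move=> m0; have m0' : m%:R != 0 :> R by rewrite pnatr_eq0 -lt0n.
have E (a : nat) : k%:R * (2 * pi * a%:R / m%:R) = a%:R * (k%:R * (2 * pi) / m%:R) :> R by ring.
under eq_bigr do rewrite E.
case: (boolP (m %| k)%N) => [/dvdnP[q ->]|mk].
  rewrite mul1r -[in RHS](card_ord m) -sumr_const; apply: eq_bigr => a _.
  have -> : a%:R * ((q * m)%N%:R * (2 * pi) / m%:R) = 0 + (a * q)%N%:R * (2 * pi) :> R.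
    by rewrite !natrM; field.
  by rewrite cosD2piMn cos0.
rewrite mul0r; apply: (proj1 (sum_cos_sin_eq0 _ _)).
  have -> : k%:R * (2 * pi) / m%:R = 2 * pi * (k %% m)%:R / m%:R + (k %/ m)%:R * (2 * pi) :> R.
    by rewrite {1}(divn_eq k m) natrD natrM; field.
  rewrite cosD2piMn; apply: cos_neq1; have p0 := @pi_gt0 R.
  have r0 : (0 < k %% m)%N by rewrite lt0n.
  rewrite divr_gt0 ?mulr_gt0 ?ltr0n//= ltr_pdivrMr ?ltr0n// ltr_pM2l ?mulr_gt0//.
  by rewrite ltr_nat ltn_pmod.
have -> : m%:R * (k%:R * (2 * pi) / m%:R) = 0 + k%:R * (2 * pi) :> R by field.
by rewrite cosD2piMn cos0.
Qed.

(** Method of images: averaging the characteristic function over the characters of Z / m keeps the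
    mass on the multiples of m. The condition N <= m J makes the truncated sum cover the whole
    support. *)
Lemma lazy_walk_avg tau N m J : (0 < m)%N -> (N <= m * J)%N ->
  \sum_(a < m) (1 - tau * (2 - 2 * cos (2 * pi * a%:R / m%:R))) ^+ N =
  m%:R * (lazy_walk tau N 0 + 2 * \sum_(j < J) lazy_walk tau N (m * j.+1)%N).
Proof.
move=> m0 NM; under eq_bigr do rewrite -(lazy_walk_cos _ _ NM).
rewrite big_split/= sumr_const card_ord -[_ *+ m]mulr_natr -mulr_sumr exchange_big/=.
rewrite (_ : \sum_(i < _) _ = \sum_(k < m * J) lazy_walk tau N k.+1 * ((m %| k.+1)%N%:R * m%:R)); last first.
  by apply: eq_bigr => k _; rewrite -mulr_sumr sum_cos_nat.
rewrite -(sum_blocks (fun k => lazy_walk tau N k.+1 * ((m %| k.+1)%N%:R * m%:R))).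
rewrite (_ : \sum_(j < J) _ = \sum_(j < J) lazy_walk tau N (m * j.+1)%N * m%:R); last first.
  apply: eq_bigr => j _; case: m m0 {NM} => // m _.
  rewrite big_ord_recr/= big1 ?add0r => [|i _].
    by rewrite -addnS -mulnSr dvdn_mulr// mul1r.
  rewrite -addnS dvdn_addr ?dvdn_mulr// gtnNdvd ?mul0r ?mulr0//.
  by rewrite ltnS.
by rewrite -mulr_suml; ring.
Qed.

End lazy_walk.

(** * Spectrum of the discrete torus *)

Section torus_spectrum.
Variable R : realType.

(** Expansion of a product of sums whose index sets depend on i: the choice functions are
    transported to functions into the disjoint union of the ['I_(m i)], where [bigA_distr_big_dep]
    applies. *)
Lemma big_torus_distr r (m : 'I_r -> nat) (F : forall i, 'I_(m i) -> R) :
  \sum_(x : torus m) \prod_(i < r) F i (x i) = \prod_(i < r) \sum_(k < m i) F i k.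
Proof.
rewrite (reindex _ (onW_bij _ (@dffun_of_fprod_bij _ (fun i => 'I_(m i))))).
transitivity (\prod_(i < r) \sum_(j in tagged_with (fun i => 'I_(m i)) i) untag 0 (F i) j); last first.
  by apply: eq_bigr => i _; rewrite -(big_tag F).
rewrite (bigA_distr_big_dep (fun i => tagged_with (fun i => 'I_(m i)) i)
  (fun i j => untag 0 (F i) j)).
have := @big_fprod R 0 1 *%R +%R _ _ (fun i => [ffun k => F i k]).
move=> E; apply: (etrans _ (etrans E _)).
  apply: eq_bigr => f _; apply: eq_bigr => i _.
  by rewrite /dffun_of_fprod !ffunE.
apply: eq_bigr => g _; apply: eq_bigr => i _; congr untag.
by apply/funext => k; rewrite ffunE.
Qed.

(* cas diagonalises the Laplacian over the reals: the functions
   x |-> prod_i cas (2 pi x_i j_i / m_i) are an orthogonal basis of eigenvectors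
   indexed by j, which cosines and sines alone are not. *)
Definition cas (x : R) := cos x + sin x.

Lemma casM (x y : R) : cas x * cas y = cos (x - y) + sin (x + y).
Proof. by rewrite /cas cosB sinD; ring. Qed.

Lemma cas_addsub (x y : R) : cas (x + y) + cas (x - y) = 2 * cos y * cas x.
Proof. by rewrite /cas cosD sinD cosB sinB; ring. Qed.

Lemma cas_modn (m j k : nat) : (0 < m)%N ->
  cas ((k %% m)%:R * (2 * pi * j%:R / m%:R)) = cas (k%:R * (2 * pi * j%:R / m%:R)).
Proof.
move=> m0; have m0' : m%:R != 0 :> R by rewrite pnatr_eq0 -lt0n.
have -> : k%:R * (2 * pi * j%:R / m%:R) =
    (k %% m)%:R * (2 * pi * j%:R / m%:R) + (k %/ m * j)%N%:R * (2 * pi) :> R.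
  by rewrite {1}(divn_eq k m) natrD !natrM; field.
by rewrite /cas cosD2piMn sinD2piMn.
Qed.

(** By [casM] the sum splits into a cosine sum in j - k and a sine sum in j + k. The sine sum always
    vanishes: it is a full sum over the group, or else each of its terms is 0. The cosine sum
    vanishes unless j = k. *)
Lemma cas_orthogonal (m : nat) (j k : 'I_m) :
  \sum_(a < m) cas (a%:R * (2 * pi * j%:R / m%:R)) * cas (a%:R * (2 * pi * k%:R / m%:R)) =
  (j == k)%:R * m%:R.
Proof.
have m0 : (0 < m)%N by apply: leq_ltn_trans (ltn_ord j).
have m0' : m%:R != 0 :> R by rewrite pnatr_eq0 -lt0n.
have p0 := @pi_gt0 R.
have E1 (a : nat) : a%:R * (2 * pi * j%:R / m%:R) - a%:R * (2 * pi * k%:R / m%:R) =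
    a%:R * (2 * pi * (j%:R - k%:R) / m%:R) :> R by ring.
have E2 (a : nat) : a%:R * (2 * pi * j%:R / m%:R) + a%:R * (2 * pi * k%:R / m%:R) =
    a%:R * (2 * pi * (j + k)%N%:R / m%:R) :> R by rewrite natrD; ring.
under eq_bigr do rewrite casM E1 E2.
rewrite big_split/= [X in _ + X](_ : _ = 0) ?addr0; last first.
  set x := 2 * pi * (j + k)%N%:R / m%:R.
  have mx : m%:R * x = 0 + (j + k)%N%:R * (2 * pi) by rewrite /x; field.
  have [x1|x1] := eqVneq (cos x) 1; last first.
    by apply: (proj2 (sum_cos_sin_eq0 x1 _)); rewrite mx cosD2piMn cos0.
  have sx : sin x = 0 by apply: cos1sin0; rewrite x1 normr1.
  have : forall a : nat, sin (a%:R * x) = 0 /\ cos (a%:R * x) = 1.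
    elim=> [|a [ih1 ih2]]; first by rewrite mul0r sin0 cos0.
    by rewrite -natr1 mulrDl mul1r sinD cosD ih1 ih2 sx x1; split; ring.
  by move=> h; rewrite big1// => a _; rewrite (h a).1.
have [->|jk] := eqVneq j k.
  rewrite mul1r -[in RHS](card_ord m) -sumr_const; apply: eq_bigr => a _.
  by rewrite subrr mulr0 mul0r mulr0 cos0.
rewrite mul0r; set x := 2 * pi * (j%:R - k%:R) / m%:R.
have key (j' k' : 'I_m) : (k' < j')%N -> cos (2 * pi * (j'%:R - k'%:R) / m%:R) != 1 :> R.
  move=> kj; apply: cos_neq1; rewrite -natrB ?(ltnW kj)//.
  rewrite divr_gt0 ?mulr_gt0 ?ltr0n ?subn_gt0//= ltr_pdivrMr ?ltr0n// ltr_pM2l ?mulr_gt0//.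
  by rewrite ltr_nat (leq_ltn_trans (leq_subr _ _)).
apply: (proj1 (sum_cos_sin_eq0 _ _)).
  have [?|kj|/val_inj e] := ltngtP j k; [|exact: key|by rewrite e eqxx in jk].
  by rewrite -cosN (_ : - x = 2 * pi * (k%:R - j%:R) / m%:R) ?key// /x; ring.
have -> : m%:R * x = 2 * pi * (j%:R - k%:R) by rewrite /x; field.
have -> : 2 * pi * (j%:R - k%:R) = (0 + j%:R * (2 * pi)) - (0 + k%:R * (2 * pi)) :> R by ring.
by rewrite cosB !cosD2piMn !sinD2piMn cos0 sin0; ring.
Qed.

Section torus.
Variables (r : nat) (m : 'I_r -> nat).
Hypothesis m_gt0 : forall i, (0 < m i)%N.

Definition hartley (j x : torus m) : R :=
  \prod_(i < r) cas ((x i)%:R * (2 * pi * (j i)%:R / (m i)%:R)).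

Lemma hartley_orthogonal (j k : torus m) :
  \sum_x hartley j x * hartley k x = (j == k)%:R * \prod_(i < r) (m i)%:R.
Proof.
have E (x : torus m) : hartley j x * hartley k x = \prod_(i < r)
    (cas ((x i)%:R * (2 * pi * (j i)%:R / (m i)%:R)) *
     cas ((x i)%:R * (2 * pi * (k i)%:R / (m i)%:R))) by rewrite big_split.
rewrite (eq_bigr _ (fun x _ => E x)).
rewrite (big_torus_distr (fun i (a : 'I_(m i)) =>
  cas (a%:R * (2 * pi * (j i)%:R / (m i)%:R)) * cas (a%:R * (2 * pi * (k i)%:R / (m i)%:R)))).
under eq_bigr do rewrite cas_orthogonal.
rewrite big_split/=; congr (_ * _).
have [->|jk] := eqVneq j k; first by rewrite big1// => i _; rewrite eqxx.
have [i ji] : exists i, j i != k i.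
  apply/existsP; apply: contraR jk; rewrite negb_exists => /forallP h.
  by apply/eqP/ffunP => i; apply/eqP; have := h i; rewrite negbK.
by rewrite (bigD1 i)//= (negbTE ji) mul0r.
Qed.

Lemma laplacian_hartley (j x : torus m) :
  laplacian (hartley j) x = torus_eigenvalue R j * hartley j x.
Proof.
rewrite /laplacian /torus_eigenvalue.
have E i : 2 * hartley j x - hartley j (torus_add i x) - hartley j (torus_sub i x) =
    (2 - 2 * cos (2 * pi * (j i)%:R / (m i)%:R)) * hartley j x.
  have HD (y : torus m) : hartley j y = cas ((y i)%:R * (2 * pi * (j i)%:R / (m i)%:R)) *
      \prod_(k < r | k != i) cas ((y k)%:R * (2 * pi * (j k)%:R / (m k)%:R)).
    by rewrite /hartley (bigD1 i).
  rewrite !HD.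
  set P := \prod_(_ < r | _ != _) _.
  rewrite (eq_bigr (fun k => cas ((x k)%:R * (2 * pi * (j k)%:R / (m k)%:R)))); last first.
    by move=> k /negbTE ki; rewrite /torus_add ffunE ki.
  rewrite [X in _ - _ * X](eq_bigr (fun k => cas ((x k)%:R * (2 * pi * (j k)%:R / (m k)%:R)))); last first.
    by move=> k /negbTE ki; rewrite /torus_sub ffunE ki.
  rewrite -/P /torus_add /torus_sub !ffunE eqxx /=.
  set t := 2 * pi * (j i)%:R / (m i)%:R.
  have -> : cas (((x i).+1 %% m i)%N%:R * t) = cas ((x i)%:R * t + t).
    by rewrite /t cas_modn// -natr1 mulrDl mul1r.
  have -> : cas ((((x i) + m i).-1 %% m i)%N%:R * t) = cas ((x i)%:R * t - t).
    rewrite /t cas_modn//.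
    have -> : (x i + m i).-1%:R * (2 * pi * (j i)%:R / (m i)%:R) =
       ((x i)%:R * t - t) + (j i)%:R * (2 * pi) :> R.
      have -> : (x i + m i).-1%:R = (x i)%:R + (m i)%:R - 1 :> R.
        by rewrite -natrD -[in RHS](@prednK (x i + m i)) ?addn_gt0 ?m_gt0 ?orbT// -natr1 addrK.
      by rewrite /t; field; rewrite pnatr_eq0 -lt0n.
    by rewrite /cas cosD2piMn sinD2piMn.
  have := cas_addsub ((x i)%:R * t) t => e.
  transitivity ((2 * cas ((x i)%:R * t) - (cas ((x i)%:R * t + t) + cas ((x i)%:R * t - t))) * P).
    ring.
  by rewrite e; ring.
under eq_bigr do rewrite E.
rewrite -mulr_suml; congr (_ * _).
by rewrite sumrB sumr_const card_ord -mulr_sumr -[_ *+ r]mulr_natr.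
Qed.

Lemma laplacian_mx_mul (f : torus m -> R) (x : 'I_#|torus m|) :
  \sum_y laplacian_mx R m x y * f (enum_val y) = laplacian f (enum_val x).
Proof.
have D z : \sum_(y < #|torus m|) (z == enum_val y)%:R * f (enum_val y) = f z.
  rewrite (bigD1 (enum_rank z))//= enum_rankK eqxx mul1r big1 ?addr0// => y yz.
  case: eqP => [e|]; last by rewrite mul0r.
  by rewrite e enum_valK eqxx in yz.
under eq_bigr do rewrite mxE /laplacian mulr_suml.
rewrite exchange_big/= /laplacian; apply: eq_bigr => i _.
under eq_bigr do rewrite !mulrBl -mulrA.
by rewrite !sumrB -mulr_sumr !D.
Qed.

(** The matrix H of the functions [hartley] satisfies L H = H D with D diagonal, and H^T H is a
    nonzero scalar, so H is invertible and L is similar to D. The characteristic polynomial is what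
    carries the multiplicities. *)
Lemma char_poly_laplacian : char_poly (laplacian_mx R m) =
  \prod_(j : torus m) ('X - (torus_eigenvalue R j)%:P).
Proof.
set L := laplacian_mx R m; set n := #|torus m| in L *.
pose H : 'M[R]_n := \matrix_(x, j) hartley (enum_val j) (enum_val x).
pose D : 'M[R]_n := diag_mx (\row_j torus_eigenvalue R (enum_val j)).
have LH : L *m H = H *m D.
  apply/matrixP => x j; rewrite mul_mx_diag !mxE.
  under eq_bigr do rewrite [H _ _]mxE.
  by rewrite laplacian_mx_mul laplacian_hartley mulrC.
have HH : H^T *m H = (\prod_(i < r) (m i)%:R)%:M.
  apply/matrixP => j k; rewrite !mxE.
  under eq_bigr do rewrite !mxE.
  rewrite -(big_enum_val (fun x => hartley (enum_val j) x * hartley (enum_val k) x)).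
  rewrite (eq_bigl xpredT)// hartley_orthogonal (inj_eq enum_val_inj).
  exact: mulr_natl.
have uH : H \in unitmx.
  have : H^T *m H \in unitmx.
    rewrite HH unitmxE det_scalar unitfE expf_neq0//.
    by apply/prodf_neq0 => i _; rewrite pnatr_eq0 -lt0n.
  by rewrite unitmx_mul => /andP[].
have -> : char_poly L = char_poly D.
  have sim : L = H *m D *m invmx H by rewrite -LH mulmxK.
  rewrite /char_poly /char_poly_mx sim.
  have -> : 'X%:M - map_mx polyC (H *m D *m invmx H) =
     map_mx polyC H *m ('X%:M - map_mx polyC D) *m map_mx polyC (invmx H).
    rewrite mulmxBr mulmxBl !map_mxM; congr (_ - _).
    by rewrite scalar_mxC -mulmxA -map_mxM mulmxV// map_mx1 mulmx1.
  rewrite !det_mulmx mulrAC -det_mulmx -map_mxM mulmxV// map_mx1 det1 mul1r//.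
rewrite char_poly_trig ?diag_mx_is_trig//.
rewrite [RHS]big_enum_val; apply: eq_bigr => j _; by rewrite !mxE eqxx mulr1n.
Qed.

Lemma det_star_laplacian : det_star (laplacian_mx R m) =
  \prod_(j : torus m | torus_eigenvalue R j != 0) torus_eigenvalue R j.
Proof.
rewrite /det_star char_poly_laplacian.
pose s := [seq torus_eigenvalue R j | j : torus m].
have Ps : \prod_(j : torus m) ('X - (torus_eigenvalue R j)%:P) = \prod_(y <- s) ('X - y%:P).
  by rewrite big_image.
rewrite Ps.
have -> : [set x | eigenvalue (laplacian_mx R m) x && (x != 0)] =
   [set` [seq x <- undup s | x != 0]].
  apply/seteqP; split => x /=; rewrite eigenvalue_root_char char_poly_laplacian Ps root_prod_XsubC;
  by rewrite mem_filter mem_undup andbC.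
rewrite -fsbig_seq ?filter_uniq ?undup_uniq//.
rewrite big_filter.
under eq_bigr do rewrite mu_prod_XsubC.
transitivity (\prod_(x <- s | x != 0) x); last by rewrite big_image_cond.
by rewrite -[RHS]big_undup_iterop_count.
Qed.

Lemma torus_eigenvalueE (j : torus m) : torus_eigenvalue R j =
  \sum_(i < r) (2 - 2 * cos (2 * pi * (j i)%:R / (m i)%:R)).
Proof.
by rewrite sumrB sumr_const card_ord -mulr_sumr -[_ *+ r]mulr_natr.
Qed.

Lemma torus_eigenvalue_ge0 (j : torus m) : 0 <= torus_eigenvalue R j.
Proof.
by rewrite torus_eigenvalueE sumr_ge0// => i _.
Qed.

Definition torus0 : torus m := [ffun i => Ordinal (m_gt0 i)].

Lemma torus_eigenvalue_eq0 (j : torus m) : (torus_eigenvalue R j == 0) = (j == torus0).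
Proof.
apply/eqP/eqP => [|->]; last first.
  rewrite torus_eigenvalueE big1// => i _.
  by rewrite ffunE/= mulr0 mul0r cos0; ring.
rewrite torus_eigenvalueE => /psumr_eq0P h; apply/ffunP => i; rewrite ffunE; apply/val_inj => /=.
apply/eqP; apply: contraT; rewrite -lt0n => ji.
have : cos (2 * pi * (j i)%:R / (m i)%:R) != 1 :> R.
  have p0 := @pi_gt0 R; apply: cos_neq1.
  rewrite divr_gt0 ?mulr_gt0 ?ltr0n//= ltr_pdivrMr ?ltr0n// ltr_pM2l ?mulr_gt0//.
  by rewrite ltr_nat.
move=> /eqP[]; have := h _ i isT; move=> /(_ _); suff : forall i : 'I_r, true -> 0 <= 2 - 2 * cos (2 * pi * (j i)%:R / (m i)%:R) :> R.
  by move=> /[swap] /[apply]; lra.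
by move=> k _; have := cos_le1 (2 * pi * (j k)%:R / (m k)%:R : R); lra.
Qed.

End torus.

Definition cycle_heat (n : nat) (t : R) : R :=
  \sum_(k < n) expR (- (t * (2 - 2 * cos (2 * pi * k%:R / n%:R)))).

Lemma torus_heat r (m : 'I_r -> nat) (t : R) :
  \sum_(j : torus m) expR (- (torus_eigenvalue R j * t)) = \prod_(i < r) cycle_heat (m i) t.
Proof.
rewrite -big_torus_distr; apply: eq_bigr => j _.
by rewrite torus_eigenvalueE mulr_suml -sumrN expR_sum; apply: eq_bigr => i _; rewrite mulrC.
Qed.

End torus_spectrum.

(** * Heat kernels of cycles and of the line *)

Section heat.
Variable R : realType.
Notation mu := (@lebesgue_measure R).
Notation J := (`[- pi, pi]%classic : set R).

Lemma cts_integrable (f : R -> R) : continuous f -> mu.-integrable J (EFin \o f).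
Proof.
move=> cf; apply: continuous_compact_integrable; first exact: segment_compact.
exact: continuous_subspaceT.
Qed.

Lemma continuous_cosM (k : R) : continuous (fun x : R => cos (k * x)).
Proof.
move=> x; apply: continuous_comp; last exact: continuous_cos.
by apply: continuousM; [exact: cvg_cst|exact: cvg_id].
Qed.

Lemma Rintegral_cosn (k : nat) : (0 < k)%N ->
  (\int[mu]_(x in J) cos (k%:R * x))%R = 0.
Proof.
move=> k0; have k0' : k%:R != 0 :> R by rewrite pnatr_eq0 -lt0n.
have p0 := @pi_gt0 R.
have hd (x : R) : is_derive x 1 (fun x : R => k%:R^-1 * sin (k%:R * x)) (cos (k%:R * x)).
  rewrite (_ : (fun _ => _) = k%:R^-1 *: (fun x => sin (k%:R * x)))//.
  have h := @is_derive1_comp R sin (fun x => k%:R * x) x _ _ (is_derive_sin _) _.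
  apply: (is_derive_eq (is_deriveZ _ (h _ _))).
  by rewrite /GRing.scale/= mulr1; field.
rewrite /Rintegral (@continuous_FTC2 _ _ (fun x => k%:R^-1 * sin (k%:R * x)))//.
- have s0 : sin (k%:R * pi) = 0 :> R.
    elim: {k0 k0' hd} k => [|k ih]; first by rewrite mul0r sin0.
    by rewrite -natr1 mulrDl mul1r sinD ih// sinpi cospi; ring.
  by rewrite mulrN sinN s0; rewrite /= oppr0 !mulr0 subrr.
- by lra.
- by apply: continuous_subspaceT; exact: continuous_cosM.
- have cF : continuous (fun x : R => k%:R^-1 * sin (k%:R * x)).
    move=> x; apply: differentiable_continuous; apply/derivable1_diffP.
    by case: (hd x).
  split.
  + by move=> x _; case: (hd x).
  + by apply: cvg_at_right_filter; exact: cF.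
  + by apply: cvg_at_left_filter; exact: cF.
- by move=> x _; rewrite derive1E; case: (hd x).
Qed.

Lemma Rintegral_J_cst (c : R) : (\int[mu]_(x in J) c)%R = 2 * pi * c.
Proof.
have p0 := @pi_gt0 R.
rewrite Rintegral_cst// (etrans (congr1 fine (lebesgue_measure_itv _)) erefl)/=.
by rewrite lte_fin ifT /= ?opprK; [ring|lra].
Qed.

(** The return probability is the constant Fourier coefficient of the characteristic function; every
    other cosine integrates to 0. *)
Lemma Rintegral_lazy_walk (tau : R) N :
  (\int[mu]_(x in J) (1 - tau * (2 - 2 * cos x)) ^+ N)%R = 2 * pi * lazy_walk tau N 0.
Proof.
under eq_Rintegral do rewrite -(lazy_walk_cos _ _ (leqnn N)).
have key M (c : nat -> R) :
  continuous (fun x : R => \sum_(k < M) c k * cos (k.+1%:R * x)) /\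
  (\int[mu]_(x in J) (\sum_(k < M) c k * cos (k.+1%:R * x)))%R = 0.
  elim: M => [|M [ih1 ih2]].
    rewrite (_ : (fun x => _) = fun=> 0); last by apply/funext => x; rewrite big_ord0.
    by split; [move=> x; exact: cvg_cst|rewrite Rintegral_J_cst mulr0].
  have c1 : continuous (fun x : R => c M * cos (M.+1%:R * x)).
    by move=> x; apply: continuousM; [exact: cvg_cst|exact: continuous_cosM].
  rewrite (_ : (fun x => _) = (fun x => \sum_(k < M) c k * cos (k.+1%:R * x) +
     c M * cos (M.+1%:R * x))); last by apply/funext => x; rewrite big_ord_recr.
  split; first by move=> x; exact: (cvgD (ih1 x) (c1 x)).
  rewrite RintegralD//; [|exact: cts_integrable..].
  rewrite ih2 RintegralZl//; last by apply: cts_integrable; exact: continuous_cosM.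
  by rewrite Rintegral_cosn// mulr0 addr0.
have [c1 E1] := key N (fun k => lazy_walk tau N k.+1).
have c2 : continuous (fun x : R => 2 * \sum_(k < N) lazy_walk tau N k.+1 * cos (k.+1%:R * x)).
  by move=> x; exact: (cvgM (cvg_cst _) (c1 x)).
rewrite RintegralD//; [|by apply: cts_integrable => x; exact: cvg_cst|exact: cts_integrable].
by rewrite Rintegral_J_cst RintegralZl// ?E1 ?mulr0 ?addr0//; exact: cts_integrable.
Qed.

(* The heat kernel e^(-2 t) I_0 (2 t) of Z at the origin. *)
Definition line_heat (t : R) : R :=
  (2 * pi)^-1 * (\int[mu]_(x in J) expR (- (t * (2 - 2 * cos x))))%R.

Lemma continuous_expcos (t : R) : continuous (fun x : R => expR (- (t * (2 - 2 * cos x)))).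
Proof.
move=> x; apply: continuous_comp; last exact: continuous_expR.
apply: continuousN; apply: continuousM; first exact: cvg_cst.
apply: continuousB; first exact: cvg_cst.
by apply: continuousM; [exact: cvg_cst|exact: continuous_cos].
Qed.

Lemma bessel_line_heat (t : R) : bessel_I0 (2 * t) = expR (2 * t) * line_heat t.
Proof.
rewrite /bessel_I0 /line_heat mulrCA; congr (_ * _).
rewrite -RintegralZl//; last by apply: cts_integrable; exact: continuous_expcos.
by apply: eq_Rintegral => x _; rewrite -expRD; congr expR; ring.
Qed.

(** Rate of convergence in Euler's limit. With w = z / N both bases 1 - w and e^(- w) lie in [0, 1]
    and differ by at most w^2, so their N-th powers differ by at most N w^2. *)
Lemma expR_power_bound (z : R) N : (0 < N)%N -> 0 <= z -> z <= N%:R ->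
  `|(1 - z / N%:R) ^+ N - expR (- z)| <= z ^+ 2 / N%:R.
Proof.
move=> N0 z0 zN; have N0' : 0 < N%:R :> R by rewrite ltr0n.
set w := z / N%:R; have w0 : 0 <= w by rewrite divr_ge0// ltW.
have w1 : w <= 1 by rewrite ler_pdivrMr// mul1r.
have -> : expR (- z) = expR (- w) ^+ N.
  by rewrite -expRM_natl /w; congr expR; field; rewrite gt_eqF.
rewrite subrXX normrM.
have e1 : 1 - w <= expR (- w) by exact: expR_ge1Dx.
have e3 : expR (- w) <= 1 by rewrite expR_le1 oppr_le0.
have e2 : expR (- w) <= 1 - w + w ^+ 2.
  have h := expR_ge1Dx w; have e0 := expR_gt0 (- w).
  have E : expR (- w) * expR w = 1 by rewrite -expRD addNr expR0.
  have : expR (- w) * (1 + w) <= 1 by rewrite -[leRHS]E ler_wpM2l// ltW.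
  nra.
have -> : z ^+ 2 / N%:R = w ^+ 2 * N%:R by rewrite /w; field; rewrite gt_eqF.
apply: ler_pM => //.
  by rewrite ler_norml; apply/andP; split; lra.
apply: (le_trans (ler_norm_sum _ _ _)).
rewrite -[X in _ <= X%:R](card_ord N) -sumr_const; apply: ler_sum => i _.
rewrite ger0_norm; last by rewrite mulr_ge0 ?exprn_ge0 ?expR_ge0// subr_ge0.
by rewrite mulr_ile1 ?exprn_ge0 ?exprn_ile1 ?expR_ge0// ?subr_ge0// gerBl.
Qed.

(** N steps with jump probability t / N on each side approximate the walk in continuous time t. The
    values 2 - 2 cos x are at most 4, whence the condition 4 t <= N. *)
Lemma lazy_walk_line_heat (t : R) N : 0 < t -> (0 < N)%N -> 4 * t <= N%:R ->
  `|lazy_walk (t / N%:R) N 0 - line_heat t| <= (4 * t) ^+ 2 / N%:R.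
Proof.
move=> t0 N0 tN; have p0 := @pi_gt0 R.
have E : lazy_walk (t / N%:R) N 0 =
    (2 * pi)^-1 * (\int[mu]_(x in J) (1 - t / N%:R * (2 - 2 * cos x)) ^+ N)%R.
  by rewrite Rintegral_lazy_walk mulKf// mulf_neq0// gt_eqF.
have cL : continuous (fun x : R => (1 - t / N%:R * (2 - 2 * cos x)) ^+ N).
  move=> x; apply: (@continuous_comp _ _ _ (fun x => 1 - t / N%:R * (2 - 2 * cos x)) (fun y => y ^+ N)).
    apply: continuousB; first exact: cvg_cst.
    apply: continuousM; first exact: cvg_cst.
    apply: continuousB; first exact: cvg_cst.
    by apply: continuousM; [exact: cvg_cst|exact: continuous_cos].
  exact: exprn_continuous.
have cE := @continuous_expcos t.
rewrite E /line_heat -mulrBr normrM gtr0_norm ?invr_gt0 ?mulr_gt0//.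
rewrite -RintegralB//; [|exact: cts_integrable..].
have cB : continuous (fun x : R => (1 - t / N%:R * (2 - 2 * cos x)) ^+ N -
    expR (- (t * (2 - 2 * cos x)))).
  by move=> x; exact: (cvgB (cL x) (cE x)).
rewrite mulrC ler_pdivrMr ?mulr_gt0//.
apply: (le_trans (le_normr_Rintegral _ (cts_integrable cB))) => //.
rewrite [X in _ <= X]mulrC -Rintegral_J_cst; apply: le_Rintegral => //.
- by apply: cts_integrable => x; exact: (cvg_norm (cB x)).
- by apply: cts_integrable => x; exact: cvg_cst.
move=> x _; set z := t * (2 - 2 * cos x).
have z0 : 0 <= z.
  by apply: mulr_ge0; [exact: ltW|have := cos_le1 x; lra].
have z4 : z <= 4 * t by have := cos_geN1 x; rewrite /z; nra.
have -> : t / N%:R * (2 - 2 * cos x) = z / N%:R by rewrite /z; ring.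
apply: (le_trans (expR_power_bound N0 z0 (le_trans z4 tN))).
by rewrite ler_wpM2r ?invr_ge0// lerXn2r ?nnegrE// (le_trans z0).
Qed.

Lemma line_heat_ge0 t : 0 <= line_heat t.
Proof.
rewrite mulr_ge0 ?invr_ge0 ?mulr_ge0 ?pi_ge0//.
by apply: Rintegral_ge0 => x _; exact: expR_ge0.
Qed.

Lemma leq_half m : (1 < m)%N -> (m <= 3 * m./2)%N.
Proof. lia. Qed.

(** Both kernels are limits of lazy walks with N steps, and before the limit the difference is 2 m
    times the images of the origin: nonnegative, and bounded by [lazy_walk_tail]. The constant is 6
    = 2 * 3 because m <= 3 * m./2. *)
Lemma cycle_line_heat m (t y : R) : (1 < m)%N -> 0 < t -> 1 <= y ->
  0 <= cycle_heat m t - m%:R * line_heat t <=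
    6 * (y ^- m./2 * expR (t * (y + y^-1 - 2))).
Proof.
move=> m1 t0 y1; have m0 : (0 < m)%N by lia.
set T := y ^- m./2 * expR (t * (y + y^-1 - 2)).
have key (e : R) : 0 < e -> - e <= cycle_heat m t - m%:R * line_heat t <= 6 * T + e.
  move=> e0.
  (* Passing from the walk to continuous time costs an error of at most m (4 t)^2 / N once for the
     cycle and once for the line. *)
  have [N [N0 tN eN]] : exists N : nat, [/\ (0 < N)%N, 4 * t <= N%:R &
      2 * m%:R * ((4 * t) ^+ 2 / N%:R) <= e].
    pose B := Num.max (4 * t) (2 * m%:R * (4 * t) ^+ 2 / e).
    have B0 : 0 <= B by rewrite le_max mulr_ge0// ltW.
    have := archi_boundP B0; set N := Num.bound B => hB.
    have N0 : 0 < N%:R :> R by apply: le_lt_trans hB.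
    exists N; split.
    - by rewrite -(ltr0n R).
    - by apply: ltW; apply: le_lt_trans hB; rewrite le_max lexx.
    - rewrite mulrA ler_pdivrMr// [e * _]mulrC -ler_pdivrMr//.
      by apply: ltW; apply: le_lt_trans hB; rewrite le_max lexx orbT.
  set tau := t / N%:R; have N0' : 0 < N%:R :> R by rewrite ltr0n.
  have tau0 : 0 <= tau <= 3^-1.
    apply/andP; split; first by rewrite divr_ge0// ltW.
    by rewrite ler_pdivrMr//; lra.
  have NNm : (N <= m * N)%N by rewrite leq_pmull.
  have avg := @lazy_walk_avg R tau N m N m0 NNm.
  have tail := @lazy_walk_tail R tau y N m N m1 tau0 y1.
  have w0 := @lazy_walk_line_heat t N t0 N0 tN.
  have D : `|\sum_(a < m) (1 - tau * (2 - 2 * cos (2 * pi * a%:R / m%:R))) ^+ N - cycle_heat m t|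
     <= m%:R * ((4 * t) ^+ 2 / N%:R).
    rewrite -sumrB (le_trans (ler_norm_sum _ _ _))//.
    rewrite [leRHS]mulr_natl -[in leRHS](card_ord m) -sumr_const; apply: ler_sum => a _.
    set c := cos _; set z := t * (2 - 2 * c).
    have z0 : 0 <= z.
      apply: mulr_ge0; first exact: ltW.
      by have : c <= 1 := cos_le1 _; lra.
    have z4 : z <= 4 * t by have : -1 <= c := cos_geN1 _; rewrite /z; nra.
    have -> : tau * (2 - 2 * c) = z / N%:R by rewrite /z /tau; ring.
    apply: (le_trans (expR_power_bound N0 z0 (le_trans z4 tN))).
    by rewrite ler_wpM2r ?invr_ge0// lerXn2r ?nnegrE// (le_trans z0).
  have Nt : N%:R * tau = t by rewrite /tau; field; rewrite gt_eqF.
  rewrite Nt -/T in tail.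
  set P := \sum_(j < N) _ in avg tail.
  have P0 : 0 <= P by apply: sumr_ge0 => j _; exact: lazy_walk_ge0.
  have mP : m%:R * P <= 3 * T.
    have := leq_half m1.
    rewrite -(ler_nat R) natrM => h.
    by apply: (le_trans (ler_wpM2r P0 h)); rewrite -mulrA ler_wpM2l.
  set eps := (4 * t) ^+ 2 / N%:R in w0 D eN.
  rewrite avg in D.
  set p := lazy_walk tau N 0 in w0 D.
  move: w0; rewrite ler_norml => /andP[w1 w2].
  move: D; rewrite ler_norml => /andP[d1 d2].
  have mp : 0 < m%:R :> R by rewrite ltr0n.
  have w1' : - (m%:R * eps) <= m%:R * p - m%:R * line_heat t.
    by rewrite -mulrBr -mulrN ler_pM2l.
  have w2' : m%:R * p - m%:R * line_heat t <= m%:R * eps.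
    by rewrite -mulrBr ler_pM2l.
  have mP0 : 0 <= m%:R * P by rewrite mulr_ge0.
  rewrite mulrDr [m%:R * (2 * P)]mulrCA in d1 d2.
  by apply/andP; split; lra.
apply/andP; split.
  by apply/ler_addgt0Pr => e e0; have /andP[+ _] := key _ e0; lra.
by apply/ler_addgt0Pr => e e0; have /andP[] := key _ e0.
Qed.

Lemma bernoulli_ineq (x : R) n : 0 <= x -> 1 + n%:R * x <= (1 + x) ^+ n.
Proof.
move=> x0; elim: n => [|n ih]; first by rewrite mul0r addr0 expr0.
rewrite exprSr -natr1; apply: le_trans (ler_wpM2r _ ih); last by lra.
have : 0 <= n%:R * x * x by rewrite !mulr_ge0.
by move=> h; lra.
Qed.

(** The factor 6 is that of [cycle_line_heat], e bounds its exponential factor at y = 1 + 1 / sqrt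
    t, and (12 K)^(2 K) comes from m <= 12 K l in the proof below. *)
Definition heat_cst (K : nat) : R := 6 * expR 1 * (12 * K%:R) ^+ (2 * K).

Lemma heat_cst_ge0 K : 0 <= heat_cst K.
Proof. by rewrite /heat_cst mulr_ge0 ?mulr_ge0 ?expR_ge0 ?exprn_ge0 ?mulr_ge0. Qed.

(* The shift parameter y = 1 + 1 / sqrt t balances the two factors of
   [cycle_line_heat]. *)
Lemma cycle_line_heat_pow (K m : nat) (t : R) : (0 < K)%N -> (4 * K <= m)%N -> 0 < t ->
  0 <= cycle_heat m t - m%:R * line_heat t <= heat_cst K * (t / m%:R ^+ 2) ^+ K.
Proof.
move=> K0 Km t0; set s := Num.sqrt t; have s0 : 0 < s by rewrite sqrtr_gt0.
have ss : s ^+ 2 = t by rewrite sqr_sqrtr// ltW.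
set x := s^-1; have x0 : 0 < x by rewrite invr_gt0.
have m1 : (1 < m)%N by lia.
have y1 : 1 <= 1 + x by lra.
have /andP[-> /=] := cycle_line_heat m1 t0 y1.
move=> /le_trans; apply.
(* The integer l is about m / (4 K): then (1 + x)^h is at least the (2 K)-th power of (1 + x)^l,
   which Bernoulli's inequality bounds below by l x. This is where the K-th power of t / m^2 comes
   from. *)
set h := m./2; set l := (h %/ (2 * K))%N.
have lh : (l * (2 * K) <= h)%N by rewrite /l leq_trunc_div.
have h2K : (2 * K <= h)%N by rewrite /h; lia.
have l1 : (0 < l)%N by rewrite /l divn_gt0//; lia.
have ml : (m <= 12 * K * l)%N.
  have := ltn_ceil h (_ : 0 < 2 * K)%N; rewrite -/l => /(_ _); rewrite /h; nia.
have l0 : 0 < l%:R :> R by rewrite ltr0n.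
have m0 : 0 < m%:R :> R by rewrite ltr0n; lia.
have e1 : expR (t * (1 + x + (1 + x)^-1 - 2)) <= expR 1.
  rewrite ler_expR -ss.
  have -> : 1 + x + (1 + x)^-1 - 2 = x ^+ 2 / (1 + x) by field; rewrite gt_eqF//; lra.
  have -> : s ^+ 2 * (x ^+ 2 / (1 + x)) = (1 + x)^-1.
    by rewrite /x; field; rewrite !gt_eqF//=; lra.
  by rewrite invf_le1//; lra.
have e2 : (1 + x) ^- h <= (t / l%:R ^+ 2) ^+ K.
  have -> : (t / l%:R ^+ 2) ^+ K = ((l%:R * x) ^+ (2 * K))^-1.
    by rewrite -ss /x [in RHS]exprM -[in RHS]exprVn; congr (_ ^+ _); field; rewrite !gt_eqF.
  rewrite lef_pV2 ?posrE ?exprn_gt0 ?mulr_gt0//; last lra.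
  apply: (@le_trans _ _ (((1 + x) ^+ l) ^+ (2 * K))).
    apply: lerXn2r; rewrite ?nnegrE ?mulr_ge0 ?exprn_ge0 ?ltW//; first lra.
    by have := @bernoulli_ineq x l (ltW x0); lra.
  by rewrite -exprM ler_weXn2l.
have e3 : (t / l%:R ^+ 2) ^+ K <= (12 * K%:R) ^+ (2 * K) * (t / m%:R ^+ 2) ^+ K.
  have -> : (12 * K%:R) ^+ (2 * K) * (t / m%:R ^+ 2) ^+ K =
     (t * (12 * K%:R / m%:R) ^+ 2) ^+ K.
    by rewrite exprM -exprMn; congr (_ ^+ _); field; rewrite gt_eqF.
  apply: lerXn2r; rewrite ?nnegrE.
  - by rewrite divr_ge0 ?sqr_ge0// ltW.
  - by rewrite mulr_ge0 ?sqr_ge0// ltW.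
  rewrite ler_pM2l// -exprVn; apply: lerXn2r; rewrite ?nnegrE ?invr_ge0 ?divr_ge0 ?mulr_ge0//.
  rewrite ler_pdivlMr// mulrC ler_pdivrMr// -!natrM ler_nat; lia.
rewrite /heat_cst -!mulrA ler_pM2l// mulrC.
apply: ler_pM; [exact: expR_ge0| |exact: e1|exact: le_trans e2 e3].
by rewrite invr_ge0 exprn_ge0//; lra.
Qed.

(** With z = w / 2 the mean value theorem gives sin z >= z cos z, so sin w = 2 sin z cos z >= w (cos
    z)^2, and (cos z)^2 = (1 + cos w) / 2 >= 1 / 2. *)
Lemma sin_ge_half (w : R) : 0 <= w <= pi / 2 -> w / 2 <= sin w.
Proof.
move=> /andP[w0 wp]; have [->|wn0] := eqVneq w 0; first by rewrite sin0 mul0r.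
have {}w0 : 0 < w by rewrite lt_neqAle eq_sym wn0.
set z := w / 2; have z0 : 0 < z by rewrite divr_gt0.
have p0 := @pi_gt0 R.
have cz : 0 <= cos z by apply: cos_ge0_pihalf; rewrite /z; apply/andP; split; lra.
have cw : 0 <= cos w by apply: cos_ge0_pihalf; apply/andP; split; lra.
have [c] := @MVT R sin cos 0 z z0 (fun x _ => is_derive_sin x)
  (continuous_subspaceT (@continuous_sin R)).
rewrite in_itv/= => /andP[c0 cz']; rewrite sin0 !subr0 => E.
have zw : z = w / 2 by [].
have cc : cos z <= cos c.
  rewrite leNgt ltr_cos -?leNgt ?in_itv/=; first exact: ltW.
    by apply/andP; split; lra.
  by apply/andP; split; lra.
have e1 : z * cos z <= sin z by rewrite E mulrC ler_pM2r.
have -> : sin w = 2 * (sin z * cos z).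
  have -> : w = z + z by rewrite /z; field.
  by rewrite sinD; ring.
have E2 : cos w = 2 * (cos z) ^+ 2 - 1.
  have -> : w = z + z by rewrite /z; field.
  by rewrite cosD -!expr2 sin2cos2; ring.
have : z * cos z * cos z <= sin z * cos z by rewrite ler_wpM2r.
nra.
Qed.

Lemma cos_le_sqr (x : R) : 0 <= x <= pi -> x ^+ 2 / 8 <= 1 - cos x.
Proof.
move=> /andP[x0 xp]; have h := @sin_ge_half (x / 2).
have -> : 1 - cos x = 2 * sin (x / 2) ^+ 2.
  have {1}-> : x = x / 2 + x / 2 by field.
  by rewrite cosD -!expr2 cos2sin2; ring.
have {}h : x / 2 / 2 <= sin (x / 2) by apply: h; apply/andP; split; lra.
have : (x / 2 / 2) ^+ 2 <= sin (x / 2) ^+ 2.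
  by apply: lerXn2r; rewrite ?nnegrE ?divr_ge0//; apply: le_trans h; rewrite !divr_ge0.
nra.
Qed.

Definition cycle_term (m : nat) (t : R) (k : nat) : R :=
  expR (- (t * (2 - 2 * cos (2 * pi * k%:R / m%:R)))).

Lemma cycle_term_le m t k : 0 <= t -> (0 < m)%N -> (2 * k <= m)%N ->
  cycle_term m t k <= expR (- (t / m%:R ^+ 2 * k%:R ^+ 2)).
Proof.
move=> t0 m0 km; have m0' : 0 < m%:R :> R by rewrite ltr0n.
rewrite ler_expR lerN2; set x := 2 * pi * k%:R / m%:R.
have p2 := @pi_ge2 R.
have km' : 2 * k%:R <= m%:R :> R by rewrite -natrM ler_nat.
have xp : 0 <= x <= pi.
  apply/andP; split.
    by rewrite divr_ge0 ?mulr_ge0 ?pi_ge0// ltW.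
  by rewrite ler_pdivrMr//; have k0 : 0 <= k%:R :> R by []; nra.
have := cos_le_sqr xp => h.
rewrite -mulrA ler_wpM2l//.
have -> : m%:R ^- 2 * k%:R ^+ 2 = (k%:R / m%:R) ^+ 2 :> R.
  by field; rewrite gt_eqF.
have xE : x = 2 * pi * (k%:R / m%:R) by rewrite /x; ring.
move: h; rewrite xE; set q := k%:R / m%:R.
have : 0 <= q ^+ 2 by exact: sqr_ge0.
have : 4 <= pi ^+ 2 :> R by nra.
nra.
Qed.

(** The symmetry k -> m - k folds the sum onto indices up to m / 2, the range of [cycle_term_le].
    The two upper bounds differ exactly for even m, whose middle index is its own mirror image. *)
Lemma cycle_heatE m t : (0 < m)%N -> cycle_heat m t =
  1 + \sum_(k < m./2) cycle_term m t k.+1 + \sum_(k < m.-1./2) cycle_term m t k.+1.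
Proof.
move=> m0; have m0' : m%:R != 0 :> R by rewrite pnatr_eq0 -lt0n.
rewrite /cycle_heat -(big_mkord xpredT (cycle_term m t)) big_ltn//.
have -> : cycle_term m t 0 = 1.
  by rewrite /cycle_term mulr0 mul0r cos0 mulr1 subrr mulr0 oppr0 expR0.
rewrite -addrA; congr (_ + _).
rewrite (@big_cat_nat _ _ _ (m./2).+1)//=; last by lia.
congr (_ + _).
  by rewrite big_add1 /= big_mkord.
rewrite big_nat_rev/=.
rewrite (_ : \sum_(_ <= i < m) _ = \sum_(0 + (m./2).+1 <= i < m) cycle_term m t ((m./2).+1 + m - i.+1)%N)%R//.
rewrite big_addn -(big_mkord xpredT (fun k => cycle_term m t k.+1)).
have -> : (m - (m./2).+1 = m.-1./2)%N by lia.
apply: eq_big_nat => i /andP[_ im]; rewrite /cycle_term; congr expR; congr (- (_ * (_ - _ * _))).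
have -> : (m./2.+1 + m - (i + m./2.+1).+1)%N = (m - i.+1)%N by lia.
rewrite natrB; last by lia.
have -> : 2 * pi * (m%:R - i.+1%:R) / m%:R = - (2 * pi * i.+1%:R / m%:R) + 1%:R * (2 * pi) :> R.
  by field.
by rewrite cosD2piMn cosN.
Qed.

Lemma expRN_le_pow (x : R) K : 0 < x -> expR (- x) <= K`!%:R / x ^+ K.
Proof.
move=> x0; case: K => [|K]; first by rewrite expr0 divr1 expR_le1 oppr_le0 ltW.
rewrite expRN ler_pdivlMr ?exprn_gt0// mulrC ler_pdivrMr ?expR_gt0//.
have := @expR_ge1Dxn R x K (ltW x0) => h.
rewrite mulrC -ler_pdivrMr ?ltr0n ?fact_gt0//.
by apply: le_trans h; rewrite lerDr.
Qed.

Lemma sum_invr_sqr M : \sum_(k < M) (k.+1%:R ^- 2 : R) <= 2.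
Proof.
suff : \sum_(k < M.+1) (k.+1%:R ^- 2 : R) <= 2 - M.+1%:R^-1.
  move=> h; apply: (@le_trans _ _ (\sum_(k < M.+1) (k.+1%:R ^- 2 : R))).
    by rewrite big_ord_recr/= lerDl invr_ge0 exprn_ge0.
  by apply: le_trans h _; rewrite gerBl invr_ge0.
elim: M => [|M ih]; first by rewrite big_ord1 expr1n invr1; lra.
rewrite big_ord_recr/=; have m0 : 0 < M.+1%:R :> R by [].
have -> : M.+2%:R = M.+1%:R + 1 :> R by rewrite natr1.
have : (M.+1%:R + 1) ^- 2 <= M.+1%:R^-1 - (M.+1%:R + 1)^-1 :> R.
  have -> : M.+1%:R^-1 - (M.+1%:R + 1)^-1 = (M.+1%:R * (M.+1%:R + 1))^-1 :> R.
    by field; rewrite !gt_eqF//; lra.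
  by rewrite lef_pV2 ?posrE ?exprn_gt0 ?mulr_gt0//; [rewrite expr2 ler_wpM2r|..]; lra.
by move=> h; apply: le_trans (lerD ih h) _; rewrite addrA subrK.
Qed.

(** The power u^(- K) comes from e^(- x) <= K! / x^K; of the factor (k + 1)^(- 2 K) only the
    exponent - 2 is kept, which suffices for convergence. *)
Lemma sum_gauss_le (u : R) K M N : 0 < u -> (0 < K)%N ->
  \sum_(M <= k < N) expR (- (u * k.+1%:R ^+ 2)) <= K`!%:R / u ^+ K * \sum_(M <= k < N) k.+1%:R ^- 2.
Proof.
move=> u0 K0; rewrite mulr_sumr; apply: ler_sum => k _.
have k0 : 0 < k.+1%:R :> R by [].
apply: (le_trans (expRN_le_pow K _)); first by rewrite mulr_gt0// exprn_gt0.
rewrite exprMn invfM mulrA ler_wpM2l//.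
  by rewrite divr_ge0 ?exprn_ge0// ltW.
rewrite lef_pV2 ?posrE ?exprn_gt0// -exprM ler_weXn2l ?ler1n//; lia.
Qed.

Lemma cycle_heat_ge1 m (t : R) : (0 < m)%N -> 1 <= cycle_heat m t.
Proof.
by move=> m0; rewrite cycle_heatE// -addrA lerDl addr_ge0// sumr_ge0// => i _; exact: expR_ge0.
Qed.

(** Large times: the trace approaches 1 faster than any power of t / m^2, at a rate that depends on
    m only through this quotient. *)
Lemma cycle_heat_le K m (t : R) : (0 < K)%N -> (0 < m)%N -> 0 < t ->
  cycle_heat m t <= 1 + 4 * K`!%:R / (t / m%:R ^+ 2) ^+ K.
Proof.
move=> K0 m0 t0; have m0' : 0 < m%:R :> R by rewrite ltr0n.
have u0 : 0 < t / m%:R ^+ 2 by rewrite divr_gt0// exprn_gt0.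
set u := t / _ in u0 *.
have key M : (M <= m./2)%N -> \sum_(k < M) cycle_term m t k.+1 <= 2 * K`!%:R / u ^+ K.
  move=> Mm; apply: (@le_trans _ _ (\sum_(0 <= k < M) expR (- (u * k.+1%:R ^+ 2)))).
    rewrite big_mkord; apply: ler_sum => k _; apply: cycle_term_le => //; first exact: ltW.
    by have := ltn_ord k; lia.
  apply: (le_trans (sum_gauss_le 0 M u0 K0)).
  rewrite big_mkord (_ : 2 * K`!%:R / u ^+ K = K`!%:R / u ^+ K * 2); last by ring.
  rewrite ler_wpM2l ?sum_invr_sqr//.
  by rewrite divr_ge0 ?exprn_ge0// ltW.
rewrite cycle_heatE// -addrA lerD2l.
have mm : (m.-1./2 <= m./2)%N by lia.
by have := key m./2 (leqnn _); have := key m.-1./2 mm; lra.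
Qed.

End heat.

(** * Gaussian limit of the heat kernel *)

Section limits.
Variable R : realType.
Notation mu := (@lebesgue_measure R).

Lemma sin_mvt (z : R) : 0 < z -> exists2 c, 0 < c < z & sin z = z * cos c.
Proof.
move=> z0; have [c] := @MVT R sin cos 0 z z0 (fun x _ => is_derive_sin x)
  (continuous_subspaceT (@continuous_sin R)).
by rewrite in_itv/= sin0 !subr0 => cz E; exists c => //; rewrite E mulrC.
Qed.

Lemma sin_sqr_le (z : R) : sin z ^+ 2 <= z ^+ 2.
Proof.
wlog z0 : z / 0 < z => [h|].
  have [z0|z0|<-] := ltgtP 0 z; [exact: h| |by rewrite sin0].
  by have := h (- z); rewrite oppr_gt0 sinN !sqrrN; apply.
by have [c _ ->] := sin_mvt z0; rewrite exprMn ler_piMr ?sqr_ge0.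
Qed.

Lemma one_sub_cos (x : R) : 1 - cos x = 2 * sin (x / 2) ^+ 2.
Proof.
have {1}-> : x = x / 2 + x / 2 by field.
by rewrite cosD -!expr2 cos2sin2; ring.
Qed.

Lemma cos_quadratic (h : R) : `|2 - 2 * cos h - h ^+ 2| <= h ^+ 4 / 4.
Proof.
have [z hz] : exists z, h = 2 * z by exists (h / 2); field.
have -> : 2 - 2 * cos h = 4 * sin z ^+ 2.
  have := one_sub_cos h; have -> : h / 2 = z by rewrite hz; field.
  lra.
have up := sin_sqr_le z.
suff lo : z ^+ 2 * (1 - z ^+ 2) <= sin z ^+ 2.
  rewrite hz ler_norml !exprMn; apply/andP; split; last first.
    have : 0 <= z ^+ 4 by apply: exprn_even_ge0.
    by nra.
  have -> : z ^+ 4 = z ^+ 2 * z ^+ 2 by ring.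
  nra.
clear h hz up; wlog z0 : z / 0 < z => [hw|].
  have [z0|z0|<-] := ltgtP 0 z; [exact: hw| |by rewrite sin0 !expr0n/= mul0r].
  by have := hw (- z); rewrite oppr_gt0 sinN !sqrrN; apply.
have [z1|z1] := leP 1 (z ^+ 2).
  by apply: (@le_trans _ _ 0); rewrite ?sqr_ge0//; have := sqr_ge0 z; nra.
have [c /andP[c0 cz] ->] := sin_mvt z0.
rewrite exprMn ler_wpM2l ?sqr_ge0//.
have c1 : 1 - c ^+ 2 / 2 <= cos c.
  have := one_sub_cos c; have := sin_sqr_le (c / 2).
  have -> : (c / 2) ^+ 2 = c ^+ 2 / 4 by field.
  lra.
have cz2 : c ^+ 2 <= z ^+ 2 by rewrite lerXn2r ?nnegrE ?ltW.
have := sqr_ge0 c; nra.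
Qed.

Lemma cvg_sqr_cos (x : R) : (fun n : nat => n%:R ^+ 2 * (2 - 2 * cos (x / n%:R))) @ \oo --> x ^+ 2.
Proof.
apply/cvgrPdist_lt => /= e e0.
near=> n.
have n0 : (0 < n)%N by near: n; exists 1%N.
have n0' : 0 < n%:R :> R by rewrite ltr0n.
have x4 : 0 <= x ^+ 4 / 4 by rewrite divr_ge0// exprn_even_ge0.
rewrite distrC; apply: le_lt_trans (_ : _ <= x ^+ 4 / 4 / n%:R) _; last first.
  rewrite ltr_pdivrMr// [e * _]mulrC -ltr_pdivrMr//; near: n.
  exact: nbhs_infty_gtr.
have := cos_quadratic (x / n%:R).
have -> : n%:R ^+ 2 * (2 - 2 * cos (x / n%:R)) - x ^+ 2 =
   n%:R ^+ 2 * (2 - 2 * cos (x / n%:R) - (x / n%:R) ^+ 2) by field; rewrite gt_eqF.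
rewrite normrM (ger0_norm (sqr_ge0 _)) => h1.
apply: (le_trans (ler_wpM2l (sqr_ge0 _) h1)).
have -> : n%:R ^+ 2 * ((x / n%:R) ^+ 4 / 4) = x ^+ 4 / 4 / n%:R ^+ 2 by field; rewrite gt_eqF.
rewrite ler_wpM2l// lef_pV2 ?posrE ?exprn_gt0//.
by rewrite expr2 ler_peMl// ler1n.
Unshelve. all: by end_near. Qed.

(** The integrand of r times [line_heat (r ^+ 2)] after the change of variable y = x / r, extended
    by 0 so that all r share one domain of integration. *)
Definition heat_integrand (r x : R) : R :=
  (- (pi * r) <= x < pi * r)%R%:R * expR (- (r ^+ 2 * (2 - 2 * cos (x / r)))).

Lemma measurable_heat_integrand r : measurable_fun setT (heat_integrand r).
Proof.
apply: measurable_funM.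
  by apply: (L1_measurable (L1_itv _ _)).
apply: continuous_measurable_fun => x.
apply: (@continuous_comp _ _ _ (fun x : R => x / r) (fun x : R => expR (- (r ^+ 2 * (2 - 2 * cos x))))).
  by apply: cvgM; [exact: cvg_id|exact: cvg_cst].
exact: continuous_expcos.
Qed.

Lemma heat_integrand_ge0 r x : 0 <= heat_integrand r x.
Proof. by rewrite mulr_ge0// expR_ge0. Qed.

(** On the support [cos_le_sqr] bounds the exponent below by x^2 / 4, and x^2 / 4 >= |x| - 1 because
    (|x| / 2 - 1)^2 >= 0. *)
Lemma heat_integrand_le r x : 0 < r -> heat_integrand r x <= expR 1 * expR (- (1 * `|x|)).
Proof.
move=> r0; rewrite /heat_integrand.
case: (boolP (- (pi * r) <= x < pi * r)%R) => [/andP[x1 x2]|_]; last first.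
  by rewrite mul0r mulr_ge0 ?expR_ge0.
rewrite /= !mul1r -expRD ler_expR.
have xr : 0 <= `|x| / r <= pi.
  apply/andP; split; first by rewrite divr_ge0// ltW.
  by rewrite ler_pdivrMr// ler_norml x1 ltW.
have := cos_le_sqr xr; rewrite expr_div_n real_normK ?num_real//.
have -> : cos (`|x| / r) = cos (x / r).
  by rewrite -(cos_norm (x / r)) normrM normfV (gtr0_norm r0).
have -> : x ^+ 2 / r ^+ 2 / 8 = x ^+ 2 / 8 / r ^+ 2 by ring.
rewrite ler_pdivrMr ?exprn_gt0// => h.
have := real_normK (num_real x); have := sqr_ge0 (`|x| / 2 - 1).
nra.
Qed.

Lemma line_heat_scaled (r : R) : 0 < r ->
  r * line_heat (r ^+ 2) = (2 * pi)^-1 * intR (heat_integrand r).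
Proof.
move=> r0; have p0 := @pi_gt0 R.
rewrite /line_heat mulrCA; congr (_ * _).
pose G (y : R) := expR (- (r ^+ 2 * (2 - 2 * cos y))).
have cG : continuous G by exact: continuous_expcos.
have hF (x : R) : is_derive x 1 (fun x : R => r^-1 * x) r^-1.
  have := is_deriveZ r^-1 (is_derive_id x 1).
  by rewrite /GRing.scale/= mulr1.
have dF : derive1 (fun x : R => r^-1 * x) = fun=> r^-1.
  by apply/funext => x; rewrite derive1E; case: (hF x).
have cF : continuous (fun x : R => r^-1 * x).
  by move=> x; apply: cvgM; [exact: cvg_cst|exact: cvg_id].
pose J : set R := `[- pi, pi]%classic; pose Jr : set R := `[- (pi * r), pi * r]%classic.
have E : (\int[mu]_(x in J) (G x)%:E = \int[mu]_(x in Jr) (G (r^-1 * x) * r^-1)%:E)%E.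
  rewrite /J /Jr; have := @integration_by_substitution_increasing R (fun x : R => r^-1 * x) G (- (pi * r)) (pi * r).
  rewrite dF.
  have -> : r^-1 * - (pi * r) = - pi by field; rewrite gt_eqF.
  have -> : r^-1 * (pi * r) = pi by field; rewrite gt_eqF.
  apply.
  - by have : 0 < pi * r by [rewrite mulr_gt0]; lra.
  - by move=> x y _ _; rewrite ltr_pM2l ?invr_gt0.
  - by move=> x _; exact: cvg_cst.
  - by apply/cvg_ex; exists r^-1; exact: cvg_cst.
  - by apply/cvg_ex; exists r^-1; exact: cvg_cst.
  - split.
    + by move=> x _; case: (hF x).
    + by apply: cvg_at_right_filter; exact: cF.
    + by apply: cvg_at_left_filter; exact: cF.
  - exact: continuous_subspaceT.
rewrite [X in r * fine X]E.
have cGr : continuous (fun x => G (r^-1 * x)).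
  by move=> x; apply: (@continuous_comp _ _ _ (fun x => r^-1 * x) G); [exact: cF|exact: cG].
have iGr : mu.-integrable Jr (EFin \o (fun x => G (r^-1 * x))).
  apply: continuous_compact_integrable; first exact: segment_compact.
  exact: continuous_subspaceT.
have E2 : fine (\int[mu]_(x in Jr) (G (r^-1 * x) * r^-1)%:E)%E =
    (\int[mu]_(x in Jr) G (r^-1 * x))%R * r^-1.
  by apply: (RintegralZr _ _ iGr); exact: measurable_itv.
rewrite E2 mulrCA mulfV ?gt_eqF// mulr1.
rewrite -Rintegral_itv_bndo_bndc; last by apply: integrableS iGr => // [|x]; [exact: measurable_itv|rewrite /Jr /= !in_itv/= => /andP[-> /ltW ->]].
rewrite Rintegral_mkcond; apply: eq_Rintegral => x _.
rewrite /heat_integrand patchE mem_setE/= in_itv/= [r^-1 * x]mulrC.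
by case: ifP => _; rewrite ?mul1r ?mul0r.
Qed.

Definition gauss_cst : R := (2 * pi)^-1 * intR (fun x => expR (- x ^+ 2)).

Definition gauss_bound : R := (2 * pi)^-1 * intR (fun x => expR 1 * expR (- (1 * `|x|))).

Lemma L1_heat_dominant : L1 (fun x : R => expR 1 * expR (- (1 * `|x|))).
Proof. by apply: L1Z; exact: L1_expRNabs. Qed.

Lemma line_heat_le (r : R) : 0 < r -> r * line_heat (r ^+ 2) <= gauss_bound.
Proof.
move=> r0; rewrite line_heat_scaled// ler_pM2l ?invr_gt0 ?mulr_gt0 ?pi_gt0//.
have hd : L1 (heat_integrand r).
  apply: L1_dom L1_heat_dominant (measurable_heat_integrand r) _ => x.
  by rewrite ger0_norm ?heat_integrand_ge0// heat_integrand_le.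
by apply: le_intR hd L1_heat_dominant _ => x; exact: heat_integrand_le.
Qed.

Lemma gauss_bound_ge0 : 0 <= gauss_bound.
Proof.
by rewrite mulr_ge0 ?invr_ge0 ?mulr_ge0 ?pi_ge0// intR_ge0// => x.
Qed.

(** Local limit theorem for the line: in the variable x the integrands tend to the Gaussian e^(-
    x^2). The shift by 1 keeps the scale n s positive. *)
Lemma line_heat_cvg (s : R) : 0 < s ->
  (fun n : nat => n%:R * line_heat ((n%:R * s) ^+ 2)) @ \oo --> gauss_cst / s.
Proof.
move=> s0; have p0 := @pi_gt0 R; rewrite -(cvg_shiftn 1).
have E n : (n + 1)%:R * line_heat (((n + 1)%:R * s) ^+ 2) =
   (2 * pi)^-1 * intR (heat_integrand ((n + 1)%:R * s)) / s.
  have n0 : 0 < (n + 1)%:R * s :> R by rewrite mulr_gt0// ltr0n addn1.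
  by rewrite -line_heat_scaled//; field; rewrite gt_eqF.
rewrite /=; under eq_fun do rewrite E.
apply: cvgMl; apply: cvgMr.
apply: (intR_dct L1_heat_dominant).
- by move=> n; exact: measurable_heat_integrand.
- move=> x.
  have h := @cvg_sqr_cos (x / s); rewrite -(cvg_shiftn 1) in h.
  have {}h : (fun n => ((n + 1)%:R * s) ^+ 2 * (2 - 2 * cos (x / ((n + 1)%:R * s)))) @ \oo --> x ^+ 2.
    have : (fun n => s ^+ 2 * ((n + 1)%:R ^+ 2 * (2 - 2 * cos (x / s / (n + 1)%:R)))) @ \oo --> s ^+ 2 * (x / s) ^+ 2.
      by apply: cvgMr; exact: h.
    have -> : s ^+ 2 * (x / s) ^+ 2 = x ^+ 2 by field; rewrite gt_eqF.
    apply: cvg_trans; apply: near_eq_cvg; near=> n => /=.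
    rewrite exprMn mulrCA mulrA; congr (_ * (_ - _ * cos _)); rewrite invfM mulrA; ring.
  have hE : (fun n => expR (- (((n + 1)%:R * s) ^+ 2 * (2 - 2 * cos (x / ((n + 1)%:R * s)))))) @ \oo --> expR (- x ^+ 2).
    by apply: continuous_cvg; [exact: continuous_expR|exact: cvgN].
  apply: cvg_trans hE; apply: near_eq_cvg; near=> n.
  rewrite /heat_integrand (_ : (- (pi * ((n + 1)%:R * s)) <= x < pi * ((n + 1)%:R * s))%R = true) ?mul1r//.
  suff : `|x| < pi * ((n + 1)%:R * s) by rewrite ltr_norml => /andP[/ltW -> ->].
  rewrite mulrCA -ltr_pdivrMr ?mulr_gt0//.
  apply: (@lt_le_trans _ _ n%:R); last by rewrite ler_nat leq_addr.
  by near: n; exact: nbhs_infty_gtr.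
- move=> n x; rewrite ger0_norm ?heat_integrand_ge0// heat_integrand_le//.
  by rewrite mulr_gt0// ltr0n addn1.
Unshelve. all: by end_near. Qed.

Lemma expRN_lipschitz (x y : R) : 0 <= x -> 0 <= y -> `|expR (- x) - expR (- y)| <= `|x - y|.
Proof.
wlog xy : x y / x <= y => [h x0 y0|x0 _].
  have [/h|/ltW/h h'] := leP x y; first exact.
  by rewrite distrC [leRHS]distrC; exact: h'.
rewrite ger0_norm ?subr_ge0 ?ler_expR ?lerN2// ler0_norm ?subr_le0// opprB.
have := expR_ge1Dx (x - y); have e1 : expR (- x) <= 1 by rewrite expR_le1 oppr_le0.
have -> : expR (- y) = expR (- x) * expR (x - y) by rewrite -expRD; congr expR; ring.
have := expR_gt0 (- x); have : expR (x - y) <= 1 by rewrite expR_le1; lra.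
nra.
Qed.

Lemma line_heat_lipschitz (t s : R) : 0 <= t -> 0 <= s ->
  `|line_heat t - line_heat s| <= 4 * `|t - s|.
Proof.
move=> t0 s0; have p0 := @pi_gt0 R.
rewrite /line_heat -mulrBr normrM gtr0_norm ?invr_gt0 ?mulr_gt0//.
have ct := @continuous_expcos R t; have cs := @continuous_expcos R s.
rewrite -RintegralB//; [|exact: cts_integrable..].
have cB : continuous (fun x : R => expR (- (t * (2 - 2 * cos x))) - expR (- (s * (2 - 2 * cos x)))).
  by move=> x; exact: (cvgB (ct x) (cs x)).
rewrite mulrC ler_pdivrMr ?mulr_gt0//.
apply: (le_trans (le_normr_Rintegral _ (cts_integrable cB))) => //.
rewrite [leRHS]mulrC -Rintegral_J_cst; apply: le_Rintegral => //.
- by apply: cts_integrable => x; exact: (cvg_norm (cB x)).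
- by apply: cts_integrable => x; exact: cvg_cst.
move=> x _; have c1 := cos_le1 x; have c2 := cos_geN1 x.
apply: (le_trans (expRN_lipschitz _ _)).
- by apply: mulr_ge0 => //; lra.
- by apply: mulr_ge0 => //; lra.
rewrite -mulrBl normrM mulrC ler_wpM2r// ger0_norm; lra.
Qed.

Lemma continuous_line_heat (t : R) : 0 < t -> {for t, continuous (@line_heat R)}.
Proof.
move=> t0; apply/cvgrPdist_lt => /= e e0.
near=> s.
have s0 : 0 < s by near: s; exact: lt_nbhsr.
rewrite (le_lt_trans (line_heat_lipschitz (ltW t0) (ltW s0)))//.
rewrite mulrC -ltr_pdivlMr//; near: s.
by apply: (@cvgr_dist_lt _ R^o _ _ _ id t) => //; rewrite divr_gt0.
Unshelve. all: by end_near. Qed.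

End limits.

(** * Theta functions *)

Section theta.
Variable R : realType.

(** The nonzero eigenvalues of the circle R / Z are (2 pi (k + 1))^2, each of multiplicity two, so
    [theta u] below is its heat trace at time u. *)
Definition theta_term (u : R) (k : nat) : R := expR (- (4 * pi ^+ 2 * u * k.+1%:R ^+ 2)).

Definition theta_partial (K : nat) (u : R) : R := 1 + 2 * \sum_(k < K) theta_term u k.

Definition theta (u : R) : R := limn (theta_partial ^~ u).

Lemma sum_invr_sqr_tail M N : (0 < M)%N -> \sum_(M <= k < M + N) (k.+1%:R ^- 2 : R) <= M%:R^-1.
Proof.
move=> M0; suff : \sum_(M <= k < M + N) (k.+1%:R ^- 2 : R) <= M%:R^-1 - (M + N)%N%:R^-1.
  by move=> h; apply: le_trans h _; rewrite gerBl invr_ge0.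
elim: N => [|N ih]; first by rewrite addn0 big_geq// subrr.
rewrite addnS big_nat_recr ?leq_addr//=; set n := (M + N)%N in ih *.
have n0 : 0 < n%:R :> R by rewrite ltr0n /n; lia.
have -> : n.+1%:R = n%:R + 1 :> R by rewrite natr1.
have : (n%:R + 1) ^- 2 <= n%:R^-1 - (n%:R + 1)^-1 :> R.
  have -> : n%:R^-1 - (n%:R + 1)^-1 = (n%:R * (n%:R + 1))^-1 :> R.
    by field; rewrite !gt_eqF//; lra.
  by rewrite lef_pV2 ?posrE ?exprn_gt0 ?mulr_gt0//; [rewrite expr2 ler_wpM2r|..]; lra.
by move=> h; apply: le_trans (lerD ih h) _; rewrite addrA subrK.
Qed.

Lemma sum_gauss_tail (u : R) M N : 0 < u -> (0 < M)%N -> (M <= N)%N ->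
  \sum_(M <= k < N) expR (- (u * k.+1%:R ^+ 2)) <= (u * M%:R)^-1.
Proof.
move=> u0 M0 /subnKC <-.
apply: (le_trans (@sum_gauss_le _ u 1 _ _ u0 isT)).
rewrite (_ : 1`!%:R = 1)//.
rewrite expr1 mul1r invfM; apply: ler_wpM2l; last exact: sum_invr_sqr_tail.
by rewrite invr_ge0 ltW.
Qed.

Lemma theta_term_le u k : 0 <= u -> theta_term u k <= expR (- (u * k.+1%:R ^+ 2)).
Proof.
move=> u0; rewrite ler_expR lerN2 ler_wpM2r ?sqr_ge0//.
by have : 1 <= 4 * pi ^+ 2 :> R by [have := @pi_ge2 R; nra]; nra.
Qed.

Lemma theta_term_ge0 u k : 0 <= theta_term u k.
Proof. exact: expR_ge0. Qed.

Lemma theta_partial_nd u : nondecreasing_seq (theta_partial ^~ u).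
Proof.
apply/nondecreasing_seqP => K; rewrite /theta_partial big_ord_recr/= lerD2l ler_pM2l//.
by rewrite lerDl theta_term_ge0.
Qed.

Lemma theta_partial_tail M N u : 0 < u -> (0 < M)%N -> (M <= N)%N ->
  theta_partial N u <= theta_partial M u + 2 * (u * M%:R)^-1.
Proof.
move=> u0 M0 MN; rewrite /theta_partial -addrA lerD2l -mulrDr ler_pM2l//.
rewrite -!(big_mkord xpredT (theta_term u)) (@big_cat_nat _ _ _ M)//= lerD2l.
apply: le_trans (sum_gauss_tail u0 M0 MN).
by apply: ler_sum => k _; apply: theta_term_le; exact: ltW.
Qed.

Lemma theta_cvg u : 0 < u -> theta_partial ^~ u @ \oo --> theta u.
Proof.
move=> u0; apply: (nondecreasing_is_cvgn (theta_partial_nd u)).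
exists (theta_partial 1 u + 2 * (u * 1)^-1) => _ [N _ <-].
have [N1|N1] := leqP 1 N; first exact: (@theta_partial_tail 1).
apply: (@le_trans _ _ (theta_partial 1 u)); first by apply: theta_partial_nd; lia.
by rewrite lerDl mulr_ge0// mulr1 invr_ge0 ltW.
Qed.

Lemma theta_partial_le M u : 0 < u -> theta_partial M u <= theta u.
Proof.
move=> u0; apply: nondecreasing_cvgn_le; first exact: theta_partial_nd.
by apply/cvg_ex; exists (theta u); exact: theta_cvg.
Qed.

Lemma theta_le_partial M u : 0 < u -> (0 < M)%N ->
  theta u <= theta_partial M u + 2 * (u * M%:R)^-1.
Proof.
move=> u0 M0; apply: limr_le; first by apply/cvg_ex; exists (theta u); exact: theta_cvg.
by exists M => // N MN; exact: theta_partial_tail.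
Qed.

Lemma theta_partial_ge1 M u : 1 <= theta_partial M u.
Proof. by rewrite lerDl mulr_ge0// sumr_ge0// => k _; exact: theta_term_ge0. Qed.

Lemma cycle_term_cvg (u : R) k : 
  (fun m : nat => cycle_term m (m%:R ^+ 2 * u) k.+1) @ \oo --> theta_term u k.
Proof.
have h := @cvg_sqr_cos R (2 * pi * k.+1%:R).
apply: continuous_cvg; first exact: continuous_expR.
apply: cvgN.
have -> : 4 * pi ^+ 2 * u * k.+1%:R ^+ 2 = u * (2 * pi * k.+1%:R) ^+ 2 by ring.
have {}h : (fun m : nat => u * (m%:R ^+ 2 * (2 - 2 * cos (2 * pi * k.+1%:R / m%:R)))) @ \oo --> u * (2 * pi * k.+1%:R) ^+ 2.
  by apply: cvgMr; exact: h.
rewrite (_ : (fun _ => _) = (fun m : nat => u * (m%:R ^+ 2 * (2 - 2 * cos (2 * pi * k.+1%:R / m%:R)))))//.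
by apply/funext => m; ring.
Qed.

(** At time m^2 u the terms beyond M are bounded by a Gaussian tail free of m, which permits the
    limit m -> oo term by term. The condition on m makes both sums of [cycle_heatE] contain the
    first M terms. *)
Lemma cycle_heat_tail M m (u : R) : 0 < u -> (0 < M)%N -> (2 * M + 2 <= m)%N ->
  0 <= cycle_heat m (m%:R ^+ 2 * u) - (1 + 2 * \sum_(k < M) cycle_term m (m%:R ^+ 2 * u) k.+1)
    <= 2 * (u * M%:R)^-1.
Proof.
move=> u0 M0 Mm; have m0 : (0 < m)%N by lia.
have m0' : 0 < m%:R :> R by rewrite ltr0n.
set t := _ * u; have t0 : 0 <= t by rewrite mulr_ge0 ?sqr_ge0// ltW.
have key N : (M <= N)%N -> (N <= m./2)%N ->
   0 <= \sum_(k < N) cycle_term m t k.+1 - \sum_(k < M) cycle_term m t k.+1 <= (u * M%:R)^-1.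
  move=> MN Nm; rewrite -!(big_mkord xpredT (fun k => cycle_term m t k.+1)).
  rewrite (@big_cat_nat _ _ _ M 0 N)//= addrAC subrr add0r.
  rewrite sumr_ge0 => [|k _]; last exact: expR_ge0.
  apply: le_trans (sum_gauss_tail u0 M0 MN).
  rewrite !big_nat; apply: ler_sum => k /andP[_ kN].
  apply: (le_trans (cycle_term_le t0 m0 _)); first by lia.
  have -> : t / m%:R ^+ 2 = u by rewrite /t; field; rewrite gt_eqF.
  by [].
have h1 := key m./2 _ (leqnn _); have h2 := key m.-1./2.
have {}h1 : 0 <= \sum_(k < m./2) cycle_term m t k.+1 - \sum_(k < M) cycle_term m t k.+1 <= (u * M%:R)^-1.
  by apply: h1; lia.
have {}h2 : 0 <= \sum_(k < m.-1./2) cycle_term m t k.+1 - \sum_(k < M) cycle_term m t k.+1 <= (u * M%:R)^-1.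
  by apply: h2; lia.
rewrite cycle_heatE//; move: h1 h2 => /andP[a1 a2] /andP[b1 b2].
by apply/andP; split; lra.
Qed.

Lemma cvg_sum_ord M (f : nat -> nat -> R) (l : nat -> R) :
  (forall k, f^~ k @ \oo --> l k) ->
  (fun m => \sum_(k < M) f m k) @ \oo --> \sum_(k < M) l k.
Proof.
move=> h; elim: M => [|M ih].
  by under eq_fun do rewrite big_ord0; rewrite big_ord0; exact: cvg_cst.
under eq_fun do rewrite big_ord_recr; rewrite big_ord_recr/=.
by apply: cvgD => //; exact: h.
Qed.

Lemma cycle_heat_cvg (u : R) : 0 < u ->
  (fun m : nat => cycle_heat m (m%:R ^+ 2 * u)) @ \oo --> theta u.
Proof.
move=> u0; apply/cvgrPdist_le => /= e e0.
pose M := (Num.bound (6 / (u * e))).+1.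
have M0 : (0 < M)%N by [].
have Me : 2 * (u * M%:R)^-1 <= e / 3.
  rewrite ler_pdivrMr ?mulr_gt0// -ler_pdivrMl ?divr_gt0//.
  apply: (@le_trans _ _ (u * (6 / (u * e)))).
    by rewrite le_eqVlt; apply/orP; left; apply/eqP; field; rewrite !gt_eqF.
  rewrite ler_pM2l//; apply/ltW/(lt_trans (archi_boundP _)); last by rewrite ltr_nat.
  by rewrite divr_ge0// mulr_ge0// ltW.
have cM : (fun m : nat => 1 + 2 * \sum_(k < M) cycle_term m (m%:R ^+ 2 * u) k.+1) @ \oo -->
    theta_partial M u.
  apply: cvgD; first exact: cvg_cst.
  apply: cvgMr; apply: (@cvg_sum_ord M (fun m k => cycle_term m (m%:R ^+ 2 * u) k.+1) (theta_term u)) => k.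
  exact: cycle_term_cvg.
have e3 : 0 < e / 3 by rewrite divr_gt0.
move/cvgrPdist_le : cM => /(_ _ e3) cM.
near=> m.
have := theta_le_partial u0 M0; have := theta_partial_le M u0.
have Mm : (2 * M + 2 <= m)%N by near: m; exists (2 * M + 2)%N.
have /andP[] := cycle_heat_tail u0 M0 Mm.
have : `|theta_partial M u - (1 + 2 * \sum_(k < M) cycle_term m (m%:R ^+ 2 * u) k.+1)| <= e / 3.
  by near: m.
rewrite !ler_norml => /andP[a1 a2] b1 b2 c1 c2.
by apply/andP; split; lra.
Unshelve. all: by end_near. Qed.

Lemma cycle_heat_mul_cvg (b : nat) (u : R) : (0 < b)%N -> 0 < u ->
  (fun n : nat => cycle_heat (b * n) (n%:R ^+ 2 * u)) @ \oo --> theta (u / b%:R ^+ 2).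
Proof.
move=> b0 u0; have b0' : 0 < b%:R :> R by rewrite ltr0n.
have u1 : 0 < u / b%:R ^+ 2 by rewrite divr_gt0// exprn_gt0.
have := cycle_heat_cvg u1 => h.
have {}h : (fun n : nat => cycle_heat (b * n) ((b * n)%N%:R ^+ 2 * (u / b%:R ^+ 2))) @ \oo --> theta (u / b%:R ^+ 2).
  apply: (cvg_comp (fun n => b * n)%N _ _ h).
  by move=> A [N _ NA]; exists N => // n /= Nn; apply: NA => /=; rewrite (leq_trans Nn)// leq_pmull.
have E n : (b * n)%N%:R ^+ 2 * (u / b%:R ^+ 2) = n%:R ^+ 2 * u :> R.
  by rewrite natrM; field; rewrite gt_eqF.
by under eq_fun do rewrite -E.
Qed.

Lemma line_heat_mul_cvg (b : nat) (s : R) : 0 < s ->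
  (fun n : nat => (b * n)%N%:R * line_heat (n%:R ^+ 2 * s ^+ 2)) @ \oo --> b%:R * gauss_cst R / s.
Proof.
move=> s0; have h := @line_heat_cvg R s s0.
rewrite -mulrA; under eq_fun => n do rewrite -exprMn natrM -mulrA.
by apply: cvgMr; exact: h.
Qed.

Lemma prodB_le (q : nat) (c l : 'I_q -> R) (e M : R) : 0 <= e -> 1 <= M ->
  (forall i, 0 <= l i) -> (forall i, l i <= c i <= M) -> (forall i, c i - l i <= e) ->
  0 <= \prod_i c i - \prod_i l i <= q%:R * e * M ^+ q.
Proof.
move=> e0 M1 l0 lc ce; have M0 : 0 <= M by lra.
elim: q c l l0 lc ce => [|q ih] c l l0 lc ce.
  by rewrite !big_ord0 subrr mul0r mul0r lexx.
rewrite !big_ord_recl; set C := \prod_(i < q) _; set L := \prod_(i < q) _.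
have /andP[h1 h2] : 0 <= C - L <= q%:R * e * M ^+ q by apply: ih.
have L0 : 0 <= L by apply: prodr_ge0.
have CM : C <= M ^+ q.
  have : C <= \prod_(i < q) M.
    apply: ler_prod => i _; have /andP[a b] := lc (lift ord0 i).
    by rewrite (le_trans (l0 _) a).
  by rewrite prodr_const card_ord.
have /andP[a b] := lc ord0; have e' := ce ord0; have l0' := l0 ord0.
have -> : c ord0 * C - l ord0 * L = (c ord0 - l ord0) * C + l ord0 * (C - L) by ring.
have C0 : 0 <= C by lra.
have Mq : M ^+ q <= M ^+ q.+1 by rewrite ler_weXn2l.
apply/andP; split; first by rewrite addr_ge0// mulr_ge0//; lra.
rewrite addrC; have -> : q.+1%:R * e * M ^+ q.+1 = q%:R * e * M ^+ q.+1 + e * M ^+ q.+1.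
  by rewrite -natr1; ring.
apply: lerD.
  apply: (@le_trans _ _ (M * (q%:R * e * M ^+ q))).
    by apply: ler_pM => //; lra.
  by rewrite exprS le_eqVlt; apply/orP; left; apply/eqP; ring.
by apply: ler_pM; lra.
Qed.

Section product.
Variables (q : nat) (b : 'I_q -> nat).
Hypothesis b_gt0 : forall i, (0 < b i)%N.

Definition torus_theta (v : R) : R := \prod_(i < q) theta (expR v / (b i)%:R ^+ 2).

(* theta_cst e^(- q v / 2) is the leading term of torus_theta at v = - oo. *)
Definition theta_cst : R := \prod_(i < q) ((b i)%:R * gauss_cst R).

Definition torus_tr (n : nat) (v : R) : R :=
  \prod_(i < q) cycle_heat (b i * n) (n%:R ^+ 2 * expR v).

Definition line_tr (n : nat) (v : R) : R :=
  \prod_(i < q) ((b i * n)%N%:R * line_heat (n%:R ^+ 2 * expR v)).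

Lemma cvg_prod_ord (r : nat) (f : 'I_r -> nat -> R) (l : 'I_r -> R) :
  (forall i, f i @ \oo --> l i) ->
  (fun n => \prod_(i < r) f i n) @ \oo --> \prod_(i < r) l i.
Proof.
elim: r f l => [|r ih] f l h.
  by under eq_fun do rewrite big_ord0; rewrite big_ord0; exact: cvg_cst.
under eq_fun do rewrite big_ord_recl; rewrite big_ord_recl.
by apply: cvgM; [exact: h|apply: (ih (fun i => f (lift ord0 i)))].
Qed.

Lemma torus_tr_cvg v : (torus_tr ^~ v) @ \oo --> torus_theta v.
Proof.
by apply: cvg_prod_ord => i; apply: cycle_heat_mul_cvg => //; exact: expR_gt0.
Qed.

Lemma expR_half (v : R) : expR v = expR (v / 2) ^+ 2.
Proof. by rewrite -expRM_natl; congr expR; field. Qed.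

Lemma line_tr_cvg v : (line_tr ^~ v) @ \oo --> theta_cst * expR (- (q%:R / 2 * v)).
Proof.
have -> : theta_cst * expR (- (q%:R / 2 * v)) =
    \prod_(i < q) ((b i)%:R * gauss_cst R / expR (v / 2)).
  rewrite big_split/= prodr_const card_ord; congr (_ * _).
  by rewrite -expRN -expRM_natl; congr expR; field.
apply: cvg_prod_ord => i.
have := @line_heat_mul_cvg (b i) (expR (v / 2)) (expR_gt0 _).
by rewrite -expR_half.
Qed.

(** The bounds are uniform in n because at time n^2 e^v on a cycle of length b_i n the quotient t /
    m^2 is e^v / b_i^2. For v <= 0 each factor is O(e^(- v / 2)), so replacing cycles by lines costs
    at most e^(- q v / 2) times the error per factor. That error is taken of order e^((q + 1) v),
    which leaves O(e^v) and requires n >= 4 (q + 1). *)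
Lemma torus_line_bounds (K : nat) : (0 < K)%N -> exists n0 : nat, exists2 C : R, 0 <= C &
  forall n v, (n0 <= n)%N ->
  [/\ v <= 0 -> `|torus_tr n v - line_tr n v| <= C * expR v,
      0 <= v -> `|torus_tr n v - 1| <= C * expR (- (K%:R * v)) &
      `|line_tr n v| <= C * expR (- (q%:R / 2 * v))].
Proof.
move=> K0.
pose B : R := (\sum_(i < q) b i)%N%:R + 1.
have B1 : 1 <= B by rewrite lerDr.
have bB i : (0 : R) < (b i)%:R <= B.
  rewrite ltr0n b_gt0/=; apply: (@le_trans _ _ (\sum_(i < q) b i)%N%:R); last by rewrite lerDl.
  by rewrite ler_nat (bigD1 i)//= leq_addr.
have g0 := gauss_bound_ge0 R.
pose H := heat_cst R q.+1; have H0 : 0 <= H by exact: heat_cst_ge0.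
pose M0 := B * gauss_bound R + H + 1.
have M01 : 1 <= M0 by rewrite lerDr addr_ge0// mulr_ge0//; lra.
pose D := 4 * K`!%:R * B ^+ (2 * K).
have D0 : 0 <= D by rewrite mulr_ge0// exprn_ge0//; lra.
pose C1 := q%:R * H * M0 ^+ q; pose C2 := q%:R * D * (1 + D) ^+ q.
pose C3 := (B * gauss_bound R) ^+ q.
have C10 : 0 <= C1 by rewrite !mulr_ge0// exprn_ge0//; lra.
have C20 : 0 <= C2 by rewrite !mulr_ge0// exprn_ge0//; lra.
have C30 : 0 <= C3 by rewrite exprn_ge0// mulr_ge0//; lra.
exists (4 * q.+1)%N, (C1 + C2 + C3); first by rewrite !addr_ge0.
move=> n v nq; have n0 : (0 < n)%N by lia.
have n0' : 0 < n%:R :> R by rewrite ltr0n.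
set u := expR v; have u0 : 0 < u by exact: expR_gt0.
set s := expR (v / 2); have s0 : 0 < s by exact: expR_gt0.
have us : u = s ^+ 2 by exact: expR_half.
pose c i := cycle_heat (b i * n) (n%:R ^+ 2 * u).
pose l i := (b i * n)%N%:R * line_heat (n%:R ^+ 2 * u).
have t0 : 0 < n%:R ^+ 2 * u by rewrite mulr_gt0// exprn_gt0.
have bn0 i : (0 < b i * n)%N by rewrite muln_gt0 b_gt0.
have tE i : n%:R ^+ 2 * u / (b i * n)%N%:R ^+ 2 = u / (b i)%:R ^+ 2.
  have /andP[bi _] := bB i.
  by rewrite natrM; field; rewrite !gt_eqF.
have uB i : u / (b i)%:R ^+ 2 <= u.
  rewrite ler_pdivrMr ?exprn_gt0 ?ltr0n//; apply: ler_peMr; first exact: ltW.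
  by rewrite exprn_ege1// ler1n.
have l_ge0 i : 0 <= l i by rewrite mulr_ge0// line_heat_ge0.
have lB i : l i <= B * gauss_bound R / s.
  rewrite /l us -exprMn natrM -mulrA.
  have ns : 0 < n%:R * s by rewrite mulr_gt0.
  have h := line_heat_le ns.
  have -> : n%:R * line_heat ((n%:R * s) ^+ 2) = (n%:R * s * line_heat ((n%:R * s) ^+ 2)) / s.
    by field; rewrite gt_eqF.
  rewrite -[leRHS]mulrA; have /andP[bi bi'] := bB i.
  apply: ler_pM; [exact: ltW| |exact: bi'|].
    apply: divr_ge0; last exact: ltW.
    by apply: mulr_ge0; [exact: ltW|exact: line_heat_ge0].
  by apply: ler_wpM2r; [rewrite invr_ge0 ltW|exact: h].
have cl i : 0 <= c i - l i <= H * u ^+ q.+1.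
  have h : (4 * q.+1 <= b i * n)%N by rewrite (leq_trans nq)// leq_pmull.
  have /andP[-> /= cl] := cycle_line_heat_pow (ltn0Sn q) h t0.
  apply: (le_trans cl); rewrite tE; apply: ler_wpM2l; first exact: H0.
  apply: lerXn2r; rewrite ?nnegrE; [|exact: ltW|exact: uB].
  by apply: divr_ge0; [exact: ltW|exact: exprn_ge0].
have cD i : 1 <= c i <= 1 + D / u ^+ K.
  rewrite cycle_heat_ge1//=.
  apply: (le_trans (cycle_heat_le K0 (bn0 i) t0)); rewrite lerD2l tE.
  have -> : 4 * K`!%:R / (u / (b i)%:R ^+ 2) ^+ K = (4 * K`!%:R / u ^+ K) * (b i)%:R ^+ (2 * K).
    by rewrite expr_div_n -exprM; field; rewrite !expf_neq0 ?gt_eqF// ltr0n.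
  rewrite /D -[X in _ <= X]mulrA [B ^+ _ / _]mulrC mulrA ler_wpM2l//.
    by rewrite divr_ge0// exprn_ge0// ltW.
  have /andP[bi bi'] := bB i.
  by apply: lerXn2r; rewrite ?nnegrE; [exact: ltW|lra|exact: bi'].
have sq : expR (- (q%:R / 2 * v)) = s ^- q.
  by rewrite /s -expRM_natl -expRN; congr expR; field.
split=> [v0|v0|].
- have u1 : u <= 1 by rewrite expR_le1.
  have s1 : s <= 1 by rewrite expR_le1; lra.
  have hM i : l i <= c i <= M0 / s.
    have /andP[h1 h2] := cl i; have h3 := lB i.
    have hH : H * u ^+ q.+1 <= H / s.
      apply: ler_wpM2l => //; apply: (@le_trans _ _ 1); last by rewrite invf_ge1.
      by apply: exprn_ile1; [exact: ltW|].
    apply/andP; split; first lra.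
    rewrite /M0 [(_ + 1) / s]mulrDl [(_ + H) / s]mulrDl; have : 0 <= 1 / s by rewrite divr_ge0// ltW.
    lra.
  have M0s : 1 <= M0 / s by rewrite ler_pdivlMr// mul1r; lra.
  have eC : 0 <= H * u ^+ q.+1 by rewrite mulr_ge0// exprn_ge0// ltW.
  have /andP[p1 p2] := prodB_le eC M0s l_ge0 hM (fun i => proj2 (andP (cl i))).
  rewrite ger0_norm//; apply: (le_trans p2).
  apply: (@le_trans _ _ (C1 * u)); last by apply: ler_wpM2r; [exact: ltW|lra].
  rewrite expr_div_n /C1.
  have -> : q%:R * (H * u ^+ q.+1) * (M0 ^+ q / s ^+ q) = q%:R * H * M0 ^+ q * (u * (u ^+ q / s ^+ q)).
    by rewrite exprS; ring.
  apply: ler_wpM2l; first exact: C10.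
  apply: ler_piMr; first exact: ltW.
  have -> : u ^+ q / s ^+ q = s ^+ q.
    by rewrite us -exprM mulnC exprM; field; rewrite expf_neq0// gt_eqF.
  by apply: exprn_ile1; [exact: ltW|].
- have u1 : 1 <= u by rewrite -expR0 ler_expR.
  have uK : 1 <= u ^+ K by rewrite exprn_ege1.
  have DK : D / u ^+ K <= D by rewrite ler_pdivrMr ?exprn_gt0// ler_peMr.
  have eD : 0 <= D / u ^+ K by rewrite divr_ge0// exprn_ge0// ltW.
  have M1 : 1 <= 1 + D by rewrite lerDl.
  have h1 (i : 'I_q) : (1 : R) <= c i <= 1 + D.
    by have /andP[-> /=] := cD i; lra.
  have h2 (i : 'I_q) : c i - 1 <= D / u ^+ K by have /andP[_] := cD i; lra.
  have /andP[] := @prodB_le q c (fun=> 1) _ _ eD M1 (fun=> ler01) h1 h2.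
  rewrite [\prod_(_ < q) 1]big1// => p1 p2; rewrite ger0_norm//; apply: (le_trans p2).
  have -> : expR (- (K%:R * v)) = u ^- K by rewrite expRN expRM_natl.
  apply: (@le_trans _ _ (C2 / u ^+ K)).
    by rewrite le_eqVlt; apply/orP; left; apply/eqP; rewrite /C2; ring.
  by apply: ler_wpM2r; [rewrite invr_ge0 exprn_ge0// ltW|lra].
- rewrite ger0_norm; last by apply: prodr_ge0 => i _; exact: l_ge0.
  rewrite sq; apply: (@le_trans _ _ (C3 / s ^+ q)); last first.
    by apply: ler_wpM2r; [rewrite invr_ge0 exprn_ge0// ltW|lra].
  rewrite /C3 -expr_div_n -[X in _ ^+ X](card_ord q) -prodr_const; apply: ler_prod => i _.
  by rewrite l_ge0 lB.
Qed.

End product.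

End theta.

(** * The logarithm of the determinant *)

Section log_determinant.
Variable R : realType.

Lemma ln_prod (I : finType) (P : pred I) (F : I -> R) : (forall i, P i -> 0 < F i) ->
  ln (\prod_(i | P i) F i) = \sum_(i | P i) ln (F i).
Proof.
move=> F0; suff [] : 0 < \prod_(i | P i) F i /\ ln (\prod_(i | P i) F i) = \sum_(i | P i) ln (F i) by [].
elim/big_rec2 : _ => [|i x y Pi [y0 <-]]; first by rewrite ln1.
by rewrite mulr_gt0 ?F0// lnM ?posrE ?F0.
Qed.

Lemma continuous_sum (I : finType) (F : I -> R -> R) : (forall i, continuous (F i)) ->
  continuous (fun v => \sum_i F i v).
Proof.
move=> cF v; rewrite (_ : (fun _ => _) = \sum_i F i); last first.
  by apply/funext => x; rewrite fct_sumE.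
by elim/big_ind : _ => [|f g cf cg|i _]; [exact: cvg_cst|exact: cvgD|exact: cF].
Qed.

Lemma line_heat_le1 (t : R) : 0 <= t -> line_heat t <= 1.
Proof.
move=> t0; have p0 := @pi_gt0 R.
rewrite /line_heat ler_pdivrMl ?mulr_gt0// -Rintegral_J_cst.
apply: le_Rintegral => //.
- by apply: cts_integrable; exact: continuous_expcos.
- by apply: cts_integrable => x; exact: cvg_cst.
- move=> x _; by rewrite expR_le1 oppr_le0 mulr_ge0.
Qed.

Lemma line_heat_ge (t : R) : 0 <= t -> 1 - 4 * t <= line_heat t.
Proof.
move=> t0; have := @line_heat_lipschitz R t 0 t0 (lexx 0).
have -> : line_heat 0 = 1 :> R.
  rewrite /line_heat; under eq_Rintegral do rewrite mul0r oppr0 expR0.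
  by rewrite Rintegral_J_cst mulr1 mulVf// mulf_neq0// gt_eqF// pi_gt0.
by rewrite subr0 (ger0_norm t0) ler_norml => /andP[]; lra.
Qed.

Lemma sub1_expr_le (x : R) n : 0 <= x <= 1 -> 1 - x ^+ n <= n%:R * (1 - x).
Proof.
move=> /andP[x0 x1]; elim: n => [|n ih]; first by rewrite expr0; lra.
rewrite exprS -natr1; have : 0 <= x ^+ n <= 1 by rewrite exprn_ge0// exprn_ile1.
by move=> /andP[h1 h2]; nra.
Qed.

(** At - oo both terms are 1 + O(e^v). At + oo, since lam may vanish, the decay is taken from a
    single factor [line_heat], of order e^(- v / 2), the others being at most 1; this is where 0 < q
    enters. *)
Lemma L1_Gum_line_heat (q : nat) (lam : R) : (0 < q)%N -> 0 <= lam ->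
  L1 (fun v => Gum v - line_heat (expR v) ^+ q * expR (- (lam * expR v))).
Proof.
move=> q0 lam0; have gb0 := gauss_bound_ge0 R.
pose X (v : R) := line_heat (expR v) ^+ q * expR (- (lam * expR v)).
have cX : continuous X.
  move=> v; apply: cvgM.
    apply: (@continuous_comp _ _ _ (fun v => line_heat (expR v)) (fun x => x ^+ q)); last exact: exprn_continuous.
    apply: continuous_comp; first exact: continuous_expR.
    by apply: continuous_line_heat; exact: expR_gt0.
  apply: continuous_comp; last exact: continuous_expR.
  by apply: cvgN; apply: cvgM; [exact: cvg_cst|exact: continuous_expR].
have -> : (fun v => Gum v - line_heat (expR v) ^+ q * expR (- (lam * expR v))) =
   (fun v => Gum0 v - (X v - (v < 0)%R%:R)).
  by apply/funext => v; rewrite /Gum0 /X; ring.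
apply: L1B; first exact: L1_Gum0.
have h2 : 0 < 2^-1 :> R by [].
apply: (L1_dom (L1Z (4 * q%:R + lam + gauss_bound R) (L1_expRNabs h2))).
  apply: measurable_funB; last exact: measurable_lt.
  exact: continuous_measurable_fun.
move=> v; set u := expR v; have u0 : 0 < u by exact: expR_gt0.
have G0 := line_heat_ge0 u; have G1 := line_heat_le1 (ltW u0).
have e0 : 0 <= expR (- (lam * u)) by exact: expR_ge0.
have e1 : expR (- (lam * u)) <= 1 by rewrite expR_le1 oppr_le0 mulr_ge0// ltW.
have Gq0 : 0 <= line_heat u ^+ q by rewrite exprn_ge0.
have Gq1 : line_heat u ^+ q <= 1 by rewrite exprn_ile1.
have [v0|v0] := ltP v 0.
  have -> : expR (- (2^-1 * `|v|)) = expR (v / 2) by rewrite ltr0_norm//; congr expR; field.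
  have uv : u <= expR (v / 2) by rewrite ler_expR; lra.
  have := line_heat_ge (ltW u0) => G4.
  have gq : 1 - line_heat u ^+ q <= q%:R * (4 * u).
    apply: (le_trans (sub1_expr_le _ _)); first by rewrite G0 G1.
    by apply: ler_wpM2l => //; lra.
  have el : 1 - expR (- (lam * u)) <= lam * u by have := expR_ge1Dx (- (lam * u)); lra.
  rewrite ler0_norm; last by rewrite subr_le0 /X mulr_ile1.
  apply: (@le_trans _ _ ((4 * q%:R + lam + gauss_bound R) * u)); last first.
    by apply: ler_wpM2l => //; rewrite !addr_ge0// mulr_ge0.
  have : 0 <= gauss_bound R * u by rewrite mulr_ge0// ltW.
  have := mulr_ge0 (etrans (subr_ge0 _ _) Gq1) (etrans (subr_ge0 _ _) e1).
  by rewrite /X -/u (_ : true%:R = 1)//; lra.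
rewrite subr0 ger0_norm ?mulr_ge0//.
have -> : expR (- (2^-1 * `|v|)) = (expR (v / 2))^-1.
  by rewrite ger0_norm// -expRN; congr expR; field.
set s := expR (v / 2); have s0 : 0 < s by exact: expR_gt0.
apply: (@le_trans _ _ (gauss_bound R / s)); last first.
  apply: ler_wpM2r; first by rewrite invr_ge0 ltW.
  by rewrite lerDr addr_ge0// mulr_ge0.
have us : u = s ^+ 2 by exact: expR_half.
have := line_heat_le s0; rewrite -us mulrC -ler_pdivlMr// => h; apply: le_trans h.
apply: (@le_trans _ _ (line_heat u ^+ q)); first by rewrite ler_piMr.
by case: q q0 {X cX Gq0 Gq1} => // q _; rewrite exprS ler_piMr// exprn_ile1.
Qed.

Lemma natr_card_torus r (m : 'I_r -> nat) : #|torus m|%:R = \prod_(i < r) (m i)%:R :> R.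
Proof.
have := @torus_heat R r m 0.
under eq_bigr do rewrite mulr0 oppr0 expR0.
rewrite sumr_const => ->; apply: eq_bigr => i _; rewrite /cycle_heat.
by under eq_bigr do rewrite mul0r oppr0 expR0; rewrite sumr_const card_ord.
Qed.

(** Sum of [ln_intR] over the nonzero eigenvalues. The eigenvalue 0 is simple and is taken away from
    both the number of vertices and the heat trace, whence the two - 1. *)
Lemma ln_det_star r (m : 'I_r -> nat) : (forall i, (0 < m i)%N) ->
  L1 (fun v : R => (#|torus m|%:R - 1) * Gum v - (\prod_(i < r) cycle_heat (m i) (expR v) - 1)) /\
  ln (det_star (laplacian_mx R m)) =
  intR (fun v : R => (#|torus m|%:R - 1) * Gum v - (\prod_(i < r) cycle_heat (m i) (expR v) - 1)).
Proof.
move=> m0.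
have pos (j : torus m) : torus_eigenvalue R j != 0 -> 0 < torus_eigenvalue R j.
  by move=> j0; rewrite lt_neqAle eq_sym j0 torus_eigenvalue_ge0.
have -> : (fun v : R => (#|torus m|%:R - 1) * Gum v - (\prod_(i < r) cycle_heat (m i) (expR v) - 1)) =
  (fun v => \sum_(j : torus m | torus_eigenvalue R j != 0)
     (Gum v - expR (- (torus_eigenvalue R j * expR v)))).
  apply/funext => v; rewrite sumrB -torus_heat.
  rewrite (bigD1 (torus0 m0))//=.
  have /eqP -> : torus_eigenvalue R (torus0 m0) == 0 by rewrite (torus_eigenvalue_eq0 _ m0).
  rewrite mul0r oppr0 expR0 addrAC subrr add0r.
  rewrite -[X in X%:R - 1]sum1_card (bigD1 (torus0 m0))//= natrD addrAC subrr add0r.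
  congr (_ - _); last by apply: eq_bigl => j; rewrite (torus_eigenvalue_eq0 _ m0).
  rewrite natr_sum mulr_suml; apply: eq_big => j; last by rewrite mul1r.
  by rewrite (torus_eigenvalue_eq0 _ m0).
split; first by apply: L1_sum => j /pos j0; exact: (ln_intR j0).1.
rewrite det_star_laplacian// ln_prod// intR_sum; last by move=> j /pos j0; exact: (ln_intR j0).1.
by apply: eq_bigr => j /pos j0; rewrite (ln_intR j0).2.
Qed.

(** * Products of a fixed torus with growing cycles *)

Section torus_sequence.
Variables (p q : nat) (a : 'I_p -> nat) (b : 'I_q -> nat).
Hypothesis a_gt0 : forall i, (0 < a i)%N.
Hypothesis b_gt0 : forall i, (0 < b i)%N.
Hypothesis q_gt0 : (0 < q)%N.

Definition fin_heat (t : R) : R := \prod_(i < p) cycle_heat (a i) t.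

Lemma fin_heatE t : fin_heat t = \sum_(j : torus a) expR (- (torus_eigenvalue R j * t)).
Proof. by rewrite torus_heat. Qed.

(** At large times only the eigenvalue 0 of the fixed torus survives. Hence after t -> n^2 t this
    factor tends to 1, and the fixed torus leaves no trace in [tr_limit]. *)
Lemma fin_heat_bounds : exists2 C : R, 0 <= C & forall t, 0 < t ->
  [/\ 1 <= fin_heat t, fin_heat t <= #|torus a|%:R & fin_heat t <= 1 + C / t].
Proof.
exists (\sum_(j : torus a | j != torus0 a_gt0) (torus_eigenvalue R j)^-1).
  by apply: sumr_ge0 => j _; rewrite invr_ge0 torus_eigenvalue_ge0.
move=> t t0.
have E : fin_heat t = 1 + \sum_(j : torus a | j != torus0 a_gt0) expR (- (torus_eigenvalue R j * t)).
  rewrite fin_heatE (bigD1 (torus0 a_gt0))//=.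
  have /eqP -> : torus_eigenvalue R (torus0 a_gt0) == 0 by rewrite (torus_eigenvalue_eq0 _ a_gt0).
  by rewrite mul0r oppr0 expR0.
split.
- by rewrite E lerDl sumr_ge0// => j _; exact: expR_ge0.
- rewrite fin_heatE -sum1_card natr_sum; apply: ler_sum => j _.
  by rewrite expR_le1 oppr_le0 mulr_ge0 ?torus_eigenvalue_ge0// ltW.
- rewrite E lerD2l mulr_suml; apply: ler_sum => j j0.
  have l0 : 0 < torus_eigenvalue R j.
    by rewrite lt_neqAle torus_eigenvalue_ge0 eq_sym (torus_eigenvalue_eq0 _ a_gt0) j0.
  rewrite -invfM; have := @expRN_le_pow R _ 1 (mulr_gt0 l0 t0).
  by rewrite expr1 (_ : 1`!%:R = 1)// mul1r.
Qed.

Lemma continuous_fin_heat (k : R) : continuous (fun v => fin_heat (k * expR v)).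
Proof.
have -> : (fun v => fin_heat (k * expR v)) =
  (fun v => \sum_(j : torus a) expR (- (torus_eigenvalue R j * (k * expR v)))).
  by apply/funext => v; rewrite fin_heatE.
apply: continuous_sum => j v.
apply: (@continuous_comp _ _ _ (fun v => - (torus_eigenvalue R j * (k * expR v))) expR); last exact: continuous_expR.
apply: cvgN; apply: cvgM; first exact: cvg_cst.
by apply: cvgM; [exact: cvg_cst|exact: continuous_expR].
Qed.

Lemma continuous_prod_ord r (f : 'I_r -> R -> R) : (forall i, continuous (f i)) ->
  continuous (fun v => \prod_(i < r) f i v).
Proof.
elim: r f => [|r ih] f cf v.
  by rewrite (_ : (fun _ => _) = fun=> 1); [exact: cvg_cst|apply/funext => x; rewrite big_ord0].
rewrite (_ : (fun _ => _) = fun v => f ord0 v * \prod_(i < r) f (lift ord0 i) v); last first.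
  by apply/funext => x; rewrite big_ord_recl.
by apply: cvgM; [exact: cf|exact: (ih (fun i => f (lift ord0 i)))].
Qed.

Lemma continuous_torus_tr n : continuous (torus_tr b n : R -> R).
Proof.
apply: continuous_prod_ord => i; apply: continuous_sum => k v.
apply: (@continuous_comp _ _ _ (fun v => - (n%:R ^+ 2 * expR v * (2 - 2 * cos (2 * pi * k%:R / (b i * n)%N%:R)))) expR); last exact: continuous_expR.
apply: cvgN; apply: cvgM; last exact: cvg_cst.
by apply: cvgM; [exact: cvg_cst|exact: continuous_expR].
Qed.

Lemma continuous_line_tr n : (0 < n)%N -> continuous (line_tr b n : R -> R).
Proof.
move=> n0; apply: continuous_prod_ord => i v.
apply: cvgM; first exact: cvg_cst.
apply: (@continuous_comp _ _ _ (fun v : R => n%:R ^+ 2 * expR v) (@line_heat R)).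
  by apply: cvgM; [exact: cvg_cst|exact: continuous_expR].
by apply: continuous_line_heat; rewrite mulr_gt0 ?expR_gt0// exprn_gt0// ltr0n.
Qed.

(** The integrand of the remainder at time n^2 e^v. The product of [fin_heat] and [line_tr] is the
    sum of the Bessel terms over all lambda_j. *)
Definition tr_defect (n : nat) (v : R) : R :=
  1 - Gum v - fin_heat (n%:R ^+ 2 * expR v) * (torus_tr b n v - line_tr b n v).

Definition tr_limit (v : R) : R :=
  torus_theta b v - 1 + Gum v - theta_cst R b * expR (- (q%:R / 2 * v)).

Lemma tr_defect_cvg v : (tr_defect ^~ v) @ \oo --> - tr_limit v.
Proof.
have -> : - tr_limit v = 1 - Gum v - 1 * (torus_theta b v - theta_cst R b * expR (- (q%:R / 2 * v))).
  by rewrite /tr_limit; ring.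
apply: cvgB; first exact: cvg_cst.
apply: cvgM; last by apply: cvgB; [exact: torus_tr_cvg|exact: line_tr_cvg].
have [C C0 hC] := fin_heat_bounds.
have u0 := expR_gt0 v.
apply/cvgrPdist_le => /= e e0.
near=> n.
have n0 : 0 < n%:R :> R by near: n; exact: nbhs_infty_gtr.
have nC : C / (e * expR v) < n%:R by near: n; exact: nbhs_infty_gtr.
have n1 : (1 : R) <= n%:R by rewrite ler1n -(ltr0n R).
have t0 : 0 < n%:R ^+ 2 * expR v by rewrite mulr_gt0// exprn_gt0.
have [h1 _ h2] := hC _ t0.
rewrite distrC ger0_norm ?subr_ge0// lerBlDl (le_trans h2)// lerD2l.
rewrite ler_pdivrMr//; rewrite ltr_pdivrMr ?mulr_gt0// in nC.
apply: (le_trans (ltW nC)).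
rewrite (_ : e * (_ ^+ 2 * _) = n%:R * (n%:R * (e * expR v))); last by ring.
by rewrite ler_pM2l// ler_peMl// mulr_ge0// ltW.
Unshelve. all: by end_near. Qed.

(** Adding [Gum0] turns 1 - [Gum] into the indicator of v >= 0. For v < 0 only the difference torus
    minus line is left. For v >= 0 the limit 1 is removed from one factor at a time: 1 - T (tr - ln)
    = - (T - 1) tr - (tr - 1) + T ln, where each summand decays. *)
Lemma tr_defect_dom : exists n0, exists2 C : R, 0 <= C & forall n v, (n0 <= n)%N ->
  `|tr_defect n v + Gum0 v| <= C * expR (- (2^-1 * `|v|)).
Proof.
have [n0 [C C0 hC]] := @torus_line_bounds R q b b_gt0 1 isT.
have [D D0 hD] := fin_heat_bounds.
set A : R := #|torus a|%:R in hD; have A0 : 0 <= A by [].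
exists n0.+1, (A * C + (D * (1 + C) + C + A * C)); first by rewrite !(addr_ge0, mulr_ge0).
move=> n v nn0; have n1 : (1 : R) <= n%:R by rewrite ler1n; lia.
have [b1 b2 b3] := hC n v (ltnW nn0).
set u := expR v in b1; have u0 : 0 < u by exact: expR_gt0.
have t0 : 0 < n%:R ^+ 2 * u by rewrite mulr_gt0// exprn_gt0//; lra.
have [T1 TA TD] := hD _ t0.
rewrite /tr_defect /Gum0 -/u; set T := fin_heat _ in T1 TA TD *.
set tr := torus_tr b n v in b1 b2 *; set ln := line_tr b n v in b1 b3 *.
have -> : 1 - Gum v - T * (tr - ln) + (Gum v - (v < 0)%R%:R) = (1 - (v < 0)%R%:R) - T * (tr - ln) by ring.
set w := expR (- (2^-1 * `|v|)); have w0 : 0 <= w by exact: expR_ge0.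
have T0 : 0 <= T by lra.
have [v0|v0] := ltP v 0.
  rewrite (_ : true%:R = 1)// subrr sub0r normrN normrM (ger0_norm T0).
  have uw : u <= w by rewrite ler_expR ltr0_norm//; lra.
  have {}b1 := b1 (ltW v0).
  apply: (@le_trans _ _ (A * C * w)).
    rewrite -mulrA; apply: ler_pM => //.
    by apply: (le_trans b1); exact: ler_wpM2l.
  by apply: ler_wpM2r => //; rewrite lerDl !(addr_ge0, mulr_ge0).
rewrite (_ : false%:R = 0)// subr0; have {}b2 := b2 v0.
have vw : expR (- v) <= w by rewrite ler_expR ger0_norm//; lra.
have qw : expR (- (q%:R / 2 * v)) <= w.
  rewrite ler_expR ger0_norm// lerN2 ler_wpM2r// ler_peMl//.
  by rewrite ler1n.
have vE : expR (- v) = u^-1 by rewrite expRN.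
rewrite mul1r in b2.
have e1 : expR (- v) <= 1 by rewrite expR_le1 oppr_le0.
have trC : `|tr| <= 1 + C.
  have -> : tr = 1 + (tr - 1) by ring.
  apply: (le_trans (ler_normD _ _)); rewrite normr1 lerD2l.
  by apply: (le_trans b2); rewrite ler_piMr.
have T1w : T - 1 <= D * w.
  apply: (@le_trans _ _ (D / u)); last by rewrite -vE ler_wpM2l.
  rewrite lerBlDl; apply: (le_trans TD); rewrite lerD2l ler_wpM2l// lef_pV2 ?posrE//.
  by apply: ler_peMl; [exact: ltW|exact: exprn_ege1].
have -> : 1 - T * (tr - ln) = - ((T - 1) * tr) - (tr - 1) + T * ln by ring.
apply: (le_trans (ler_normD _ _)); rewrite [leRHS]mulrDl.
apply: (@le_trans _ _ ((D * (1 + C) + C) * w + A * C * w)); last first.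
  by rewrite -[leLHS]mulrDl lerDr !mulr_ge0.
apply: lerD; last first.
  rewrite normrM (ger0_norm T0) -mulrA; apply: ler_pM => //.
  by apply: (le_trans b3); exact: ler_wpM2l.
apply: (le_trans (ler_normB _ _)); rewrite normrN [leRHS]mulrDl; apply: lerD.
  rewrite normrM ger0_norm ?subr_ge0//.
  have -> : D * (1 + C) * w = D * w * (1 + C) by ring.
  by apply: ler_pM => //; rewrite subr_ge0.
by apply: (le_trans b2); exact: ler_wpM2l.
Qed.

Lemma measurable_tr_defect n : (0 < n)%N -> measurable_fun setT (tr_defect n).
Proof.
move=> n0; apply: continuous_measurable_fun => v.
apply: cvgB; first by apply: cvgB; [exact: cvg_cst|exact: continuous_Gum].
apply: cvgM; first exact: continuous_fin_heat.
by apply: cvgB; [exact: continuous_torus_tr|exact: continuous_line_tr].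
Qed.

Lemma tr_defect_intR_cvg : L1 tr_limit /\
  (fun n => intR (tr_defect n)) @ \oo --> - intR tr_limit.
Proof.
have [n0 [C C0 hC]] := tr_defect_dom.
have h2 : 0 < 2^-1 :> R by [].
pose g v := C * expR (- (2^-1 * `|v|)) + `|Gum0 v| : R.
have g1 : L1 g by apply: L1D; [exact: (L1Z C (L1_expRNabs h2))|exact: (L1_norm (@L1_Gum0 R))].
pose f n := tr_defect (n + n0.+1).
have mf n : measurable_fun setT (f n) by apply: measurable_tr_defect; rewrite addnS.
have fg n v : `|f n v| <= g v.
  have -> : f n v = (tr_defect (n + n0.+1) v + Gum0 v) - Gum0 v by rewrite /f; ring.
  apply: (le_trans (ler_normB _ _)); rewrite lerD2r; apply: hC; lia.
have fl v : (f ^~ v) @ \oo --> - tr_limit v.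
  exact: (cvg_comp _ _ (cvg_addnr n0.+1) (@tr_defect_cvg v)).
have := intR_dct g1 mf fl fg.
have lim1 : L1 (fun v => - tr_limit v).
  have mlim : measurable_fun setT (fun v => - tr_limit v).
    by apply: (measurable_fun_cvg mf) => x _; exact: fl.
  apply: (L1_dom g1 mlim) => v.
  have cn : (fun n => `|f n v|) @ \oo --> `|- tr_limit v| by apply: cvg_norm; exact: fl.
  rewrite -(cvg_lim _ cn)//; apply: limr_le; first by apply/cvg_ex; eexists; exact: cn.
  by apply: nearW.
have L : L1 tr_limit.
  by have := L1Z (-1) lim1; under eq_fun do rewrite mulN1r opprK.
split => //.
have -> : - intR tr_limit = intR (fun v => - tr_limit v).
  by rewrite -mulN1r -(intRZ _ L); congr intR; apply/funext => v; rewrite mulN1r.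
by rewrite -(cvg_shiftn n0.+1 (fun n => intR (tr_defect n))).
Qed.

(** Limits of the discrete bounds as n -> oo. The first one gives the small-time behaviour of theta
    that Poisson summation would give, with error O(e^v). *)
Lemma torus_theta_bounds (K : nat) : (0 < K)%N -> exists2 C : R, 0 <= C & forall v,
  (v <= 0 -> `|torus_theta b v - theta_cst R b * expR (- (q%:R / 2 * v))| <= C * expR v) /\
  (0 <= v -> `|torus_theta b v - 1| <= C * expR (- (K%:R * v))).
Proof.
move=> K0; have [n0 [C C0 hC]] := @torus_line_bounds R q b b_gt0 K K0.
exists C => // v; have ct := @torus_tr_cvg R q b b_gt0 v; have cl := @line_tr_cvg R q b v.
split=> v0.
- have cn : (fun n => `|torus_tr b n v - line_tr b n v|) @ \oo -->
     `|torus_theta b v - theta_cst R b * expR (- (q%:R / 2 * v))|.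
    by apply: cvg_norm; exact: cvgB.
  rewrite -(cvg_lim _ cn)//; apply: limr_le; first by apply/cvg_ex; eexists; exact: cn.
  by exists n0 => // n /= nn0; have [+ _ _] := hC n v nn0; exact.
- have cn : (fun n => `|torus_tr b n v - 1|) @ \oo --> `|torus_theta b v - 1|.
    by apply: cvg_norm; apply: cvgB => //; exact: cvg_cst.
  rewrite -(cvg_lim _ cn)//; apply: limr_le; first by apply/cvg_ex; eexists; exact: cn.
  by exists n0 => // n /= nn0; have [_ + _] := hC n v nn0; exact.
Qed.

Lemma measurable_torus_theta : measurable_fun setT (torus_theta b : R -> R).
Proof.
apply: (@measurable_fun_cvg _ _ _ _ (torus_tr b)).
  by move=> n; apply: continuous_measurable_fun; exact: continuous_torus_tr.
by move=> v _; exact: torus_tr_cvg.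
Qed.

Definition line_integrand (lam v : R) : R :=
  Gum v - line_heat (expR v) ^+ q * expR (- (lam * expR v)).

(* Both sides are integrals over ln t; the substitution t -> n ^ 2 t turns the
   Gumbel term of the left-hand side into 2 ln n. *)
Lemma ln_det_star_defect n r (m : 'I_r -> nat) : (0 < n)%N -> (forall i, (0 < m i)%N) ->
  (forall t : R, \prod_(i < r) cycle_heat (m i) t =
     fin_heat t * \prod_(i < q) cycle_heat (b i * n) t) ->
  ln (det_star (laplacian_mx R m)) =
  \prod_(i < q) (b i * n)%N%:R *
    (\sum_(j : torus a) intR (line_integrand (torus_eigenvalue R j))) + 2 * ln n%:R +
  intR (tr_defect n).
Proof.
move=> n0 m0 mE; have [i1 ->] := ln_det_star m0.
have i2 (j : torus a) : L1 (line_integrand (torus_eigenvalue R j)).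
  by apply: L1_Gum_line_heat => //; exact: torus_eigenvalue_ge0.
set N : R := \prod_(i < q) _.
rewrite -(intR_sum _ (fun j _ => i2 j)).
have i3 : L1 (fun v => \sum_(j : torus a) line_integrand (torus_eigenvalue R j) v).
  exact: L1_sum.
rewrite -(intRZ _ i3).
have n2 : 0 < n%:R ^+ 2 :> R by rewrite exprn_gt0// ltr0n.
have [i4 e4] := ln_intR n2.
have -> : 2 * ln n%:R = ln (n%:R ^+ 2) :> R by rewrite lnXn ?ltr0n// mulr_natl.
rewrite -e4.
set h := ln (n%:R ^+ 2 : R) in e4 *.
pose f1 (v : R) := (#|torus m|%:R - 1) * Gum v - (\prod_(i < r) cycle_heat (m i) (expR v) - 1).
pose f2 (v : R) := N * \sum_(j : torus a) line_integrand (torus_eigenvalue R j) v.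
have i12 : L1 (fun v => f1 v - f2 v) by apply: L1B => //; exact: L1Z.
have hE v : expR (v + h) = n%:R ^+ 2 * expR v by rewrite expRD lnK// mulrC.
(* At t = 0 a heat trace counts the vertices. *)
have cardE : #|torus m|%:R = #|torus a|%:R * N :> R.
  rewrite !natr_card_torus.
  have c0 (k : nat) : cycle_heat k 0 = k%:R :> R.
    by rewrite /cycle_heat; under eq_bigr do rewrite mul0r oppr0 expR0; rewrite sumr_const card_ord.
  have := mE 0; rewrite /fin_heat.
  by under eq_bigr do rewrite c0; under [in X in _ = X * _]eq_bigr do rewrite c0;
     under [in X in _ = _ * X]eq_bigr do rewrite c0.
(* At v + h the time is n^2 e^v. The Gumbel terms weighted by the number of vertices cancel; the -
   [Gum (v + h)] that remains is cancelled by the integrand of ln (n^2), which leaves - [Gum v]. *)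
have E v : f1 (v + h) - f2 (v + h) - (Gum v - expR (- (n%:R ^+ 2 * expR v))) = tr_defect n v.
  have sG : \sum_(j : torus a) Gum (v + h) = #|torus a|%:R * Gum (v + h) by rewrite sumr_const mulr_natl.
  rewrite /f1 /f2 /line_integrand sumrB sG -mulr_sumr -fin_heatE.
  rewrite hE mE cardE /tr_defect /torus_tr /line_tr big_split/= -/N.
  rewrite prodr_const card_ord /Gum hE.
  ring.
have s1 : intR (fun v => f1 v - f2 v) = intR f1 - intR f2 by apply: intRB => //; exact: L1Z.
have s2 : intR (fun v => f1 (v + h) - f2 (v + h)) = intR f1 - intR f2.
  by rewrite -s1; exact: (intR_shift h i12).
have s3 := intRB (L1_shift h i12) i4.
have -> : intR (tr_defect n) =
    intR f1 - intR f2 - intR (fun v => Gum v - expR (- (n%:R ^+ 2 * expR v))).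
  by rewrite -s2 -s3; congr intR; apply/funext => v; rewrite -E.
by rewrite /f1 /f2; ring.
Qed.

End torus_sequence.
Lemma Rintegral_line (q : nat) (lam : R) :
  (\int[lebesgue_measure]_(t in `]0, +oo[)
     ((expR (- t) - bessel_I0 (2 * t) ^+ q * expR (- ((2 * q%:R + lam) * t))) / t))%R =
  intR (line_integrand q lam).
Proof.
rewrite (_ : (fun t => _) = (fun t => (expR (- t) - line_heat t ^+ q * expR (- (lam * t))) / t)); last first.
  apply/funext => t; congr ((_ - _) / _); rewrite bessel_line_heat exprMn mulrAC mulrC.
  by congr (_ * _); rewrite -expRM_natl -expRD; congr expR; ring.
apply: Rintegral_expR => t t0.
have cl (k : R) : {for t, continuous (fun t => expR (- (k * t)))}.
  apply: (@continuous_comp _ _ _ (fun t => - (k * t)) expR); last exact: continuous_expR.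
  by apply: cvgN; apply: cvgM; [exact: cvg_cst|exact: cvg_id].
have c1 : {for t, continuous (fun t : R => expR (- t))}.
  by rewrite (_ : (fun _ => _) = fun t => expR (- (1 * t)))//; apply/funext => x; rewrite mul1r.
suff cG : {for t, continuous (fun t : R => line_heat t ^+ q)} by exact: (cvgB c1 (cvgM cG (cl lam))).
apply: (@continuous_comp _ _ _ (@line_heat R) (fun x => x ^+ q)); last exact: exprn_continuous.
exact: continuous_line_heat.
Qed.

Lemma Lambda0_gt0 d p (a : p.-tuple nat) (b : (d - p).-tuple nat) n : (p <= d)%N ->
  (forall i, (0 < tnth a i)%N) -> (forall i, (0 < tnth b i)%N) -> (0 < n)%N ->
  forall i, (0 < Lambda0 a b n i)%N.
Proof.
move=> pd a0 b0 n0 i; rewrite /Lambda0.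
have : all (leq 1) (a ++ [seq (x * n)%N | x <- b]).
  rewrite all_cat all_map; apply/andP; split; apply/allP => x /tnthP[k ->] //=.
  by rewrite muln_gt0 b0 n0.
move=> /all_nthP; apply.
by rewrite size_cat size_map !size_tuple subnKC.
Qed.

Lemma prod_Lambda0 d p (a : p.-tuple nat) (b : (d - p).-tuple nat) n (F : nat -> R) : (p <= d)%N ->
  \prod_(i < d) F (Lambda0 a b n i) =
  (\prod_(i < p) F (tnth a i)) * \prod_(i < d - p) F (tnth b i * n)%N.
Proof.
move=> pd; set s := a ++ [seq (x * n)%N | x <- b].
have ss : size s = d by rewrite size_cat size_map !size_tuple subnKC.
transitivity (\prod_(x <- s) F x).
  by rewrite (big_nth 0%N) ss big_mkord.
by rewrite big_cat big_map !big_tuple.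
Qed.

End log_determinant.

(** * Real analytic functions *)

Section real_analytic.
Variable R : realType.
Implicit Types (f g : R -> R) (x : R).

(** Analyticity as a geometric bound on all Taylor remainders: sums and products then need only
    finite algebra, N = 0 says that f is bounded near x, and for |h| < d the bound forces
    convergence to f. *)
Definition real_analytic_at f x := exists c : nat -> R, exists d C : R,
  [/\ 0 < d, 0 <= C & forall N h, `|h| <= d ->
    `|f (x + h) - \sum_(n < N) c n * h ^+ n| <= C * (`|h| / d) ^+ N].

Lemma real_analytic_cst k x : real_analytic_at (fun=> k) x.
Proof.
exists (fun n => if n is 0%N then k else 0), 1, `|k|; split => // N h _.
rewrite divr1; case: N => [|N]; first by rewrite big_ord0 subr0 expr0 mulr1.
rewrite big_ord_recl/= expr0 mulr1 big1 ?addr0 ?subrr ?normr0.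
  by rewrite mulr_ge0// exprn_ge0.
by move=> i _; rewrite mul0r.
Qed.

Lemma real_analytic_id x : real_analytic_at id x.
Proof.
exists (fun n => if n is 0%N then x else (n == 1%N)%:R), 1, (`|x| + 1).
split => [//||N h h1]; first by rewrite addr_ge0.
rewrite divr1; case: N => [|[|N]].
- rewrite big_ord0 subr0 expr0 mulr1 (le_trans (ler_normD _ _))//.
  by rewrite lerD2l.
- rewrite big_ord1 expr0 mulr1 addrAC subrr add0r expr1.
  by rewrite ler_peMl// lerDr.
- rewrite !big_ord_recl/= expr0 mulr1 expr1 mul1r big1 ?addr0 ?subrr ?normr0.
    by rewrite mulr_ge0 ?addr_ge0 ?exprn_ge0.
  by move=> i _; rewrite mul0r.
Qed.

(** Shrinking the radius keeps the coefficients and the constant, which lets two functions share a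
    radius. *)
Lemma real_analyticW f x (d : R) : real_analytic_at f x -> 0 < d ->
  exists c : nat -> R, exists d' C : R,
  [/\ 0 < d' <= d, 0 <= C & forall d'' N h, 0 < d'' <= d' -> `|h| <= d'' ->
    `|f (x + h) - \sum_(n < N) c n * h ^+ n| <= C * (`|h| / d'') ^+ N].
Proof.
move=> [c [e [C [e0 C0 fc]]]] d0.
exists c, (Num.min d e), C; split => //.
  by rewrite lt_min d0 e0 ge_min lexx.
move=> d'' N h /andP[d''0]; rewrite le_min => /andP[dd de] hd.
apply: (le_trans (fc _ _ (le_trans hd de))).
rewrite ler_wpM2l// lerXn2r ?nnegrE ?divr_ge0//; [exact: ltW|exact: ltW|].
by rewrite ler_wpM2l// lef_pV2.
Qed.

Lemma real_analyticD f g x : real_analytic_at f x -> real_analytic_at g x ->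
  real_analytic_at (fun x => f x + g x) x.
Proof.
move=> [c [d1 [C1 [d10 C10 fc]]]] ag.
have [e [d [C2 [/andP[d0 dd1] C20 ge]]]] := real_analyticW ag d10.
exists (fun n => c n + e n), d, (C1 + C2); split => //; first exact: addr_ge0.
move=> N h hd.
under eq_bigr do rewrite mulrDl.
rewrite big_split/= opprD addrACA (le_trans (ler_normD _ _))//.
rewrite mulrDl lerD//; last by apply: ge; rewrite ?d0 ?lexx.
apply: (le_trans (fc _ _ (le_trans hd dd1))).
rewrite ler_wpM2l// lerXn2r ?nnegrE ?divr_ge0//; [exact: ltW|exact: ltW|].
by rewrite ler_wpM2l// lef_pV2.
Qed.

(** Cauchy product. By [key] its N-th remainder is F_N g plus the sum of the c_j h^j G_(N - j). The
    bound on c_n comes from two consecutive remainders at h = d. In all there are 2 N + 1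
    contributions of size r^N, absorbed by halving the radius since N + 1 <= 2^N. *)
Lemma real_analyticM f g x : real_analytic_at f x -> real_analytic_at g x ->
  real_analytic_at (fun x => f x * g x) x.
Proof.
move=> af ag; have [c [d1 [C1 [/andP[d10 _] C10 fc]]]] := real_analyticW af ltr01.
have [e [d [C2 [/andP[d0 dd1] C20 ge]]]] := real_analyticW ag d10.
pose F N h := f (x + h) - \sum_(n < N) c n * h ^+ n.
pose G N h := g (x + h) - \sum_(n < N) e n * h ^+ n.
have FC N h : `|h| <= d -> `|F N h| <= C1 * (`|h| / d) ^+ N.
  by apply: fc; rewrite d0.
have GC N h : `|h| <= d -> `|G N h| <= C2 * (`|h| / d) ^+ N.
  by apply: ge; rewrite d0 lexx.
have cC n : `|c n| <= 2 * C1 / d ^+ n.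
  have nd : `|d| <= d by rewrite gtr0_norm.
  have := FC n d nd; have := FC n.+1 d nd.
  rewrite (gtr0_norm d0) divff ?gt_eqF// !expr1n !mulr1.
  rewrite {1}/F big_ord_recr/= opprD addrA -/(F n d) => h1 h2.
  rewrite ler_pdivlMr ?exprn_gt0// -{1}(gtr0_norm d0) -normrX -normrM.
  have -> : c n * d ^+ n = F n d - (F n d - c n * d ^+ n) by ring.
  by rewrite (le_trans (ler_normB _ _))//; lra.
have key N h : f (x + h) * g (x + h) -
    \sum_(n < N) (\sum_(i < n.+1) c i * e (n - i)%N) * h ^+ n =
    F N h * g (x + h) + \sum_(j < N) c j * h ^+ j * G (N - j)%N h.
  elim: N => [|N ih]; first by rewrite /F !big_ord0 subr0 addr0 subr0.
  rewrite big_ord_recr/= opprD addrA ih.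
  have -> : F N.+1 h = F N h - c N * h ^+ N.
    by rewrite /F big_ord_recr/= opprD addrA.
  rewrite [X in _ = _ + X]big_ord_recr/= subSnn.
  have -> : G 1%N h = g (x + h) - e 0%N by rewrite /G big_ord1 expr0 mulr1.
  have -> : \sum_(j < N) c j * h ^+ j * G (N.+1 - j)%N h =
     \sum_(j < N) c j * h ^+ j * G (N - j)%N h -
     (\sum_(j < N) c j * e (N - j)%N) * h ^+ N.
    rewrite mulr_suml -sumrB; apply: eq_bigr => j _.
    rewrite subSn 1?ltnW// /G big_ord_recr/= -[in h ^+ N](subnK (ltnW (ltn_ord j))) exprD.
    ring.
  rewrite [\sum_(i < N.+1) c i * e (N - i)%N]big_ord_recr/= subnn. ring.
exists (fun n => \sum_(i < n.+1) c i * e (n - i)%N), (d / 2), (2 * (C1 * C2)).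
split => [||N h hd]; first exact: divr_gt0.
  by rewrite !mulr_ge0.
have hd' : `|h| <= d by apply: (le_trans hd); lra.
rewrite key (le_trans (ler_normD _ _))//.
set r := `|h| / d; have r0 : 0 <= r by rewrite divr_ge0// ltW.
have g2 : `|g (x + h)| <= C2.
  by have := GC 0%N h hd'; rewrite /G big_ord0 subr0 expr0 mulr1.
have s1 : `|F N h * g (x + h)| <= C1 * C2 * r ^+ N.
  by rewrite normrM mulrAC ler_pM// FC.
have s2 : `|\sum_(j < N) c j * h ^+ j * G (N - j)%N h| <= \sum_(j < N) 2 * (C1 * C2) * r ^+ N.
  apply: (le_trans (ler_norm_sum _ _ _)); apply: ler_sum => j _.
  rewrite !normrM normrX.
  have -> : 2 * (C1 * C2) * r ^+ N = (2 * C1 / d ^+ j * `|h| ^+ j) * (C2 * r ^+ (N - j)).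
    have -> : r ^+ N = r ^+ j * r ^+ (N - j) by rewrite -exprD subnKC// ltnW.
    by rewrite [r ^+ j]expr_div_n; ring.
  by rewrite ler_pM ?mulr_ge0// ?ler_wpM2r// GC.
apply: (le_trans (lerD s1 s2)).
rewrite sumr_const card_ord.
have -> : `|h| / (d / 2) = 2 * r by rewrite /r; field; rewrite gt_eqF.
rewrite (exprMn N 2 r).
have -> : C1 * C2 * r ^+ N + (2 * (C1 * C2) * r ^+ N) *+ N =
   (C1 * C2 * r ^+ N) * (1 + 2 * N%:R) by rewrite -mulr_natr; ring.
have -> : 2 * (C1 * C2) * (2 ^+ N * r ^+ N) = (C1 * C2 * r ^+ N) * (2 * 2 ^+ N) by ring.
rewrite ler_wpM2l ?mulr_ge0 ?exprn_ge0//.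
have : (N.+1 <= 2 ^ N)%N by rewrite ltn_expl.
by rewrite -(ler_nat R) natrX -[N.+1]addn1 natrD; lra.
Qed.

Lemma real_analyticN f x : real_analytic_at f x ->
  real_analytic_at (fun x => - f x) x.
Proof.
move=> /(real_analyticM (real_analytic_cst (-1) x)).
by under eq_fun do rewrite mulN1r.
Qed.

Lemma real_analyticB f g x : real_analytic_at f x -> real_analytic_at g x ->
  real_analytic_at (fun x => f x - g x) x.
Proof. by move=> af ag; apply: real_analyticD => //; exact: real_analyticN. Qed.

(** Convergence at h = d makes a_n d^n bounded; for |h| <= d / 2 the tail is then dominated by a
    geometric series of ratio at most 1 / 2. *)
Lemma real_analytic_series f x (a : nat -> R) (d : R) : 0 < d ->
  (forall h, `|h| <= d ->
     series (fun n => a n * h ^+ n) @ \oo --> f (x + h)) ->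
  real_analytic_at f x.
Proof.
move=> d0 af.
have [C C0 aC] : exists2 C, 0 <= C & forall n, `|a n * d ^+ n| <= C.
  have : cvg (series (fun n => a n * d ^+ n) @ \oo).
    by apply/cvg_ex; exists (f (x + d)); apply: af; rewrite gtr0_norm.
  move=> /cvg_series_cvg_0 h0.
  have /cvg_seq_bounded : cvg ((fun n => a n * d ^+ n) @ \oo) by apply/cvg_ex; exists 0.
  move=> [C [_ /(_ (C + 1))]]; rewrite ltrDl ltr01 => /(_ isT) hC.
  exists (C + 1); last by move=> n; exact: hC.
  by apply: (le_trans (normr_ge0 (a 0%N * d ^+ 0))); exact: hC.
exists a, (d / 2), (2 * C); split; [exact: divr_gt0|by rewrite mulr_ge0|].
move=> N h hd.
have hd' : `|h| <= d by apply: (le_trans hd); lra.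
pose r := `|h| / d.
have r0 : 0 <= r by rewrite divr_ge0// ltW.
have r2 : r <= 2^-1 by rewrite ler_pdivrMr//; lra.
have step k : `|\sum_(N <= n < N + k) a n * h ^+ n| <= 2 * C * (`|h| / (d / 2)) ^+ N.
  have -> : `|h| / (d / 2) = 2 * r by rewrite /r; field; rewrite gt_eqF.
  apply: (@le_trans _ _ (\sum_(N <= n < N + k) C * r ^+ n)).
    apply: (le_trans (ler_norm_sum _ _ _)); apply: ler_sum => n _.
    have -> : a n * h ^+ n = (a n * d ^+ n) * (h / d) ^+ n.
      by rewrite expr_div_n; field; rewrite expf_neq0 ?gt_eqF.
    rewrite normrM normrX normf_div (gtr0_norm d0).
    by rewrite ler_wpM2r// exprn_ge0.
  rewrite -mulr_sumr -{1}[N]add0n big_addn addKn.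
  have -> : \sum_(0 <= i < k) r ^+ (i + N) = r ^+ N * \sum_(i < k) r ^+ i.
    by rewrite mulr_sumr big_mkord; apply: eq_bigr => i _; rewrite exprD mulrC.
  have S2 : \sum_(i < k) r ^+ i <= 2.
    have : (1 - r) * \sum_(i < k) r ^+ i <= 1.
      by rewrite -opprB mulNr -subrX1 opprB gerBl exprn_ge0.
    have S0 : 0 <= \sum_(i < k) r ^+ i by apply: sumr_ge0 => i _; exact: exprn_ge0.
    nra.
  have rN : r ^+ N <= (2 * r) ^+ N.
    apply: lerXn2r; rewrite ?nnegrE; [exact: r0|exact: mulr_ge0|].
    by rewrite mulr_natl mulr2n lerDl.
  rewrite [2 * C]mulrC -mulrA ler_wpM2l//.
  by rewrite (le_trans (ler_wpM2l (exprn_ge0 N r0) S2))// mulrC ler_wpM2l.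
have := af h hd'; rewrite -(cvg_shiftn N) => cv.
have {}cv : (fun k => series (fun n => a n * h ^+ n) (k + N)%N - \sum_(n < N) a n * h ^+ n) @ \oo
    --> f (x + h) - \sum_(n < N) a n * h ^+ n.
  by apply: cvgB => //; exact: cvg_cst.
have nv : (fun k => `|series (fun n => a n * h ^+ n) (k + N)%N - \sum_(n < N) a n * h ^+ n|) @ \oo
    --> `|f (x + h) - \sum_(n < N) a n * h ^+ n| by exact: cvg_norm.
rewrite -(cvg_lim _ nv)//; apply: limr_le; first by apply/cvg_ex; eexists; exact: nv.
apply: nearW => k /=.
rewrite /series/= -(big_mkord xpredT (fun n => a n * h ^+ n)).
rewrite (@big_cat_nat _ _ _ N)//= ?leq_addl// addrAC subrr add0r addnC.
exact: step.
Qed.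

(** Zeros on the right of x suffice: if c_n is the first nonzero coefficient, the remainder bound
    gives |c_n| h^n <= C (h / d)^(n + 1) for small h > 0, which fails as h tends to 0. *)
Lemma real_analytic_eq0 f x e : real_analytic_at f x -> 0 < e ->
  (forall h, 0 < h < e -> f (x + h) = 0) ->
  exists2 d, 0 < d & forall h, `|h| < d -> f (x + h) = 0.
Proof.
move=> [c [d [C [d0 C0 fc]]]] e0 f0.
have c0 n : c n = 0.
  have [m] := ubnP n; elim: m n => // m ih n nm.
  apply/eqP; apply: contraT => cn0.
  have cn : 0 < `|c n| by rewrite normr_gt0.
  (* The third bound makes C h smaller than |c_n| d^(n + 1), against the remainder bound; C + 1
     keeps the denominator positive when C = 0. *)
  pose h := Num.min (Num.min (e / 2) d) (`|c n| * d ^+ n.+1 / (2 * (C + 1))).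
  have h0 : 0 < h.
    rewrite !lt_min divr_gt0//= d0/= divr_gt0 ?mulr_gt0 ?exprn_gt0//.
    by rewrite ltr_wpDl.
  have he : h < e by rewrite !gt_min; apply/orP; left; apply/orP; left; lra.
  have hd : h <= d by rewrite !ge_min lexx orbT.
  have hc : h <= `|c n| * d ^+ n.+1 / (2 * (C + 1)) by rewrite ge_min lexx orbT.
  have := fc n.+1 h; rewrite gtr0_norm// => /(_ hd).
  rewrite f0 ?h0// big_ord_recr/= big1; last first.
    by move=> i _; rewrite ih ?mul0r// (leq_trans (ltn_ord i)).
  rewrite !add0r normrN normrM normrX (gtr0_norm h0) expr_div_n exprSr.
  rewrite [d ^+ n.+1 in X in X -> _]exprSr.
  rewrite ler_pdivlMr in hc; last by rewrite mulr_gt0// ltr_wpDl.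
  rewrite mulrA ler_pdivlMr ?mulr_gt0 ?exprn_gt0// => hh.
  have hn0 : 0 < h ^+ n by rewrite exprn_gt0.
  have : `|c n| * d ^+ n.+1 <= C * h.
    rewrite -(ler_pM2r hn0); apply: le_trans (_ : _ <= C * (h ^+ n * h)) _; last by rewrite le_eqVlt; apply/orP; left; apply/eqP; ring.
    by rewrite (le_trans _ hh)// le_eqVlt; apply/orP; left; apply/eqP; rewrite exprS; ring.
  nra.
exists d => // h hd; apply/eqP; rewrite -normr_le0.
apply/ler_addgt0Pl => eps eps0; rewrite addr0.
have r1 : `|h| / d < 1 by rewrite ltr_pdivrMr// mul1r.
have : (fun N => C * (`|h| / d) ^+ N) @ \oo --> (C * 0).
  by apply: cvgMr; apply: cvg_expr; rewrite ger0_norm// divr_ge0// ltW.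
rewrite mulr0 => /cvgrPdist_le/(_ _ eps0)[N _ /(_ _ (leqnn N))].
rewrite sub0r normrN => /ler_normlW; apply: le_trans.
have := fc N h (ltW hd); rewrite big1 ?subr0//.
by move=> i _; rewrite c0 mul0r.
Qed.

Lemma real_analytic_identity f (a b c : R) : a < b -> b < c ->
  (forall x, a < x < c -> real_analytic_at f x) ->
  (forall x, b < x < c -> f x = 0) ->
  forall x, a < x < c -> f x = 0.
Proof.
move=> ab bc af f0 x /andP[ax xc].
pose S := [set y | a < y < c /\ forall z, y < z < c -> f z = 0].
have Sb : S b by split => //; rewrite ab bc.
have Slb : lbound S a by move=> y [/andP[/ltW]].
have hS : has_inf S by split; [exists b|exists a].
pose m := inf S.
have am : a <= m by apply: lb_le_inf => //; exists b.
have mb : m <= b by apply: ge_inf => //; exists a.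
have mz z : m < z < c -> f z = 0.
  move=> /andP[mz zc]; have [y [yS1 yS2] yz] := inf_lt hS.1 mz.
  by apply: yS2; rewrite yz.
have [xm|mx] := leP x m; last by apply: mz; rewrite mx.
have {}am : a < m by apply: lt_le_trans xm.
have mc : m < c by apply: le_lt_trans mb bc.
have [|||d d0 fd] := @real_analytic_eq0 f m (c - m).
- by apply: af; rewrite am.
- by rewrite subr_gt0.
- by move=> h /andP[h0 hc]; apply: mz; lra.
pose y := Num.max (m - d / 2) ((a + m) / 2).
have ym : y < m by rewrite gt_max; apply/andP; split; lra.
have : S y.
  split.
    by rewrite lt_max; apply/andP; split; [apply/orP; right|]; lra.
  move=> z /andP[yz zc]; have [zm|] := ltP z (m + d); last first.
    by move=> mz'; apply: mz; rewrite zc andbT; lra.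
  rewrite -(subrKC m z); apply: fd.
  rewrite ltr_norml; apply/andP; split; last by lra.
  have : m - d / 2 <= y by rewrite le_max lexx.
  lra.
by move=> Sy; have := ge_inf (ex_intro _ a Slb) Sy; rewrite leNgt ym.
Qed.

End real_analytic.

(** * Complex analytic functions *)

Section complex_analysis.
Variable R : realType.
Notation C := (R[i]^o).
Local Notation Re := complex.Re.
Local Notation Im := complex.Im.

Lemma cReM (z w : R[i]) : Re (z * w) = Re z * Re w - Im z * Im w.
Proof. by case: z w => [a b] [c d]. Qed.

Lemma cImM (z w : R[i]) : Im (z * w) = Re z * Im w + Im z * Re w.
Proof. by case: z w => [a b] [c d]. Qed.

Lemma cReD (z w : R[i]) : Re (z + w) = Re z + Re w.
Proof. by case: z w => [a b] [c d]. Qed.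

Lemma cImD (z w : R[i]) : Im (z + w) = Im z + Im w.
Proof. by case: z w => [a b] [c d]. Qed.

Lemma cReN (z : R[i]) : Re (- z) = - Re z.
Proof. by case: z. Qed.

Lemma cImN (z : R[i]) : Im (- z) = - Im z.
Proof. by case: z. Qed.

Lemma cReB (z w : R[i]) : Re (z - w) = Re z - Re w.
Proof. by rewrite cReD cReN. Qed.

Lemma cImB (z w : R[i]) : Im (z - w) = Im z - Im w.
Proof. by rewrite cImD cImN. Qed.

Lemma complexP (z w : R[i]) : Re z = Re w -> Im z = Im w -> z = w.
Proof. by case: z w => [a b] [c d] /= -> ->. Qed.

Lemma cRe_sum (I : Type) (r : seq I) (P : pred I) (F : I -> R[i]) :
  Re (\sum_(i <- r | P i) F i) = \sum_(i <- r | P i) Re (F i).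
Proof. by elim/big_rec2 : _ => // i x y _ <-; exact: cReD. Qed.

Lemma cIm_sum (I : Type) (r : seq I) (P : pred I) (F : I -> R[i]) :
  Im (\sum_(i <- r | P i) F i) = \sum_(i <- r | P i) Im (F i).
Proof. by elim/big_rec2 : _ => // i x y _ <-; exact: cImD. Qed.

(** The modulus as a real number: the norm of [R[i]] takes its values in [R[i]]. *)
Definition cnorm (z : R[i]) : R := Re `|z|.

Lemma cnormE (z : R[i]) : `|z| = (cnorm z)%:C.
Proof. by rewrite /cnorm normc_def. Qed.

Lemma cnorm_def (z : R[i]) : cnorm z = Num.sqrt (Re z ^+ 2 + Im z ^+ 2).
Proof. by rewrite /cnorm normc_def. Qed.

Lemma cnorm_ge0 z : 0 <= cnorm z.
Proof. by rewrite cnorm_def sqrtr_ge0. Qed.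

Lemma cnormD z w : cnorm (z + w) <= cnorm z + cnorm w.
Proof. by rewrite -lecR rmorphD/= -!cnormE ler_normD. Qed.

Lemma cnormM z w : cnorm (z * w) = cnorm z * cnorm w.
Proof. by apply: complexI; rewrite rmorphM/= -!cnormE normrM. Qed.

Lemma cnormX z n : cnorm (z ^+ n) = cnorm z ^+ n.
Proof. by apply: complexI; rewrite rmorphXn/= -!cnormE normrX. Qed.

Lemma cnorm_sum (I : Type) (r : seq I) (P : pred I) (F : I -> R[i]) :
  cnorm (\sum_(i <- r | P i) F i) <= \sum_(i <- r | P i) cnorm (F i).
Proof.
elim/big_rec2 : _ => [|i x y _ h]; first by rewrite cnorm_def expr0n/= addr0 sqrtr0.
by apply: (le_trans (cnormD _ _)); rewrite lerD2l.
Qed.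

Lemma cnorm_real (x : R) : cnorm x%:C = `|x|.
Proof. by rewrite cnorm_def/= expr0n/= addr0 sqrtr_sqr. Qed.

Lemma Re_le_cnorm z : `|Re z| <= cnorm z.
Proof. by rewrite cnorm_def -sqrtr_sqr ler_wsqrtr// lerDl sqr_ge0. Qed.

Lemma Im_le_cnorm z : `|Im z| <= cnorm z.
Proof. by rewrite cnorm_def -sqrtr_sqr ler_wsqrtr// lerDr sqr_ge0. Qed.

Lemma cnorm_le z : cnorm z <= `|Re z| + `|Im z|.
Proof.
rewrite cnorm_def -(ger0_norm (addr_ge0 (normr_ge0 (Re z)) (normr_ge0 (Im z)))) -sqrtr_sqr.
rewrite ler_wsqrtr// sqrrD !real_normK ?num_real// addrAC lerDl.
by rewrite mulrn_wge0// mulr_ge0.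
Qed.

Lemma posC (e : R[i]) : 0 < e -> e = (Re e)%:C /\ 0 < Re e.
Proof. by case: e => a b; rewrite ltcE/= => /andP[/eqP -> ->]. Qed.

Lemma cvg_complexP (T : Type) (F : set_system T) (FF : Filter F) (f : T -> C) (l : C) :
  f @ F --> l <-> (fun t => Re (f t)) @ F --> Re l /\ (fun t => Im (f t)) @ F --> Im l.
Proof.
split=> [/cvgrPdist_le fl|[/cvgrPdist_le f1 /cvgrPdist_le f2]].
  have fl' (e : R) : 0 < e -> \forall t \near F, cnorm (l - f t) <= e.
    move=> e0; have e0' : 0 < e%:C by rewrite ltcR.
    by apply: filterS (fl _ e0') => t; rewrite cnormE lecR.
  split; apply/cvgrPdist_le => /= e e0; apply: filterS (fl' _ e0) => t; apply: le_trans.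
    by rewrite -cReB Re_le_cnorm.
  by rewrite -cImB Im_le_cnorm.
apply/cvgrPdist_le => /= e /posC[-> e0].
have e2 : 0 < Re e / 2 by rewrite divr_gt0.
apply: filterS2 (f1 _ e2) (f2 _ e2) => t h1 h2.
rewrite cnormE lecR; apply: (le_trans (cnorm_le _)).
by rewrite cReB cImB; lra.
Qed.

Lemma cvg_cnorm (T : Type) (F : set_system T) (FF : Filter F) (f : T -> C) (l : C) :
  f @ F --> l -> (fun t => cnorm (f t)) @ F --> cnorm l.
Proof. by move=> /cvg_norm/cvg_complexP[]. Qed.

Lemma analytic_at_ball (Z : C -> C) (z : C) : analytic_at Z z ->
  exists c : nat -> C, exists2 d : R, 0 < d & forall h : C, cnorm h <= d ->
    series (fun n => c n * h ^+ n) @ \oo --> Z (z + h).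
Proof.
move=> [c /nbhs_normP[e /= e0 hc]]; exists c.
have [eE e0'] := posC e0.
exists (Re e / 2) => [|h hd]; first by rewrite divr_gt0.
have := hc (z + h); rewrite /= opprD addrA subrr sub0r normrN cnormE eE ltcR.
rewrite (addrC z h) addrK addrC; apply.
by apply: le_lt_trans hd _; lra.
Qed.

Lemma analytic_at_coef_bound (c : nat -> C) (d : R) (l : C) :
  series (fun n => c n * d%:C ^+ n) @ \oo --> l -> 0 <= d ->
  exists2 B : R, 0 <= B & forall n, cnorm (c n) * d ^+ n <= B.
Proof.
move=> cd d0.
have h0 : (fun n => cnorm (c n * d%:C ^+ n)) @ \oo --> 0.
  have : cvg (series (fun n => c n * d%:C ^+ n) @ \oo) by apply/cvg_ex; exists l.
  move=> /cvg_series_cvg_0/cvg_cnorm.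
  by rewrite cnorm_real normr0.
have /cvg_seq_bounded : cvg ((fun n => cnorm (c n * d%:C ^+ n)) @ \oo) by apply/cvg_ex; exists 0.
move=> [B [_ /(_ (B + 1))]]; rewrite ltrDl ltr01 => /(_ isT) hB.
exists (B + 1) => [|n].
  by apply: (@le_trans _ _ `|cnorm (c 0%N * d%:C ^+ 0)|); [exact: normr_ge0|exact: (hB 0%N)].
have /= := hB n I; rewrite cnormM cnormX cnorm_real (ger0_norm d0) ger0_norm//.
by rewrite mulr_ge0 ?cnorm_ge0// exprn_ge0.
Qed.

(** The numbers |c_n| d^n are bounded, so for |h| <= d / 2 the terms of order at least 2 form a
    geometric tail. *)
Lemma analytic_at_taylor2 (Z : C -> C) (z : C) : analytic_at Z z ->
  exists c1 : C, exists d B : R, [/\ 0 < d, 0 <= B & forall h : C, cnorm h <= d ->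
    cnorm (Z (z + h) - Z z - c1 * h) <= B * cnorm h ^+ 2].
Proof.
move=> /analytic_at_ball[c [d d0 hc]].
have c0 : Z z = c 0%N.
  have n0 : cnorm 0 <= d by rewrite cnorm_real normr0 ltW.
  have := hc 0 n0; rewrite addr0 => h1.
  have h2 : series (fun n => c n * 0 ^+ n) @ \oo --> c 0%N.
    rewrite -(cvg_shiftn 1) (_ : (fun _ => _) = fun=> c 0%N); first exact: cvg_cst.
    apply/funext => n; rewrite /series/= addn1 big_ltn// expr0 mulr1 big_nat big1 ?addr0// => i /andP[i1 _].
    by rewrite expr0n gtn_eqF// mulr0.
  exact: (cvg_unique (@norm_hausdorff _ C) h1 h2).
have cd : cnorm d%:C <= d by rewrite cnorm_real gtr0_norm.
have [B B0 hB] := analytic_at_coef_bound (hc _ cd) (ltW d0).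
exists (c 1%N), (d / 2), (2 * B / d ^+ 2); split; first by rewrite divr_gt0.
  by apply: divr_ge0; [exact: mulr_ge0|apply: exprn_ge0; exact: ltW].
move=> h hd; set r := cnorm h / d.
have r0 : 0 <= r by rewrite divr_ge0 ?cnorm_ge0// ltW.
have r2 : r <= 2^-1 by rewrite ler_pdivrMr//; lra.
have hd' : cnorm h <= d by lra.
have := hc h hd'; rewrite -(cvg_shiftn 2) => cv.
have {}cv : (fun n => series (fun n => c n * h ^+ n) (n + 2)%N - Z z - c 1%N * h) @ \oo -->
    (Z (z + h) - Z z - c 1%N * h : C).
  by apply: cvgB; [apply: cvgB|]; [exact: cv|exact: cvg_cst|exact: cvg_cst].
move/cvg_cnorm : cv => cv.
rewrite -(cvg_lim _ cv)//; apply: limr_le; first by apply/cvg_ex; eexists; exact: cv.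
apply: nearW => n.
rewrite /series/= addn2 big_ltn// big_ltn// expr0 expr1 mulr1 c0.
rewrite [X in cnorm X](_ : _ = \sum_(2 <= i < n.+2) c i * h ^+ i); last by ring.
apply: (le_trans (cnorm_sum _ _ _)).
apply: (@le_trans _ _ (\sum_(2 <= i < n.+2) B * r ^+ i)).
  apply: ler_sum => i _; rewrite cnormM cnormX.
  have -> : cnorm (c i) * cnorm h ^+ i = (cnorm (c i) * d ^+ i) * r ^+ i.
    by rewrite /r expr_div_n; field; rewrite expf_neq0 ?gt_eqF.
  by rewrite ler_wpM2r ?exprn_ge0.
rewrite -mulr_sumr -{1}[2%N]add0n big_addn -addn2 addnK.
have -> : \sum_(0 <= i < n) r ^+ (i + 2) = r ^+ 2 * \sum_(i < n) r ^+ i.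
  by rewrite mulr_sumr big_mkord; apply: eq_bigr => i _; rewrite exprD mulrC.
have S2 : \sum_(i < n) r ^+ i <= 2.
  have : (1 - r) * \sum_(i < n) r ^+ i <= 1.
    by rewrite -opprB mulNr -subrX1 opprB gerBl exprn_ge0.
  have S0 : 0 <= \sum_(i < n) r ^+ i by apply: sumr_ge0 => i _; exact: exprn_ge0.
  nra.
have -> : 2 * B / d ^+ 2 * cnorm h ^+ 2 = B * (r ^+ 2 * 2).
  by rewrite /r expr_div_n; field; rewrite gt_eqF.
by apply: ler_wpM2l => //; apply: ler_wpM2l => //; exact: exprn_ge0.
Qed.

(** [derive1] is a [lim], whose value is meaningful only once the difference quotient is known to
    converge; the second order estimate shows that it does. *)
Lemma analytic_at_derive1 (Z : C -> C) (z : C) : analytic_at Z z ->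
  (fun h : C => h^-1 *: (Z (h + z) - Z z) : C) @ 0^' --> derive1 Z z.
Proof.
move=> /analytic_at_taylor2[c [d [B [d0 B0 hB]]]].
have cv : (fun h : C => h^-1 *: (Z (h + z) - Z z) : C) @ 0^' --> c.
  apply/cvgrPdist_le => /= e /posC[eE e0].
  have m0 : 0 < (Num.min d (Re e / (B + 1)))%:C :> R[i].
    by rewrite ltcR lt_min d0/= divr_gt0// ltr_wpDl.
  near=> h.
  have h0 : h != 0 by near: h; exact: nbhs_dnbhs_neq.
  have n0 : 0 < cnorm h by rewrite lt_neqAle cnorm_ge0 eq_sym andbT -(inj_eq (@complexI R)) -cnormE normr_eq0.
  have hd : cnorm h <= d /\ cnorm h * (B + 1) <= Re e.
    have : `|h| <= (Num.min d (Re e / (B + 1)))%:C.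
      near: h; apply: nbhs_dnbhs.
      by apply: filterS (nbhs0_le m0).
    by rewrite cnormE lecR le_min ler_pdivlMr ?ltr_wpDl// => /andP[].
  have := hB h hd.1; rewrite (addrC z) => hh.
  rewrite eE cnormE lecR.
  have -> : c - h^-1 *: (Z (h + z) - Z z) = - (h^-1 * (Z (h + z) - Z z - c * h)).
    by rewrite /GRing.scale/=; field.
  have -> (w : R[i]) : cnorm (- w) = cnorm w by rewrite /cnorm normrN.
  rewrite cnormM.
  have -> : cnorm h^-1 = (cnorm h)^-1.
    have n0' : cnorm h != 0 by rewrite gt_eqF.
    by apply: (mulIf n0'); rewrite -cnormM mulVf// mulVf// cnorm_real normr1.
  rewrite ler_pdivrMl//; apply: (le_trans hh).
  have := hd.2; nra.
by rewrite /derive1 (cvg_lim _ cv).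
Unshelve. all: by end_near. Qed.

(** For a real increment the powers h^n are real, so the real and imaginary parts are power series
    with coefficients Re c_n and Im c_n. *)
Lemma analytic_at_horizontal (Z : C -> C) (x y : R) : analytic_at Z (x +i* y) ->
  real_analytic_at (fun x => Re (Z (x +i* y))) x /\
  real_analytic_at (fun x => Im (Z (x +i* y))) x.
Proof.
move=> /analytic_at_ball[c [d d0 hc]].
have key (h : R) : `|h| <= d ->
    series (fun n => Re (c n) * h ^+ n) @ \oo --> Re (Z ((x + h) +i* y)) /\
    series (fun n => Im (c n) * h ^+ n) @ \oo --> Im (Z ((x + h) +i* y)).
  move=> hd; have hd' : cnorm h%:C <= d by rewrite cnorm_real.
  have := hc _ hd'.
  have -> : (x +i* y : C) + h%:C = (x + h) +i* y by apply: complexP; rewrite /= ?addr0.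
  move=> /cvg_complexP[h1 h2].
  have eR n : Re (series (fun n => c n * h%:C ^+ n) n) = series (fun n => Re (c n) * h ^+ n) n.
    by rewrite /series/= cRe_sum; apply: eq_bigr => i _; rewrite -rmorphXn/= cReM/= mulr0 subr0.
  have eI n : Im (series (fun n => c n * h%:C ^+ n) n) = series (fun n => Im (c n) * h ^+ n) n.
    by rewrite /series/= cIm_sum; apply: eq_bigr => i _; rewrite -rmorphXn/= cImM/= mulr0 add0r.
  by rewrite (funext eR) in h1; rewrite (funext eI) in h2.
split.
  exact: (@real_analytic_series _ _ x (fun n => Re (c n)) d d0 (fun h hd => (key h hd).1)).
exact: (@real_analytic_series _ _ x (fun n => Im (c n)) d d0 (fun h hd => (key h hd).2)).
Qed.

Definition real_analytic_C (F : R -> R[i]) (x : R) :=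
  real_analytic_at (fun x => Re (F x)) x /\ real_analytic_at (fun x => Im (F x)) x.

Lemma real_analytic_CD F G x : real_analytic_C F x -> real_analytic_C G x ->
  real_analytic_C (fun x => F x + G x) x.
Proof.
move=> [f1 f2] [g1 g2]; split.
  by under eq_fun do rewrite cReD; exact: real_analyticD.
by under eq_fun do rewrite cImD; exact: real_analyticD.
Qed.

Lemma real_analytic_CM F G x : real_analytic_C F x -> real_analytic_C G x ->
  real_analytic_C (fun x => F x * G x) x.
Proof.
move=> [f1 f2] [g1 g2]; split.
  by under eq_fun do rewrite cReM; apply: real_analyticB; exact: real_analyticM.
by under eq_fun do rewrite cImM; apply: real_analyticD; exact: real_analyticM.
Qed.

Lemma real_analytic_Ccst k x : real_analytic_C (fun=> k) x.
Proof. by split; exact: real_analytic_cst. Qed.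

Lemma real_analytic_CB F G x : real_analytic_C F x -> real_analytic_C G x ->
  real_analytic_C (fun x => F x - G x) x.
Proof.
move=> [f1 f2] [g1 g2]; split.
  by under eq_fun do rewrite cReB; exact: real_analyticB.
by under eq_fun do rewrite cImB; exact: real_analyticB.
Qed.

End complex_analysis.

(** * Mellin transforms *)

Section mellin.
Variable R : realType.
Notation C := (R[i]^o).
Local Notation Re := complex.Re.
Local Notation Im := complex.Im.
Implicit Types (g : R -> R) (a c x y : R) (s : R[i]).

(* g(v) e^(x v) is integrable for a < x < c. *)
Definition band a c g := measurable_fun setT g /\ exists2 B : R, 0 <= B &
  forall v, `|g v| <= B * expR (- (a * v)) /\ `|g v| <= B * expR (- (c * v)).

Lemma bandD a c g h : band a c g -> band a c h -> band a c (fun v => g v + h v).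
Proof.
move=> [mg [B B0 hB]] [mh [D D0 hD]]; split; first exact: measurable_funD.
exists (B + D) => [|v]; first exact: addr_ge0.
have [b1 b2] := hB v; have [d1 d2] := hD v.
by rewrite !mulrDl; split; apply: (le_trans (ler_normD _ _)); exact: lerD.
Qed.

Lemma band_mul a c g (w : R -> R) : band a c g -> measurable_fun setT w -> (forall v, `|w v| <= 1) ->
  band a c (fun v => g v * w v).
Proof.
move=> [mg [B B0 hB]] mw w1; split; first exact: measurable_funM.
exists B => // v; have [b1 b2] := hB v.
by split; rewrite normrM; [apply: le_trans b1|apply: le_trans b2]; rewrite ler_piMr.
Qed.

Lemma bandZ a c k g : band a c g -> band a c (fun v => k * g v).
Proof.
move=> [mg [B B0 hB]]; split; first by apply: measurable_funM => //; exact: measurable_cst.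
exists (`|k| * B) => [|v]; first exact: mulr_ge0.
by have [b1 b2] := hB v; split; rewrite normrM -mulrA ler_wpM2l.
Qed.

Lemma bandB a c g h : band a c g -> band a c h -> band a c (fun v => g v - h v).
Proof.
move=> bg /(bandZ (-1)) bh; have := bandD bg bh.
by under eq_fun do rewrite mulN1r.
Qed.

Lemma band_sum a c (I : Type) (r : seq I) (F : I -> R -> R) : (forall i, band a c (F i)) ->
  band a c (fun v => \sum_(i <- r) F i v).
Proof.
move=> bF; elim: r => [|i r ih].
  under eq_fun do rewrite big_nil; split; first exact: measurable_cst.
  by exists 0 => // v; rewrite normr0 !mul0r.
by under eq_fun do rewrite big_cons; exact: bandD.
Qed.

Lemma band_le a c a' c' g : a <= a' -> a' <= c' -> c' <= c -> band a c g -> band a' c' g.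
Proof.
move=> aa ac cc [mg [B B0 hB]]; split => //; exists B => // v; have [b1 b2] := hB v.
have [v0|v0] := leP 0 v.
  by split; apply: (le_trans b2); rewrite ler_wpM2l// ler_expR lerN2 ler_wpM2r//; lra.
by split; apply: (le_trans b1); rewrite ler_wpM2l// ler_expR lerN2 ler_wnM2r//; lra.
Qed.

Lemma band_dom a c g x (d : R) : band a c g -> 0 <= d -> a + d <= x -> x <= c - d ->
  exists2 B : R, 0 <= B & forall v, `|g v * expR (x * v)| <= B * expR (- (d * `|v|)).
Proof.
move=> [mg [B B0 hB]] d0 ax xc; exists B => // v; have [b1 b2] := hB v.
rewrite normrM (ger0_norm (expR_ge0 _)).
have [v0|v0] := leP 0 v.
  apply: (le_trans (ler_wpM2r (expR_ge0 _) b2)).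
  rewrite -mulrA -expRD ler_wpM2l// ler_expR ger0_norm//; nra.
apply: (le_trans (ler_wpM2r (expR_ge0 _) b1)).
rewrite -mulrA -expRD ler_wpM2l// ler_expR ltr0_norm//; nra.
Qed.

Lemma continuous_expM x : continuous (fun v : R => expR (x * v)).
Proof.
move=> v; apply: (@continuous_comp _ _ _ (fun v => x * v) expR); last exact: continuous_expR.
by apply: cvgM; [exact: cvg_cst|exact: cvg_id].
Qed.

Lemma measurable_expM x : measurable_fun setT (fun v : R => expR (x * v)).
Proof. by apply: continuous_measurable_fun; exact: continuous_expM. Qed.

Lemma measurable_cosM y : measurable_fun setT (fun v : R => cos (y * v)).
Proof.
apply: continuous_measurable_fun => v.
apply: (@continuous_comp _ _ _ (fun v => y * v) cos); last exact: continuous_cos.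
by apply: cvgM; [exact: cvg_cst|exact: cvg_id].
Qed.

Lemma measurable_sinM y : measurable_fun setT (fun v : R => sin (y * v)).
Proof.
apply: continuous_measurable_fun => v.
apply: (@continuous_comp _ _ _ (fun v => y * v) sin); last exact: continuous_sin.
by apply: cvgM; [exact: cvg_cst|exact: cvg_id].
Qed.

Lemma band_L1 a c g x : band a c g -> a < x < c -> L1 (fun v => g v * expR (x * v)).
Proof.
move=> bg /andP[ax xc]; pose d := Num.min (x - a) (c - x).
have d0 : 0 < d by rewrite lt_min !subr_gt0 ax.
have dl : d <= x - a by rewrite ge_min lexx.
have dr : d <= c - x by rewrite ge_min lexx orbT.
have [||B B0 hB] := band_dom (x := x) bg (ltW d0); [lra|lra|].
apply: (L1_dom (L1Z B (L1_expRNabs d0))) hB.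
by apply: measurable_funM; [exact: bg.1|exact: measurable_expM].
Qed.

Lemma pow_le_expR (y : R) n : 0 <= y -> y ^+ n / n`!%:R <= expR y.
Proof.
move=> y0; case: n => [|n]; first by rewrite expr0 divr1 -expR0 ler_expR.
by apply: le_trans (expR_ge1Dxn n y0); rewrite lerDr.
Qed.

Lemma sum_pow_le_expR (y : R) N : 0 <= y -> \sum_(n < N) y ^+ n / n`!%:R <= expR y.
Proof.
move=> y0; rewrite -(big_mkord xpredT (fun n => y ^+ n / n`!%:R)).
apply: (nondecreasing_cvgn_le (u_ := series (exp_coeff y)) _ _ N).
  apply/nondecreasing_seqP => n; rewrite /series/= big_nat_recr//= lerDl.
  by rewrite divr_ge0// exprn_ge0.
exact: is_cvg_series_exp_coeff.
Qed.

Lemma sum_pow_cvg_expR (y : R) : (fun N => \sum_(n < N) y ^+ n / n`!%:R) @ \oo --> expR y.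
Proof.
have := is_cvg_series_exp_coeff y.
rewrite /expR /series/= => h; have {h} := h.
by under eq_fun do rewrite big_mkord.
Qed.

(** The coefficients are the integrals of g(v) e^(x v) v^n / n!. Since x is at distance at least 2 d
    from both ends of the strip, g(v) e^(x v) is O(e^(- 2 d |v|)), and the partial sums of e^(h v)
    with |h| <= d use up only half of this decay. *)
Lemma band_real_analytic a c g x : band a c g -> a < x < c ->
  real_analytic_at (fun x => intR (fun v => g v * expR (x * v))) x.
Proof.
move=> bg /andP[ax xc]; pose d := Num.min (x - a) (c - x) / 2.
have m0 : 0 < Num.min (x - a) (c - x) by rewrite lt_min !subr_gt0 ax.
have d0 : 0 < d by rewrite divr_gt0.
have dl : Num.min (x - a) (c - x) <= x - a by rewrite ge_min lexx.
have dr : Num.min (x - a) (c - x) <= c - x by rewrite ge_min lexx orbT.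
have d20 : 0 <= 2 * d by rewrite mulr_ge0// ltW.
have [||B B0 hB] := band_dom (x := x) bg d20; [rewrite /d; lra|rewrite /d; lra|].
have mg : measurable_fun setT (fun v => g v * expR (x * v)).
  by apply: measurable_funM; [exact: bg.1|exact: measurable_expM].
have dom (w : R -> R) (K : R) : measurable_fun setT w ->
    (forall v, `|w v| <= K * expR (d * `|v|)) -> 0 <= K ->
    forall v, `|g v * expR (x * v) * w v| <= (B * K) * expR (- (d * `|v|)).
  move=> mw wK K0 v; rewrite normrM; apply: (le_trans (ler_pM _ _ (hB v) (wK v))) => //.
  have -> : - (2 * d * `|v|) = - (d * `|v|) - d * `|v| by ring.
  rewrite expRD le_eqVlt; apply/orP; left; apply/eqP.
  by rewrite [expR (- (d * `|v|))]expRN; field; rewrite gt_eqF// expR_gt0.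
have mpow n : measurable_fun setT (fun v : R => v ^+ n / n`!%:R).
  apply: measurable_funM; last exact: measurable_cst.
  by apply: continuous_measurable_fun; exact: exprn_continuous.
have bpow n (v : R) : `|v ^+ n / n`!%:R| <= d ^- n * expR (d * `|v|).
  rewrite -ler_pdivrMl ?invr_gt0 ?exprn_gt0// invrK normrM normrX normfV.
  rewrite [`|n`!%:R|]ger0_norm// mulrA -exprMn; apply: pow_le_expR.
  by rewrite mulr_ge0// ltW.
have iL n : L1 (fun v => g v * expR (x * v) * (v ^+ n / n`!%:R)).
  apply: (L1_dom (L1Z (B * d ^- n) (L1_expRNabs d0))).
    exact: measurable_funM.
  by apply: dom => //; rewrite invr_ge0 exprn_ge0// ltW.
apply: (@real_analytic_series _ _ _ (fun n => intR (fun v => g v * expR (x * v) * (v ^+ n / n`!%:R))) d d0) => h hd.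
pose f N v := g v * expR (x * v) * \sum_(n < N) (h * v) ^+ n / n`!%:R.
have E N : series (fun n => intR (fun v => g v * expR (x * v) * (v ^+ n / n`!%:R)) * h ^+ n) N =
    intR (f N).
  rewrite /series/= big_mkord /f.
  under [in RHS]eq_fun do rewrite mulr_sumr.
  have i3 (n : 'I_N) : L1 (fun v => g v * expR (x * v) * ((h * v) ^+ n / n`!%:R)).
    have := L1Z (h ^+ n) (iL n); congr L1; apply/funext => v.
    by rewrite exprMn; ring.
  rewrite (intR_sum _ (fun n _ => i3 n)); apply: eq_bigr => n _.
  rewrite mulrC -(intRZ _ (iL n)); congr intR; apply/funext => v.
  by rewrite exprMn; ring.
rewrite (funext E).
have K0 : 0 < d by [].
apply: (intR_dct (g := fun v => (B * 1) * expR (- (d * `|v|)))).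
- exact: (L1Z _ (L1_expRNabs d0)).
- move=> N; apply: measurable_funM => //; apply: continuous_measurable_fun => v.
  rewrite (_ : (fun _ => _) = \sum_(n < N) (fun v => (h * v) ^+ n / n`!%:R)); last first.
    by apply/funext => w; rewrite fct_sumE.
  elim/big_ind : _ => [|p1 p2 c1 c2|n _]; [exact: cvg_cst|exact: cvgD|].
  apply: cvgM; last exact: cvg_cst.
  apply: (@continuous_comp _ _ _ (fun v => h * v) (fun z => z ^+ n)); last exact: exprn_continuous.
  by apply: cvgM; [exact: cvg_cst|exact: cvg_id].
- move=> v; rewrite mulrDl expRD mulrA; apply: cvgMr; exact: sum_pow_cvg_expR.
- move=> N v; rewrite /f; set S := \sum_(_ < _) _.
  have SE : `|S| <= 1 * expR (d * `|v|).
    rewrite mul1r; apply: (@le_trans _ _ (\sum_(n < N) (`|h| * `|v|) ^+ n / n`!%:R)).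
      apply: (le_trans (ler_norm_sum _ _ _)); apply: ler_sum => n _.
      by rewrite normrM normrX normfV normrM [`|n`!%:R|]ger0_norm.
    apply: (le_trans (sum_pow_le_expR _ _)); first exact: mulr_ge0.
    by rewrite ler_expR ler_wpM2r.
  rewrite normrM; apply: (le_trans (ler_pM _ _ (hB v) SE)) => //.
  rewrite !mulr1 mul1r -mulrA -expRD ler_wpM2l// ler_expR; lra.
Qed.

(** In t = e^v this is the integral of g t^(s - 1) dt, given by its real and imaginary parts because
    [intR] integrates real functions. *)
Definition mellin g s : R[i] :=
  intR (fun v => g v * (expR (Re s * v) * cos (Im s * v))) +i*
  intR (fun v => g v * (expR (Re s * v) * sin (Im s * v))).

Lemma mellin_L1 a c g s : band a c g -> a < Re s < c ->
  L1 (fun v => g v * (expR (Re s * v) * cos (Im s * v))) /\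
  L1 (fun v => g v * (expR (Re s * v) * sin (Im s * v))).
Proof.
move=> bg sb; split.
  have := band_L1 (band_mul bg (measurable_cosM (Im s)) (fun v => cos_max (Im s * v))) sb.
  by congr L1; apply/funext => v; ring.
have := band_L1 (band_mul bg (measurable_sinM (Im s)) (fun v => sin_max (Im s * v))) sb.
by congr L1; apply/funext => v; ring.
Qed.

Lemma mellinD a c g h s : band a c g -> band a c h -> a < Re s < c ->
  mellin (fun v => g v + h v) s = mellin g s + mellin h s.
Proof.
move=> bg bh sb; have [g1 g2] := mellin_L1 bg sb; have [h1 h2] := mellin_L1 bh sb.
apply: complexP; rewrite ?cReD ?cImD/=.
  by rewrite -(intRD g1 h1); congr intR; apply/funext => v; ring.
by rewrite -(intRD g2 h2); congr intR; apply/funext => v; ring.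
Qed.

Lemma mellinZ a c k g s : band a c g -> a < Re s < c ->
  mellin (fun v => k * g v) s = k%:C * mellin g s.
Proof.
move=> bg sb; have [g1 g2] := mellin_L1 bg sb.
apply: complexP; rewrite ?cReM ?cImM/= mul0r ?subr0 ?addr0.
  by rewrite -(intRZ k g1); congr intR; apply/funext => v; ring.
by rewrite -(intRZ k g2); congr intR; apply/funext => v; ring.
Qed.

Lemma mellinB a c g h s : band a c g -> band a c h -> a < Re s < c ->
  mellin (fun v => g v - h v) s = mellin g s - mellin h s.
Proof.
move=> bg bh sb; have [g1 g2] := mellin_L1 bg sb; have [h1 h2] := mellin_L1 bh sb.
apply: complexP; rewrite ?cReB ?cImB/=.
  by rewrite -(intRB g1 h1); congr intR; apply/funext => v; ring.
by rewrite -(intRB g2 h2); congr intR; apply/funext => v; ring.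
Qed.

Lemma mellin0 s : mellin (fun=> 0) s = 0.
Proof.
apply: complexP; rewrite /=.
  by under eq_fun do rewrite mul0r; rewrite intR0.
by under eq_fun do rewrite mul0r; rewrite intR0.
Qed.

Lemma mellin_sum a c (I : Type) (r : seq I) (F : I -> R -> R) s :
  (forall i, band a c (F i)) -> a < Re s < c ->
  mellin (fun v => \sum_(i <- r) F i v) s = \sum_(i <- r) mellin (F i) s.
Proof.
move=> bF sb; elim: r => [|i r ih].
  by rewrite big_nil; under eq_fun do rewrite big_nil; rewrite mellin0.
rewrite big_cons -ih; under eq_fun do rewrite big_cons.
by apply: (mellinD (bF i) _ sb); exact: band_sum.
Qed.

Lemma mellin_shift a c g s x : 0 < x -> band a c g -> a < Re s < c ->
  mellin (fun v => g (v + ln x)) s = cpow x (- s) * mellin g s.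
Proof.
move=> x0 bg sb; have [g1 g2] := mellin_L1 bg sb; set h := ln x.
have e1 v : expR (Re s * v) = expR (- (Re s * h)) * expR (Re s * (v + h)).
  by rewrite -expRD; congr expR; ring.
have e2 v : Im s * v = Im s * (v + h) - Im s * h by ring.
apply: complexP; rewrite ?cReM ?cImM /cpow ?cReM ?cImM /= cReN cImN !mulNr cosN sinN.
  have i1 := L1Z (expR (- (Re s * h)) * cos (Im s * h)) (L1_shift h g1).
  have i2 := L1Z (expR (- (Re s * h)) * sin (Im s * h)) (L1_shift h g2).
  transitivity (expR (- (Re s * h)) * cos (Im s * h) * intR (fun v => g v * (expR (Re s * v) * cos (Im s * v))) +
     expR (- (Re s * h)) * sin (Im s * h) * intR (fun v => g v * (expR (Re s * v) * sin (Im s * v)))); last by ring.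
  rewrite -(intR_shift h g1) -(intR_shift h g2).
  rewrite -(intRZ _ (L1_shift h g1)) -(intRZ _ (L1_shift h g2)) -(intRD i1 i2).
  congr intR; apply/funext => v; rewrite e1 e2 cosB; ring.
have i1 := L1Z (expR (- (Re s * h)) * cos (Im s * h)) (L1_shift h g2).
have i2 := L1Z (expR (- (Re s * h)) * sin (Im s * h)) (L1_shift h g1).
transitivity (expR (- (Re s * h)) * cos (Im s * h) * intR (fun v => g v * (expR (Re s * v) * sin (Im s * v))) -
   expR (- (Re s * h)) * sin (Im s * h) * intR (fun v => g v * (expR (Re s * v) * cos (Im s * v)))); last by ring.
rewrite -(intR_shift h g1) -(intR_shift h g2).
rewrite -(intRZ _ (L1_shift h g1)) -(intRZ _ (L1_shift h g2)) -(intRB i1 i2).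
by congr intR; apply/funext => v; rewrite e1 e2 sinB; ring.
Qed.

Lemma cnorm_mellin_le a c g s : band a c g -> a < Re s < c ->
  cnorm (mellin g s) <= 2 * intR (fun v => `|g v| * expR (Re s * v)).
Proof.
move=> bg sb; have [g1 g2] := mellin_L1 bg sb.
have i0 : L1 (fun v => `|g v| * expR (Re s * v)).
  have := L1_norm (band_L1 bg sb); congr L1; apply/funext => v.
  by rewrite normrM [`|expR _|]ger0_norm// expR_ge0.
rewrite mulr_natl mulr2n; apply: (le_trans (cnorm_le _)); apply: lerD.
  apply: (le_trans (norm_intR g1)); apply: le_intR => // [|v]; first exact: L1_norm.
  rewrite normrM ler_wpM2l// normrM [`|expR _|]ger0_norm ?expR_ge0//.
  by rewrite ler_piMr ?expR_ge0// cos_max.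
apply: (le_trans (norm_intR g2)); apply: le_intR => // [|v]; first exact: L1_norm.
rewrite normrM ler_wpM2l// normrM [`|expR _|]ger0_norm ?expR_ge0//.
by rewrite ler_piMr ?expR_ge0// sin_max.
Qed.

Lemma real_analytic_mellin a c g x y : band a c g -> a < x < c ->
  real_analytic_C (fun x => mellin g (x +i* y)) x.
Proof.
move=> bg xb; split => /=.
  have -> : (fun x => intR (fun v => g v * (expR (x * v) * cos (y * v)))) =
      (fun x => intR (fun v => g v * cos (y * v) * expR (x * v))).
    by apply/funext => z; congr intR; apply/funext => v; rewrite mulrAC mulrA.
  exact: band_real_analytic (band_mul bg (measurable_cosM y) (fun v => cos_max (y * v))) xb.
have -> : (fun x => intR (fun v => g v * (expR (x * v) * sin (y * v)))) =
    (fun x => intR (fun v => g v * sin (y * v) * expR (x * v))).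
  by apply/funext => z; congr intR; apply/funext => v; rewrite mulrAC mulrA.
exact: band_real_analytic (band_mul bg (measurable_sinM y) (fun v => sin_max (y * v))) xb.
Qed.

(** Continuity at 0 along the diagonal, by domination: for large n the factor e^(v / (n + 1)) is at
    most e^(d v) on the right half-line and at most 1 on the left. *)
Lemma mellin_diag_cvg a c g : a < 0 -> 0 < c -> band a c g ->
  (fun n : nat => mellin g (n.+1%:R^-1 +i* n.+1%:R^-1) : C) @ \oo --> ((intR g)%:C : C).
Proof.
move=> a0 c0 bg; pose d := Num.min (- a) c / 2.
have m0 : 0 < Num.min (- a) c by rewrite lt_min oppr_gt0 a0.
have d0 : 0 < d by rewrite divr_gt0.
have dl : Num.min (- a) c <= - a by rewrite ge_min lexx.
have dr : Num.min (- a) c <= c by rewrite ge_min lexx orbT.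
have t0 : (fun n : nat => n.+1%:R^-1 : R) @ \oo --> 0 by exact: cvg_harmonic.
have [N _ hN] : \forall n \near \oo, (n.+1%:R^-1 : R) <= d.
  move/cvgrPdist_le : t0 => /(_ _ d0); apply: filterS => n.
  by rewrite sub0r normrN ger0_norm.
have [||B B0 hB] := band_dom (x := 0) bg (ltW d0); [rewrite /d; lra|rewrite /d; lra|].
have main (w : R -> R) (l : R) : continuous w -> (forall z, `|w z| <= 1) -> w 0 = l ->
    (fun n : nat => intR (fun v => g v * (expR (n.+1%:R^-1 * v) * w (n.+1%:R^-1 * v)))) @ \oo -->
    intR (fun v => g v * l).
  move=> cw w1 wl.
  pose f n v := g v * (expR ((n + N).+1%:R^-1 * v) * w ((n + N).+1%:R^-1 * v)).
  rewrite -(cvg_shiftn N).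
  have [B1 B10 hB1] : exists2 B : R, 0 <= B & forall n v, `|f n v| <= B * expR (- (d * `|v|)).
    have [||B1 B10 hB1] := band_dom (x := d) bg (ltW d0); [rewrite /d; lra|rewrite /d; lra|].
    exists (B + B1) => [|n v]; first exact: addr_ge0.
    rewrite /f mulrA normrM; apply: (@le_trans _ _ `|g v * expR ((n + N).+1%:R^-1 * v)|).
      by rewrite ler_piMr.
    have tn : (n + N).+1%:R^-1 <= d by apply: (hN (n + N)%N); rewrite /= leq_addl.
    have tn0 : 0 <= (n + N).+1%:R^-1 :> R by [].
    have [v0|v0] := leP 0 v.
      apply: (@le_trans _ _ `|g v * expR (d * v)|).
        rewrite !normrM ler_wpM2l// !ger0_norm ?expR_ge0// ler_expR.
        by rewrite ler_wpM2r.
      by apply: (le_trans (hB1 v)); rewrite mulrDl lerDr mulr_ge0 ?expR_ge0.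
    apply: (@le_trans _ _ `|g v * expR (0 * v)|).
      rewrite !normrM ler_wpM2l// !ger0_norm ?expR_ge0// ler_expR mul0r.
      by rewrite mulr_ge0_le0// ltW.
    by apply: (le_trans (hB v)); rewrite mulrDl lerDl mulr_ge0 ?expR_ge0.
  apply: (intR_dct (f_ := f) (g := fun v => B1 * expR (- (d * `|v|)))) => //.
  - exact: (L1Z _ (L1_expRNabs d0)).
  - move=> n; apply: measurable_funM; first exact: bg.1.
    apply: measurable_funM; first exact: measurable_expM.
    apply: continuous_measurable_fun => v.
    apply: (@continuous_comp _ _ _ (fun v : R => ((n + N).+1%:R^-1 : R) * v) w); last exact: cw.
    by apply: cvgM; [exact: cvg_cst|exact: cvg_id].
  - move=> v; apply: cvgMr.
    have tv : (fun n : nat => (n + N).+1%:R^-1 * v) @ \oo --> 0.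
      rewrite -(mul0r v); apply: cvgMl.
      by rewrite (cvg_shiftn N (fun n : nat => n.+1%:R^-1 : R)).
    have E1 := continuous_cvg _ (@continuous_expR R 0) tv.
    have E2 := continuous_cvg _ (cw 0) tv.
    have -> : l = expR 0 * w 0 by rewrite expR0 mul1r wl.
    exact: (cvgM (E1 _) (E2 _)).
apply/cvg_complexP; split => /=.
  have := main cos 1 (@continuous_cos R) (fun z => cos_max z) (@cos0 R).
  by under [in X in _ --> X]eq_fun do rewrite mulr1.
have := main sin 0 (@continuous_sin R) (fun z => sin_max z) (@sin0 R).
by under [in X in _ --> X]eq_fun do rewrite mulr0; rewrite intR0.
Qed.

End mellin.

(** * Exponentials on half-lines and the pole of Gamma *)

Section half_line.
Variable R : realType.
Notation C := (R[i]^o).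
Local Notation Re := complex.Re.
Local Notation Im := complex.Im.

Lemma intR_itv_FTC (F f : R -> R) (a b : R) : a < b -> continuous f ->
  (forall x : R, is_derive x (1 : R) F (f x)) ->
  intR (fun v => (a <= v < b)%R%:R * f v) = F b - F a.
Proof.
move=> ab cf hd; pose J : set R := `[a, b[%classic.
have -> : (fun v => (a <= v < b)%R%:R * f v) = f \_ J.
  apply/funext => v; rewrite patchE /J mem_setE in_itv/=.
  by case: ifP => /= _; rewrite ?mul1r ?mul0r.
have ci : lebesgue_measure.-integrable `[a, b] (EFin \o f).
  apply: continuous_compact_integrable; first exact: segment_compact.
  exact: continuous_subspaceT.
rewrite /intR -Rintegral_mkcond Rintegral_itv_bndo_bndc; last first.
  apply: integrableS ci => // x /=; rewrite !in_itv/=.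
  by case/andP => -> /ltW ->.
rewrite /Rintegral (@continuous_FTC2 _ f F a b)//.
- exact: continuous_subspaceT.
- have cF : continuous F.
    move=> x; apply: differentiable_continuous; apply/derivable1_diffP.
    by case: (hd x).
  split.
  + by move=> x _; case: (hd x).
  + by apply: cvg_at_right_filter; exact: cF.
  + by apply: cvg_at_left_filter; exact: cF.
- by move=> x _; rewrite derive1E; case: (hd x).
Qed.

Lemma cvg_expRN_nat (d : R) : 0 < d -> (fun n : nat => expR (- (d * n%:R))) @ \oo --> 0.
Proof.
move=> d0.
have -> : (fun n : nat => expR (- (d * n%:R))) = (fun n => expR (- d) ^+ n).
  by apply/funext => n; rewrite -expRM_natr mulNr.
by apply: cvg_expr; rewrite ger0_norm ?expR_ge0// expR_lt1 oppr_lt0.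
Qed.

Lemma intR_neg_half (F f : R -> R) (B d : R) : 0 < d -> continuous f ->
  (forall x : R, is_derive x (1 : R) F (f x)) ->
  (forall v, v <= 0 -> `|f v| <= B * expR (d * v)) ->
  (fun n : nat => F (- n%:R)) @ \oo --> 0 ->
  intR (fun v => (v < 0)%R%:R * f v) = F 0.
Proof.
move=> d0 cf hd fB F0.
have B0 : 0 <= B by have := le_trans (normr_ge0 _) (fB 0 (lexx 0)); rewrite mulr0 expR0 mulr1.
pose f_ (n : nat) v := (- n%:R <= v < 0)%R%:R * f v.
have cvg1 : intR (f_ n) @[n --> \oo] --> intR (fun v => (v < 0)%R%:R * f v).
  apply: (intR_dct (g := fun v => B * expR (- (d * `|v|)))).
  - exact: (L1Z _ (L1_expRNabs d0)).
  - move=> n; apply: measurable_funM; first exact: (L1_measurable (L1_itv (- n%:R) 0)).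
    exact: continuous_measurable_fun.
  - move=> v; apply: cvgMl; apply: cvg_near_cst.
    near=> n; rewrite (_ : (- n%:R <= v) = true)//.
    by rewrite lerNl; apply: ltW; near: n; exact: nbhs_infty_gtr.
  - move=> n v; rewrite /f_; have [v0|v0] := ltP v 0; last first.
      by rewrite andbF mul0r normr0 mulr_ge0 ?expR_ge0.
    rewrite andbT normrM [`|v|]ltr0_norm// mulrN opprK.
    apply: le_trans (fB v (ltW v0)); rewrite ler_piMl//.
    by case: (- n%:R <= v); rewrite ?normr1 ?normr0.
have cvg2 : intR (f_ n) @[n --> \oo] --> F 0 - 0.
  have : (fun n : nat => F 0 - F (- n%:R)) @ \oo --> F 0 - 0 by apply: cvgB => //; exact: cvg_cst.
  apply: cvg_trans; apply: near_eq_cvg; exists 1%N => // n /= n1.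
  by rewrite (intR_itv_FTC _ cf hd)// oppr_lt0 ltr0n.
by rewrite (cvg_unique _ cvg1 cvg2) ?subr0//; exact: norm_hausdorff.
Unshelve. all: by end_near. Qed.

Lemma intR_pos_half (F f : R -> R) (B d : R) : 0 < d -> continuous f ->
  (forall x : R, is_derive x (1 : R) F (f x)) ->
  (forall v, 0 <= v -> `|f v| <= B * expR (- (d * v))) ->
  (fun n : nat => F n%:R) @ \oo --> 0 ->
  intR (fun v => (0 <= v)%R%:R * f v) = - F 0.
Proof.
move=> d0 cf hd fB F0.
have B0 : 0 <= B by have := le_trans (normr_ge0 _) (fB 0 (lexx 0)); rewrite mulr0 oppr0 expR0 mulr1.
pose f_ (n : nat) v := (0 <= v < n%:R)%R%:R * f v.
have cvg1 : intR (f_ n) @[n --> \oo] --> intR (fun v => (0 <= v)%R%:R * f v).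
  apply: (intR_dct (g := fun v => B * expR (- (d * `|v|)))).
  - exact: (L1Z _ (L1_expRNabs d0)).
  - move=> n; apply: measurable_funM; first exact: (L1_measurable (L1_itv 0 n%:R)).
    exact: continuous_measurable_fun.
  - move=> v; apply: cvgMl; apply: cvg_near_cst.
    near=> n; rewrite (_ : (v < n%:R) = true) ?andbT//.
    by near: n; exact: nbhs_infty_gtr.
  - move=> n v; rewrite /f_; have [v0|v0] := leP 0 v; last first.
      by rewrite mul0r normr0 mulr_ge0 ?expR_ge0.
    rewrite andTb normrM [`|v|]ger0_norm//.
    apply: le_trans (fB v v0); rewrite ler_piMl//.
    by case: (_ < _); rewrite ?normr1 ?normr0.
have cvg2 : intR (f_ n) @[n --> \oo] --> 0 - F 0.
  have : (fun n : nat => F n%:R - F 0) @ \oo --> 0 - F 0 by apply: cvgB => //; exact: cvg_cst.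
  apply: cvg_trans; apply: near_eq_cvg; exists 1%N => // n /= n1.
  by rewrite (intR_itv_FTC _ cf hd)// ltr0n.
by rewrite (cvg_unique _ cvg1 cvg2) ?sub0r//; exact: norm_hausdorff.
Unshelve. all: by end_near. Qed.

Lemma intR_exp_pos_half (a : R) : 0 < a ->
  L1 (fun v => (0 <= v)%R%:R * expR (- (a * v))) /\
  intR (fun v => (0 <= v)%R%:R * expR (- (a * v))) = a^-1.
Proof.
move=> a0.
have ce : continuous (fun v : R => expR (- (a * v))).
  have -> : (fun v : R => expR (- (a * v))) = (fun v => expR (- a * v)).
    by apply/funext => v; rewrite mulNr.
  exact: continuous_expM.
split.
  apply: (L1_dom (L1_expRNabs a0)) => [|v].
    apply: measurable_funM; last exact: continuous_measurable_fun.
    have -> : (fun v : R => (0 <= v)%R%:R : R) = (fun v => 1 - (v < 0)%R%:R).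
      by apply/funext => v; case: leP => _ /=; rewrite ?subr0 ?subrr.
    by apply: measurable_funB; [exact: measurable_cst|exact: measurable_lt].
  have [v0|v0] := leP 0 v; last by rewrite mul0r normr0 expR_ge0.
  by rewrite mul1r !ger0_norm ?expR_ge0.
have hd (x : R) : is_derive x 1 (fun v : R => - a^-1 * expR (- (a * v))) (expR (- (a * x))).
  rewrite (_ : (fun _ => _) = (- a^-1) *: (fun x => expR (- a * x))); last first.
    by apply/funext => y; rewrite -[- (a * y)]mulNr.
  apply: (is_derive_eq (is_deriveZ _ (is_derive_expRM _ _))).
  by rewrite /GRing.scale/= mulrA mulrNN mulVf ?gt_eqF// mul1r mulNr.
rewrite (intR_pos_half (B := 1) a0 ce hd).
- by rewrite mulr0 oppr0 expR0 mulr1 opprK.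
- by move=> v _; rewrite mul1r ger0_norm ?expR_ge0.
- by rewrite -(mulr0 (- a^-1)); apply: cvgMr; exact: cvg_expRN_nat.
Qed.

Lemma is_derive_cosM (y v : R) : is_derive v 1 (fun v => cos (y * v)) (- (y * sin (y * v))).
Proof.
have h := @is_derive1_comp R cos (fun x => y * x) v _ _ (is_derive_cos _) _.
by apply: (is_derive_eq (h _ _)); rewrite /GRing.scale/= mulr1; ring.
Qed.

Lemma is_derive_sinM (y v : R) : is_derive v 1 (fun v => sin (y * v)) (y * cos (y * v)).
Proof.
have h := @is_derive1_comp R sin (fun x => y * x) v _ _ (is_derive_sin _) _.
by apply: (is_derive_eq (h _ _)); rewrite /GRing.scale/= mulr1; ring.
Qed.

Lemma intR_expcos_neg_half (x y p q : R) : 0 < x ->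
  intR (fun v => (v < 0)%R%:R * (expR (x * v) * (p * cos (y * v) + q * sin (y * v)))) =
  (p * x - q * y) / (x ^+ 2 + y ^+ 2).
Proof.
move=> x0; have n0 : x ^+ 2 + y ^+ 2 != 0.
  by rewrite gt_eqF// ltr_wpDr ?sqr_ge0// exprn_gt0.
(* P and Q solve x P + y Q = p and x Q - y P = q, so that e^(x v) (P cos (y v) + Q sin (y v)) is a
   primitive of the integrand. *)
pose P := (p * x - q * y) / (x ^+ 2 + y ^+ 2).
pose Q := (p * y + q * x) / (x ^+ 2 + y ^+ 2).
have bnd (p' q' v : R) : `|expR (x * v) * (p' * cos (y * v) + q' * sin (y * v))| <= (`|p'| + `|q'|) * expR (x * v).
  rewrite normrM ger0_norm ?expR_ge0// mulrC ler_wpM2r ?expR_ge0//.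
  apply: (le_trans (ler_normD _ _)); rewrite !normrM.
  by apply: lerD; rewrite ler_piMr// ?cos_max ?sin_max.
have cf (p' q' : R) : continuous (fun v => expR (x * v) * (p' * cos (y * v) + q' * sin (y * v))).
  move=> v; apply: cvgM; first exact: continuous_expM.
  have cy : {for v, continuous (fun v : R => y * v)} by apply: cvgM; [exact: cvg_cst|exact: cvg_id].
  apply: cvgD; (apply: cvgM; first exact: cvg_cst).
    exact: (continuous_comp cy (@continuous_cos R _)).
  exact: (continuous_comp cy (@continuous_sin R _)).
have hd (v : R) : is_derive v 1 (fun v => expR (x * v) * (P * cos (y * v) + Q * sin (y * v)))
    (expR (x * v) * (p * cos (y * v) + q * sin (y * v))).
  have h1 := is_deriveZ P (is_derive_cosM y v).
  have h2 := is_deriveZ Q (is_derive_sinM y v).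
  have h3 := is_deriveM (is_derive_expRM x v) (is_deriveD h1 h2).
  apply: (is_derive_eq h3); rewrite /GRing.scale/=.
  rewrite (_ : (P \*: _ + Q \*: _) v = P * cos (y * v) + Q * sin (y * v))//.
  by rewrite /P /Q; field; exact: n0.
rewrite (intR_neg_half x0 (cf p q) hd (fun v _ => bnd p q v)).
  by rewrite !mulr0 expR0 cos0 sin0 mulr0 mulr1 addr0 mul1r.
apply/norm_cvg0P.
apply: (@squeeze_cvgr _ _ _ _ (fun=> 0) (fun n : nat => (`|P| + `|Q|) * expR (- (x * n%:R)))).
- by apply: nearW => n; rewrite normr_ge0/= (le_trans (bnd P Q _))// mulrN.
- exact: cvg_cst.
- by rewrite -(mulr0 (`|P| + `|Q|)); apply: cvgMr; exact: cvg_expRN_nat.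
Qed.

(** Source of all poles: a main term e^(- a v) at v = - oo contributes a simple pole at s = a. *)
Lemma mellin_neg_half (a : R) (s : R[i]) : a < Re s ->
  mellin (fun v => (v < 0)%R%:R * expR (- (a * v))) s = (s - a%:C)^-1.
Proof.
move=> as0; have x0 : 0 < Re s - a by rewrite subr_gt0.
have e v : expR ((Re s - a) * v) = expR (- (a * v)) * expR (Re s * v).
  by rewrite -expRD; congr expR; ring.
case: s as0 x0 e => [x y] /= _ x0 e.
rewrite /mellin/=; apply: complexP => /=; rewrite ?oppr0 ?addr0.
  have := intR_expcos_neg_half y 1 0 x0; rewrite mul1r mul0r subr0 => <-.
  by congr intR; apply/funext => v; rewrite e; ring.
have := intR_expcos_neg_half y 0 1 x0; rewrite mul0r mul1r sub0r => h.
rewrite -mulNr -h.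
by congr intR; apply/funext => v; rewrite e; ring.
Qed.

Lemma band_neg_half (a c : R) : a <= c -> band a c (fun v => (v < 0)%R%:R * expR (- (a * v))).
Proof.
move=> ac; split.
  apply: measurable_funM; first exact: measurable_lt.
  have -> : (fun v : R => expR (- (a * v))) = (fun v => expR (- a * v)).
    by apply/funext => v; rewrite mulNr.
  exact: measurable_expM.
exists 1 => // v; rewrite !mul1r; have [v0|v0] := ltP v 0; last by rewrite mul0r normr0 !expR_ge0.
rewrite mul1r ger0_norm ?expR_ge0//; split => //.
by rewrite ler_expR lerN2 ler_wnM2r// ltW.
Qed.

Lemma band_Gum (K : nat) : band 0 K%:R (@Gum R).
Proof.
split; first by apply: continuous_measurable_fun; exact: continuous_Gum.
exists (1 + K`!%:R) => [|v]; first exact: addr_ge0.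
rewrite ger0_norm ?expR_ge0// mul0r oppr0 expR0 mulr1.
have G1 : Gum v <= 1 by rewrite /Gum expR_le1 oppr_le0 expR_ge0.
split; first by apply: (le_trans G1); rewrite lerDl.
apply: (le_trans (expRN_le_pow K (expR_gt0 v))).
by rewrite expRN expRM_natl ler_wpM2r ?invr_ge0 ?exprn_ge0 ?expR_ge0// lerDr.
Qed.

Lemma band_Gum0 (K : nat) : band (-1) K%:R (@Gum0 R).
Proof.
have m0 : measurable_fun setT (@Gum0 R) := L1_measurable (@L1_Gum0 R).
split => //; exists (1 + K`!%:R) => [|v]; first exact: addr_ge0.
have [v0|v0] := ltP v 0.
  have := @Gum0_le R v; rewrite [`|v|]ltr0_norm// opprK => h.
  split; apply: (le_trans h).
    by rewrite mulN1r opprK ler_peMl ?expR_ge0// lerDl.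
  apply: (@le_trans _ _ 1); first by rewrite expR_le1 ltW.
  apply: mulr_ege1; first by rewrite lerDl.
  by rewrite -expR0 ler_expR -mulrN mulr_ge0// oppr_ge0 ltW.
have -> : Gum0 v = Gum v by rewrite /Gum0 ltNge v0 subr0.
have [_ [B B0 hB]] := band_Gum K; have [h1 h2] := band_Gum K.
rewrite ger0_norm ?expR_ge0//.
have G1 : Gum v <= 1 by rewrite /Gum expR_le1 oppr_le0 expR_ge0.
split.
  apply: (le_trans G1); apply: mulr_ege1; first by rewrite lerDl.
  by rewrite -[leLHS]expR0 ler_expR mulN1r opprK.
apply: (le_trans (expRN_le_pow K (expR_gt0 v))).
by rewrite expRN expRM_natl ler_wpM2r ?invr_ge0 ?exprn_ge0 ?expR_ge0// lerDr.
Qed.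

(** The left-hand side is Gamma(s), and its pole at 0 is split off. The transform of [Gum0]
    converges for Re s > - 1, so s Gamma(s) tends to 1 along the diagonal. *)
Lemma mellin_Gum (s : R[i]) : 0 < Re s -> mellin (@Gum R) s = mellin (@Gum0 R) s + s^-1.
Proof.
move=> s0; pose K := Num.bound (Re s).
have sK : 0 < Re s < K%:R by rewrite s0 archi_boundP// ltW.
have -> : s^-1 = mellin (fun v => (v < 0)%R%:R * expR (- (0 * v))) s.
  by rewrite mellin_neg_half// subr0.
rewrite -(mellinD (a := 0) (c := K%:R))//.
- congr mellin; apply/funext => v; rewrite /Gum0 mul0r oppr0 expR0; ring.
- by apply: band_le (band_Gum0 K).
- exact: band_neg_half.
Qed.

End half_line.

From mathcomp Require Import finmap.

(** * The Epstein zeta function *)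

Section lattice_sums.
Variable R : realType.
Notation C := (R[i]^o).
Local Notation Re := complex.Re.
Local Notation Im := complex.Im.

Lemma sum_symmetric (phi : int -> R) K : (forall m, phi (- m) = phi m) ->
  \sum_(j < K.*2.+1) phi (j%:Z - K%:Z) = phi 0 + 2 * \sum_(k < K) phi k.+1%:Z.
Proof.
move=> ev; rewrite -(big_mkord xpredT (fun j => phi (j%:Z - K%:Z))).
rewrite (@big_cat_nat _ _ _ K)//=; last by rewrite -addnn; lia.
rewrite big_nat_rev/=.
have -> : \sum_(K <= i < K.*2.+1) phi (i%:Z - K%:Z) = \sum_(0 <= i < K.+1) phi i%:Z.
  have -> : K.*2.+1 = (K.+1 + K)%N by rewrite -addnn addSn.
  rewrite -{1}[K]add0n big_addn addnK; apply: eq_bigr => i _; congr phi; lia.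
rewrite [X in _ + X]big_nat_recl//= add0n.
rewrite !big_mkord mulr_natl mulr2n addrCA; congr (_ + (_ + _)).
  apply: eq_bigr => i _; rewrite -ev; congr phi.
  have := ltn_ord i; lia.
Qed.

Lemma big_uniq_split (T : eqType) (V : zmodType) (s1 s2 : seq T) (F : T -> V) :
  uniq s1 -> uniq s2 -> {subset s1 <= s2} ->
  \sum_(k <- s2) F k = \sum_(k <- s1) F k + \sum_(k <- s2 | k \notin s1) F k.
Proof.
move=> u1 u2 s12; rewrite (bigID (fun k => k \in s1))/=; congr (_ + _).
rewrite -big_filter; apply: perm_big; apply: uniq_perm => //; first exact: filter_uniq.
move=> k; rewrite mem_filter; case k1: (k \in s1) => //=.
by rewrite s12.
Qed.

Lemma ler_sum_uniq (T : eqType) (s1 s2 : seq T) (F : T -> R) :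
  uniq s1 -> uniq s2 -> {subset s1 <= s2} -> (forall k, 0 <= F k) ->
  \sum_(k <- s1) F k <= \sum_(k <- s2) F k.
Proof.
by move=> u1 u2 s12 F0; rewrite (big_uniq_split _ u1 u2 s12) lerDl sumr_ge0.
Qed.

Lemma sumB_uniq_le (T : eqType) (s1 s2 : seq T) (F G : T -> R) :
  uniq s1 -> uniq s2 -> {subset s1 <= s2} -> (forall k, `|F k| <= G k) ->
  `|\sum_(k <- s2) F k - \sum_(k <- s1) F k| <= \sum_(k <- s2) G k - \sum_(k <- s1) G k.
Proof.
move=> u1 u2 s12 FG; rewrite !(big_uniq_split _ u1 u2 s12) addrAC subrr add0r.
rewrite [X in _ <= X]addrAC subrr add0r.
by apply: (le_trans (ler_norm_sum _ _ _)); apply: ler_sum => k _.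
Qed.

(** Cauchy's criterion for the filter of finite sets: the sets containing a given B K form an
    element of the filter. *)
Lemma totally_cvg (I : choiceType) (f : {fset I} -> R) (B : nat -> {fset I}) (e : nat -> R) :
  e @ \oo --> 0 ->
  (forall K A, (B K `<=` A)%fset -> `|f A - f (B K)| <= e K) ->
  exists l : R, f @ @summability.totally I --> l.
Proof.
move=> e0 fB.
have FF : ProperFilter (f @ @summability.totally I).
  exact: (fmap_proper_filter f (@summability.totally_filter I)).
have cf : cauchy (f @ @summability.totally I).
  apply: cauchy_exP => eps eps0.
  have [K _ hK] : \forall K \near \oo, e K < eps.
    move/cvgrPdist_lt : e0 => /(_ _ eps0); apply: filterS => K.
    by rewrite sub0r normrN; apply: le_lt_trans; exact: ler_norm.
  exists (f (B K)); exists (B K) => // A /= BA.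
  rewrite /ball/= distrC; apply: le_lt_trans (fB _ _ BA) _; exact: (hK K (leqnn K)).
by have /cvg_ex := @cauchy_cvg R _ FF cf.
Qed.

Section lattice.
Variables (q : nat) (b : 'I_q -> nat).
Hypothesis b_gt0 : forall i, (0 < b i)%N.
Hypothesis q_gt0 : (0 < q)%N.

Let I := {k : 'rV[int]_q | k != 0}.

Definition qform (k : 'rV[int]_q) : R := \sum_(i < q) ((k 0 i)%:~R ^+ 2 / (b i)%:R ^+ 2).

Lemma qform_gt0 k : k != 0 -> 0 < qform k.
Proof.
move=> k0; have h i : 0 <= (k 0 i)%:~R ^+ 2 / (b i)%:R ^+ 2 :> R by rewrite divr_ge0 ?sqr_ge0.
have [i ki] : exists i, k 0 i != 0.
  apply/existsP; apply: contraR k0; rewrite negb_exists => /forallP k0.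
  by apply/eqP/rowP => i; rewrite mxE; apply/eqP; have := k0 i; rewrite negbK.
rewrite /qform (bigD1 i)//= ltr_wpDr ?sumr_ge0//.
apply: divr_gt0; last by rewrite exprn_gt0// ltr0n.
by rewrite exprn_even_gt0//= intr_eq0.
Qed.

(** The eigenvalue of the Laplacian of R^q / B Z^q at the frequency k. *)
Definition freq (k : 'rV[int]_q) : R := (2 * pi) ^+ 2 * qform k.

Lemma freq_gt0 k : k != 0 -> 0 < freq k.
Proof.
by move=> k0; rewrite mulr_gt0 ?qform_gt0// exprn_gt0// mulr_gt0// pi_gt0.
Qed.

Definition heat_term (k : 'rV[int]_q) (v : R) : R := expR (- (freq k * expR v)).

Lemma heat_term_ge0 k v : 0 <= heat_term k v.
Proof. exact: expR_ge0. Qed.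

Definition heat_coord (i : 'I_q) (v : R) (m : int) : R :=
  expR (- (4 * pi ^+ 2 * (expR v / (b i)%:R ^+ 2) * m%:~R ^+ 2)).

Lemma heat_termE k v : heat_term k v = \prod_(i < q) heat_coord i v (k 0 i).
Proof.
rewrite /heat_coord -expR_sum sumrN; congr (expR (- _)).
rewrite /freq /qform mulr_sumr mulr_suml; apply: eq_bigr => i _; ring.
Qed.

(** The cube |k_i| <= K is parametrised by finite functions, so that sums over it factor over the
    coordinates. *)
Definition box_vec (K : nat) (f : {ffun 'I_q -> 'I_K.*2.+1}) : 'rV[int]_q :=
  \row_i ((f i)%:Z - K%:Z).

Lemma box_vec_inj K : injective (@box_vec K).
Proof.
move=> f g /rowP h; apply/ffunP => i; apply/val_inj => /=.
by have := h i; rewrite !mxE => /addIr[].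
Qed.

Definition box (K : nat) : seq 'rV[int]_q := [seq box_vec f | f <- enum {ffun 'I_q -> 'I_K.*2.+1}].

Lemma box_uniq K : uniq (box K).
Proof. by rewrite map_inj_uniq ?enum_uniq//; exact: box_vec_inj. Qed.

Lemma mem_box K k : (k \in box K) = [forall i, absz (k 0%R i) <= K]%N.
Proof.
apply/mapP/forallP => [[f _ ->] i|h].
  rewrite mxE; have := ltn_ord (f i); move: (nat_of_ord (f i)) => j; rewrite -addnn; lia.
exists [ffun i => inord (absz (k 0 i + K%:Z))]; first by rewrite mem_enum.
apply/rowP => i; rewrite mxE ffunE inordK; have := h i; rewrite -?addnn; lia.
Qed.

Lemma box_sum K v : \sum_(k <- box K) heat_term k v =
  \prod_(i < q) theta_partial K (expR v / (b i)%:R ^+ 2).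
Proof.
rewrite big_map big_enum/=.
under eq_bigr do rewrite heat_termE.
transitivity (\sum_(f : {ffun 'I_q -> 'I_K.*2.+1}) \prod_(i < q) heat_coord i v ((f i)%:Z - K%:Z)).
  by apply: eq_bigr => f _; apply: eq_bigr => i _; rewrite mxE.
rewrite -(bigA_distr_bigA (fun i (j : 'I_K.*2.+1) => heat_coord i v (j%:Z - K%:Z))).
apply: eq_bigr => i _; rewrite sum_symmetric; last first.
  by move=> m; rewrite /heat_coord mulrNz sqrrN.
by rewrite /heat_coord expr0n/= mulr0 oppr0 expR0.
Qed.

Lemma heat_term0 v : heat_term 0 v = 1.
Proof.
rewrite /heat_term /freq /qform big1 ?mulr0 ?mul0r ?oppr0 ?expR0// => i _.
by rewrite mxE expr0n/= mul0r.
Qed.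

(** The cube without the origin, which [insub] discards; its heat sum is therefore the product of
    partial theta sums minus 1. *)
Definition fbox (K : nat) : {fset I} := seq_fset tt (pmap insub (box K)).

Lemma mem_fbox K (i : I) : (i \in fbox K) = (val i \in box K).
Proof. by rewrite seq_fsetE mem_pmap_sub. Qed.

Definition heat_sum (A : {fset I}) (v : R) : R := \sum_(i <- A) heat_term (val i) v.

Lemma heat_sum_fbox K v : heat_sum (fbox K) v =
  \prod_(i < q) theta_partial K (expR v / (b i)%:R ^+ 2) - 1.
Proof.
rewrite -box_sum /heat_sum -(big_map val xpredT (heat_term ^~ v)).
have z0 : (0 : 'rV[int]_q) \in box K by rewrite mem_box; apply/forallP => i; rewrite mxE.
rewrite [X in _ = X - 1](bigD1_seq 0)//= ?box_uniq// heat_term0 addrAC subrr add0r.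
rewrite -[RHS]big_filter; apply: perm_big; apply: uniq_perm.
- by rewrite map_inj_uniq; [exact: (fset_uniq (fbox K))|move=> i j; exact: val_inj].
- by rewrite filter_uniq// box_uniq.
- move=> k; rewrite mem_filter; apply/mapP/andP => [[i iA ->]|[k0 kb]].
    by rewrite -mem_fbox; split => //; exact: (valP i).
  by exists (exist _ k k0) => //; rewrite mem_fbox.
Qed.

Lemma heat_sum_le (A B : {fset I}) v : (A `<=` B)%fset -> heat_sum A v <= heat_sum B v.
Proof.
move=> /fsubsetP AB; apply: ler_sum_uniq; rewrite ?fset_uniq// => k.
exact: heat_term_ge0.
Qed.

Lemma fbox_exhaust (A : {fset I}) : exists K, (A `<=` fbox K)%fset.
Proof.
exists (\sum_(i <- A) \sum_(j < q) `|val i ord0 j|)%N.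
apply/fsubsetP => i iA; rewrite mem_fbox mem_box; apply/forallP => j.
by rewrite (big_fsetD1 i)//= (bigD1 j)//= -addnA leq_addr.
Qed.

Lemma theta_coord_gt0 (v : R) (i : 'I_q) : 0 < expR v / (b i)%:R ^+ 2.
Proof. by rewrite divr_gt0 ?expR_gt0// exprn_gt0// ltr0n. Qed.

Lemma heat_sum_le_theta (A : {fset I}) v : heat_sum A v <= torus_theta b v - 1.
Proof.
have [K AK] := fbox_exhaust A; apply: (le_trans (heat_sum_le v AK)).
rewrite heat_sum_fbox lerD2r; apply: ler_prod => i _.
apply/andP; split; last exact: (theta_partial_le _ (theta_coord_gt0 v i)).
exact: (le_trans ler01 (theta_partial_ge1 _ _)).
Qed.

Lemma heat_sum_cvg v : (fun K => heat_sum (fbox K) v) @ \oo --> torus_theta b v - 1.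
Proof.
under eq_fun do rewrite heat_sum_fbox.
apply: cvgB; last exact: cvg_cst.
apply: (@cvg_prod_ord R q (fun i K => theta_partial K (expR v / (b i)%:R ^+ 2))) => i.
exact: theta_cvg (theta_coord_gt0 v i).
Qed.

Lemma bandI a c (B : R) (g : R -> R) : a <= c -> measurable_fun setT g -> 0 <= B ->
  (forall v, v <= 0 -> `|g v| <= B * expR (- (a * v))) ->
  (forall v, 0 <= v -> `|g v| <= B * expR (- (c * v))) -> band a c g.
Proof.
move=> ac mg B0 hn hp; split => //; exists B => // v; have [v0|v0] := leP 0 v.
  have h := hp v v0; split => //; apply: (le_trans h).
  by rewrite ler_wpM2l// ler_expR lerN2 ler_wpM2r.
have h := hn v (ltW v0); split => //; apply: (le_trans h).
by rewrite ler_wpM2l// ler_expR lerN2 ler_wnM2r// ltW.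
Qed.

Lemma gauss_cst_ge0 : 0 <= gauss_cst R.
Proof.
rewrite mulr_ge0 ?invr_ge0 ?mulr_ge0 ?pi_ge0//.
by apply: intR_ge0 => x; exact: expR_ge0.
Qed.

Lemma theta_cst_ge0 : 0 <= theta_cst R b.
Proof. by apply: prodr_ge0 => i _; rewrite mulr_ge0// gauss_cst_ge0. Qed.

Lemma band_theta (K : nat) : (q <= K)%N ->
  band (q%:R / 2) K%:R (fun v => torus_theta b v - 1 : R).
Proof.
move=> qK; have K0 : (0 < K)%N by lia.
have [B B0 hB] := @torus_theta_bounds R q b b_gt0 K K0.
have c0 := theta_cst_ge0.
have q0 : 0 <= q%:R / 2 :> R by rewrite divr_ge0.
have D0 : 0 <= B + theta_cst R b + 1 by rewrite !addr_ge0.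
apply: (bandI _ _ D0).
- have : q%:R <= K%:R :> R by rewrite ler_nat.
  by move=> h; lra.
- by apply: measurable_funB; [exact: measurable_torus_theta|exact: measurable_cst].
- move=> v v0; have h := (hB v).1 v0.
  set e := expR (- _) in h *.
  have e1 : 1 <= e by rewrite -expR0 ler_expR oppr_ge0 mulr_ge0_le0.
  have u1 : expR v <= 1 by rewrite expR_le1.
  have -> : torus_theta b v - 1 = (torus_theta b v - theta_cst R b * e) + (theta_cst R b * e - 1) by ring.
  apply: (le_trans (ler_normD _ _)); rewrite -addrA mulrDl; apply: lerD.
    by apply: (le_trans h); apply: ler_wpM2l => //; exact: le_trans e1.
  apply: (le_trans (ler_normB _ _)); rewrite normr1 mulrDl mul1r; apply: lerD => //.
  by rewrite ger0_norm ?mulr_ge0//; exact: le_trans e1.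
- move=> v v0; apply: (le_trans ((hB v).2 v0)).
  by rewrite ler_wpM2r ?expR_ge0// -addrA lerDl addr_ge0.
Qed.

Lemma heat_term_shift k : k != 0 -> heat_term k = fun v => Gum (v + ln (freq k)).
Proof.
by move=> k0; apply/funext => v; rewrite /Gum expRD lnK ?posrE ?freq_gt0// mulrC.
Qed.

Lemma band_heat_term k (K : nat) : k != 0 -> band 0 K%:R (heat_term k).
Proof.
move=> k0; have f0 := freq_gt0 k0.
split.
  rewrite heat_term_shift//; apply: (measurableT_comp (f := @Gum R)); last exact: measurable_funD.
  by apply: continuous_measurable_fun; exact: continuous_Gum.
have F0 : 0 <= K`!%:R / freq k ^+ K by rewrite divr_ge0// exprn_ge0// ltW.
exists (1 + K`!%:R / freq k ^+ K) => [|v]; first exact: addr_ge0.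
rewrite ger0_norm ?heat_term_ge0// mul0r oppr0 expR0 mulr1.
have u0 := expR_gt0 v.
have t1 : heat_term k v <= 1 by rewrite expR_le1 oppr_le0 mulr_ge0// ltW.
split; first by apply: (le_trans t1); rewrite lerDl.
apply: (le_trans (expRN_le_pow K (mulr_gt0 f0 u0))).
rewrite exprMn invfM mulrA expRN expRM_natl; apply: ler_wpM2r; last by rewrite lerDr.
by rewrite invr_ge0 exprn_ge0// ltW.
Qed.

Lemma band_heat_sum (A : {fset I}) (K : nat) : band 0 K%:R (heat_sum A).
Proof. by apply: band_sum => i; apply: band_heat_term; exact: (valP i). Qed.

Lemma cpowM (x y : R) (s : R[i]) : 0 < x -> 0 < y -> cpow (x * y) s = cpow x s * cpow y s.
Proof.
move=> x0 y0; rewrite /cpow lnM ?posrE// !mulrDr expRD cosD sinD.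
apply: complexP;
  rewrite !(cReM, cImM) /= ; ring.
Qed.

Lemma cpow_sqr (x : R) (s : R[i]) : 0 < x -> cpow x (- (2 * s)) = cpow (x ^+ 2) (- s).
Proof.
move=> x0; rewrite /cpow lnXn// mulr_natl mulr2n !(cReN, cImN, cReD, cImD).
have e (y : R) : - (y + y) * ln x = - y * (ln x *+ 2) by rewrite mulr2n; ring.
by rewrite !e.
Qed.

(** * The Dirichlet series in its half-plane of convergence *)

Section summation.
Variable s : R[i].
Hypothesis s_gt : q%:R / 2 < Re s.

Let x := Re s.
Let K0 := (q + Num.bound (Re s))%N.

Lemma Re_s_gt0 : 0 < x.
Proof. by apply: le_lt_trans s_gt; rewrite divr_ge0. Qed.

Lemma Re_s_lt : x < K0%:R.
Proof.
apply: (lt_le_trans (archi_boundP (ltW Re_s_gt0))).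
by rewrite ler_nat leq_addl.
Qed.

Lemma band_theta_sub (A : {fset I}) :
  band (q%:R / 2) K0%:R (fun v => torus_theta b v - 1 - heat_sum A v).
Proof.
apply: bandB; first by apply: band_theta; exact: leq_addr.
apply: band_le (band_heat_sum A K0) => //.
by have := lt_trans s_gt Re_s_lt; exact: ltW.
Qed.

Lemma band_theta0 : band (q%:R / 2) K0%:R (fun v => torus_theta b v - 1 : R).
Proof. by apply: band_theta; exact: leq_addr. Qed.

(** The integrand is nonnegative and only decreases when points are added to the cube, so this
    number controls all larger finite sets at once. *)
Definition tail (K : nat) : R :=
  intR (fun v => (torus_theta b v - 1 - heat_sum (fbox K) v) * expR (x * v)).

Lemma tail_L1 (A : {fset I}) : L1 (fun v => (torus_theta b v - 1 - heat_sum A v) * expR (x * v)).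
Proof. by apply: (band_L1 (band_theta_sub A)); rewrite s_gt Re_s_lt. Qed.

Lemma tail_cvg : tail @ \oo --> 0.
Proof.
rewrite -(@intR0 R).
have i0 : L1 (fun v => (torus_theta b v - 1) * expR (x * v)).
  by apply: (band_L1 band_theta0); rewrite s_gt Re_s_lt.
apply: (intR_dct (f_ := fun K v => (torus_theta b v - 1 - heat_sum (fbox K) v) * expR (x * v)) i0).
- by move=> K; exact: (L1_measurable (tail_L1 _)).
- move=> v; rewrite -(mul0r (expR (x * v))); apply: cvgMl.
  rewrite -(subrr (torus_theta b v - 1)); apply: cvgB; first exact: cvg_cst.
  exact: heat_sum_cvg.
- move=> K v; have h := heat_sum_le_theta (fbox K) v.
  rewrite ger0_norm; last by rewrite mulr_ge0 ?expR_ge0// subr_ge0.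
  rewrite ler_wpM2r ?expR_ge0// gerBl.
  by apply: sumr_ge0 => i _; exact: heat_term_ge0.
Qed.

Lemma heat_sum_tail (K : nat) (A : {fset I}) : (fbox K `<=` A)%fset ->
  intR (fun v => (torus_theta b v - 1 - heat_sum A v) * expR (x * v)) <= tail K.
Proof.
move=> KA; apply: le_intR; [exact: tail_L1|exact: tail_L1|move=> v].
by rewrite ler_wpM2r ?expR_ge0// lerD2l lerN2 heat_sum_le.
Qed.

(** This is Gamma(x) > 0; the convergence proof divides by it. *)
Lemma gamma_gt0 : 0 < intR (fun v => Gum v * expR (x * v)).
Proof.
pose c : R := expR (- expR 1).
apply: (@lt_le_trans _ _ (intR (fun v => c * (0 <= v < 1)%R%:R))).
  rewrite (intRZ _ (L1_itv 0 1)) intR_itv// subr0 mulr1; exact: expR_gt0.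
apply: le_intR.
- exact: (L1Z _ (L1_itv 0 1)).
- by apply: (band_L1 (band_Gum R K0)); rewrite Re_s_gt0 Re_s_lt.
- move=> v; case: andP => [[v0 v1]|_]; last first.
    by rewrite mulr0 mulr_ge0 ?expR_ge0.
  rewrite mulr1 -[leLHS]mulr1; apply: ler_pM; rewrite ?expR_ge0//.
    by rewrite ler_expR lerN2 ler_expR ltW.
  by rewrite -[leLHS]expR0 ler_expR mulr_ge0// ltW// Re_s_gt0.
Qed.

Lemma intR_heat_term k : k != 0 ->
  L1 (fun v => heat_term k v * expR (x * v)) /\
  intR (fun v => heat_term k v * expR (x * v)) =
  expR (- (x * ln (freq k))) * intR (fun v => Gum v * expR (x * v)).
Proof.
move=> k0; split.
  by apply: (band_L1 (band_heat_term K0 k0)); rewrite Re_s_gt0 Re_s_lt.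
have g1 : L1 (fun v => Gum v * expR (x * v)).
  by apply: (band_L1 (band_Gum R K0)); rewrite Re_s_gt0 Re_s_lt.
set h := ln (freq k).
rewrite -(intR_shift h g1) -(intRZ _ (L1_shift h g1)); congr intR; apply/funext => v.
rewrite heat_term_shift// -/h mulrCA; congr (_ * _); rewrite -expRD; congr expR; ring.
Qed.

(** The modulus rho of a term is a constant times the integral of its heat term against e^(x v).
    Hence the sum of the moduli over any finite set disjoint from a cube is at most a constant times
    [tail]: comparison with theta takes the place of counting lattice points. Real and imaginary
    parts are treated separately. *)
Lemma dirichlet_cvg : exists l : C,
  summability.partial_sum (fun k : I => cpow (qform (val k)) (- s) : C) @ @summability.totally I --> l.
Proof.
pose Gx := intR (fun v => Gum v * expR (x * v)).
have G0 : 0 < Gx by exact: gamma_gt0.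
pose D := expR (x * ln ((2 * pi) ^+ 2)) / Gx.
have D0 : 0 < D by rewrite divr_gt0 ?expR_gt0.
have p0 : 0 < (2 * pi) ^+ 2 :> R by rewrite exprn_gt0// mulr_gt0// pi_gt0.
pose rho (k : 'rV[int]_q) : R := expR (- (x * ln (qform k))).
have rhoE (i : I) : rho (val i) = D * intR (fun v => heat_term (val i) v * expR (x * v)).
  have qi := qform_gt0 (valP i).
  rewrite (intR_heat_term (valP i)).2 -/Gx /D /rho /freq lnM ?posrE//.
  rewrite [x * (_ + _)]mulrDr opprD expRD [expR (- (x * ln (_ ^+ 2)))]expRN; field.
  by rewrite !gt_eqF// expR_gt0.
have sumE (A : {fset I}) : \sum_(i <- A) rho (val i) = D * intR (fun v => heat_sum A v * expR (x * v)).
  under eq_bigr do rewrite rhoE.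
  rewrite -mulr_sumr; congr (_ * _).
  rewrite -(intR_sum _ (fun (i : I) _ => (intR_heat_term (valP i)).1)).
  by congr intR; apply/funext => v; rewrite mulr_suml.
have it : L1 (fun v => (torus_theta b v - 1) * expR (x * v)).
  by apply: (band_L1 band_theta0); rewrite s_gt Re_s_lt.
have ih (A : {fset I}) : L1 (fun v => heat_sum A v * expR (x * v)).
  by apply: (band_L1 (band_heat_sum A K0)); rewrite Re_s_gt0 Re_s_lt.
have key (F : I -> R) : (forall i, `|F i| <= rho (val i)) ->
    exists l : R, (fun A : {fset I} => \sum_(i <- A) F i) @ @summability.totally I --> l.
  move=> Frho; apply: (totally_cvg (B := fbox) (e := fun K => D * tail K)).
    by rewrite -(mulr0 D); apply: cvgMr; exact: tail_cvg.
  move=> K A KA; have /fsubsetP KA' := KA.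
  apply: (le_trans (sumB_uniq_le (fset_uniq _) (fset_uniq _) KA' Frho)).
  rewrite !sumE -mulrBr ler_pM2l//.
  rewrite -(intRB (ih _) (ih _)); apply: le_intR; [exact: L1B|exact: tail_L1|move=> v].
  by rewrite -mulrBl ler_wpM2r ?expR_ge0// lerD2r heat_sum_le_theta.
have bnd (i : I) : `|Re (cpow (qform (val i)) (- s))| <= rho (val i) /\
    `|Im (cpow (qform (val i)) (- s))| <= rho (val i).
  rewrite /cpow cReM cImM cReN cImN/= !mul0r subr0 addr0 /rho !normrM !mulNr.
  rewrite [ `|expR _|]ger0_norm ?expR_ge0// cosN sinN normrN.
  by split; rewrite ler_piMr ?expR_ge0// ?cos_max ?sin_max.
have [l1 h1] := key (fun i => Re (cpow (qform (val i)) (- s))) (fun i => (bnd i).1).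
have [l2 h2] := key (fun i => Im (cpow (qform (val i)) (- s))) (fun i => (bnd i).2).
have FF := @summability.totally_filter I.
exists (l1 +i* l2); apply/cvg_complexP; split => /=.
  apply: cvg_trans h1; apply: near_eq_cvg; apply: nearW => A.
  by rewrite /summability.partial_sum cRe_sum -(big_seq_fsetE _ _ xpredT (fun i : I => Re (cpow (qform (val i)) (- s)))).
apply: cvg_trans h2; apply: near_eq_cvg; apply: nearW => A.
by rewrite /summability.partial_sum cIm_sum -(big_seq_fsetE _ _ xpredT (fun i : I => Im (cpow (qform (val i)) (- s)))).
Qed.

Lemma mellin_heat_sum (A : {fset I}) : mellin (heat_sum A) s =
  mellin (@Gum R) s * (cpow (2 * pi) (- (2 * s)) *
    summability.partial_sum (fun k : I => cpow (qform (val k)) (- s) : C) A).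
Proof.
have p0 : 0 < 2 * pi :> R by rewrite mulr_gt0// pi_gt0.
have sb : 0 < Re s < K0%:R by rewrite Re_s_gt0 Re_s_lt.
rewrite (mellin_sum _ (fun i => band_heat_term K0 (valP i)) sb).
rewrite /summability.partial_sum -(big_seq_fsetE _ _ xpredT (fun i : I => cpow (qform (val i)) (- s))).
rewrite cpow_sqr// !mulr_sumr; apply: eq_bigr => i _.
have i0 := valP i.
rewrite (heat_term_shift i0) (mellin_shift (freq_gt0 i0) (band_Gum R K0) sb).
by rewrite /freq cpowM ?exprn_gt0// ?qform_gt0// mulrC.
Qed.

(** The transforms of the finite heat sums converge along the finite sets in two ways: termwise, to
    Gamma times the zeta series, and by domination by theta, to the transform of theta - 1. *)
Lemma epstein_mellin : mellin (@Gum R) s * epstein_series b s =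
  mellin (fun v => torus_theta b v - 1) s.
Proof.
have FF := @summability.totally_filter I.
have [l hl] := dirichlet_cvg.
have -> : epstein_series b s = cpow (2 * pi) (- (2 * s)) * l.
  by rewrite /epstein_series; congr (_ * _); exact: (cvg_lim (@norm_hausdorff _ C) hl).
have sb : q%:R / 2 < Re s < K0%:R by rewrite s_gt Re_s_lt.
have h1 : (fun A => mellin (heat_sum A) s : C) @ @summability.totally I -->
    (mellin (@Gum R) s * (cpow (2 * pi) (- (2 * s)) * l) : C).
  rewrite (_ : (fun A => _) = (fun A => mellin (@Gum R) s * (cpow (2 * pi) (- (2 * s)) *
      summability.partial_sum (fun k : I => cpow (qform (val k)) (- s) : C) A))); last first.
    by apply/funext => A; exact: mellin_heat_sum.
  by apply: cvgMr; apply: cvgMr; exact: hl.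
have h2 : (fun A => mellin (heat_sum A) s : C) @ @summability.totally I -->
    (mellin (fun v => torus_theta b v - 1) s : C).
  apply/cvgrPdist_le => /= e /posC[-> e0].
  have e2 : 0 < Re e / 2 by rewrite divr_gt0.
  move/cvgrPdist_le : tail_cvg => /(_ _ e2) [K _ /(_ K (leqnn K))].
  rewrite sub0r normrN => /ler_normlW tK.
  exists (fbox K) => // A /= KA.
  rewrite cnormE lecR.
  have bA : band (q%:R / 2) K0%:R (heat_sum A).
    by apply: band_le (band_heat_sum A K0) => //; exact: ltW (lt_trans s_gt Re_s_lt).
  rewrite -(mellinB band_theta0 bA sb).
  apply: (le_trans (cnorm_mellin_le (band_theta_sub A) sb)).
  have -> : (fun v => `|torus_theta b v - 1 - heat_sum A v| * expR (Re s * v)) =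
      (fun v => (torus_theta b v - 1 - heat_sum A v) * expR (Re s * v)).
    by apply/funext => v; rewrite ger0_norm// subr_ge0 heat_sum_le_theta.
  by have := le_trans (heat_sum_tail KA) tK; rewrite -/x; lra.
exact: (cvg_unique (@norm_hausdorff _ C) h1 h2).
Qed.

End summation.

End lattice.
End lattice_sums.

(** * The derivative at zero *)

Section derivative_at_zero.
Variable R : realType.
Notation C := (R[i]^o).
Local Notation Re := complex.Re.
Local Notation Im := complex.Im.
Variables (q : nat) (b : 'I_q -> nat).
Hypothesis b_gt0 : forall i, (0 < b i)%N.
Hypothesis q_gt0 : (0 < q)%N.

(** [tr_limit] with its last term cut off at v = 0. Left on v >= 0, that term would confine the
    transform to Re s < q / 2, away from the half-plane of the series; cut off, the transform
    converges for all Re s > - 1. *)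
Definition theta_reg (v : R) : R :=
  torus_theta b v - 1 + Gum v - theta_cst R b * ((v < 0)%R%:R * expR (- (q%:R / 2 * v))).

Lemma band_theta_reg (K : nat) : (q <= K)%N -> band (-1) K%:R theta_reg.
Proof.
move=> qK; have K0 : (0 < K)%N by lia.
have [B B0 hB] := @torus_theta_bounds R q b b_gt0 K K0.
have D0 : 0 <= B + 1 + K`!%:R by rewrite !addr_ge0.
have pos v : 0 <= v -> `|theta_reg v| <= (B + 1 + K`!%:R) * expR (- (K%:R * v)).
  move=> v0; rewrite /theta_reg ltNge v0 mul0r mulr0 subr0.
  have h := (hB v).2 v0.
  have g : `|Gum v| <= K`!%:R * expR (- (K%:R * v)).
    rewrite ger0_norm ?expR_ge0//; apply: (le_trans (expRN_le_pow K (expR_gt0 v))).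
    by rewrite expRN expRM_natl.
  apply: (le_trans (ler_normD _ _)); rewrite [leRHS]mulrDl; apply: lerD => //.
  by apply: (le_trans h); rewrite ler_wpM2r ?expR_ge0// lerDl.
apply: (bandI _ _ D0) => //.
- by rewrite (le_trans _ (ler0n _ K))// lerN10.
- apply: measurable_funB.
    apply: measurable_funD; last by apply: continuous_measurable_fun; exact: continuous_Gum.
    by apply: measurable_funB; [exact: measurable_torus_theta|exact: measurable_cst].
  apply: measurable_funM; first exact: measurable_cst.
  have [m _] := @band_neg_half R (q%:R / 2) (q%:R / 2) (lexx _); exact: m.
- move=> v; rewrite le_eqVlt => /orP[/eqP ->|v0].
    by have := pos 0 (lexx 0); rewrite !mulr0.
  have h := (hB v).1 (ltW v0).
  have g := @Gum0_le R v.
  rewrite mulN1r opprK.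
  have -> : theta_reg v = (torus_theta b v - theta_cst R b * expR (- (q%:R / 2 * v))) + Gum0 v.
    by rewrite /theta_reg /Gum0 v0 (_ : true%:R = 1)//; ring.
  apply: (le_trans (ler_normD _ _)).
  rewrite [ `|v|]ltr0_norm// opprK in g.
  apply: (le_trans (lerD h g)); rewrite -{2}[expR v]mul1r -mulrDl ler_wpM2r ?expR_ge0//.
  by rewrite lerDl.
Qed.

Lemma mellin_theta_reg (s : R[i]) : q%:R / 2 < Re s ->
  mellin theta_reg s = mellin (fun v => torus_theta b v - 1) s + mellin (@Gum R) s -
    (theta_cst R b)%:C * (s - (q%:R / 2)%:C)^-1.
Proof.
move=> s_gt; pose K := (q + Num.bound (Re s))%N.
have q0 : 0 <= q%:R / 2 :> R by rewrite divr_ge0.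
have s0 : 0 < Re s by exact: le_lt_trans s_gt.
have sK : Re s < K%:R.
  by apply: (lt_le_trans (archi_boundP (ltW s0))); rewrite ler_nat leq_addl.
have qK : q%:R / 2 <= K%:R :> R by exact: ltW (lt_trans s_gt sK).
have sb : q%:R / 2 < Re s < K%:R by rewrite s_gt sK.
have b1 : band (q%:R / 2) K%:R (fun v => torus_theta b v - 1 : R).
  by apply: band_theta => //; exact: leq_addr.
have b2 : band (q%:R / 2) K%:R (@Gum R) by apply: band_le (band_Gum R K).
have b3 := @band_neg_half R _ _ qK.
rewrite -(mellin_neg_half s_gt) -(mellinZ _ b3 sb) -(mellinD b1 b2 sb).
by rewrite -(mellinB (bandD b1 b2) (bandZ _ b3) sb).
Qed.

(** The additional summand is the integral of c e^(- q v / 2) over v >= 0; it is the opposite of the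
    value at s = 0 of c / (s - q / 2). *)
Lemma intR_theta_reg : L1 (tr_limit b : R -> R) ->
  intR theta_reg = intR (tr_limit b) + theta_cst R b * (2 / q%:R).
Proof.
move=> i1; have q2 : 0 < q%:R / 2 :> R by rewrite divr_gt0// ltr0n.
have [i2 e2] := intR_exp_pos_half q2.
have -> : 2 / q%:R = intR (fun v : R => (0 <= v)%R%:R * expR (- (q%:R / 2 * v))).
  by rewrite e2; field; rewrite pnatr_eq0 -lt0n.
rewrite -(intRZ _ i2) -(intRD i1 (L1Z _ i2)); congr intR; apply/funext => v.
rewrite /theta_reg /tr_limit leNgt; case: (v < 0) => /=; ring.
Qed.

Variable Z : C -> C.
Hypothesis hZ : epstein_continuation b Z.

(* The factor s - q / 2 removes the pole of the leading term of theta. *)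
Let W (s : R[i]) : R[i] :=
  (s - (q%:R / 2)%:C) * (mellin (@Gum R) s * (Z s + 1) - mellin theta_reg s) - (theta_cst R b)%:C.

Lemma W_eq0_right (s : R[i]) : q%:R / 2 < Re s -> W s = 0.
Proof.
move=> s_gt; rewrite /W (hZ.1 _ s_gt) [_ * (epstein_series b s + 1)]mulrDr mulr1 epstein_mellin// mellin_theta_reg//.
have n0 : s - (q%:R / 2)%:C != 0.
  apply/eqP => /(congr1 (@complex.Re R)); rewrite cReB/= => h.
  by have := s_gt; rewrite -subr_gt0 h ltxx.
by rewrite opprB addrCA subrr addr0 mulrC divfK// subrr.
Qed.

Lemma half_natC : (q%:R / 2 : R[i]) = (q%:R / 2 : R)%:C.
Proof. by rewrite rmorphM/= fmorphV/= !rmorph_nat. Qed.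

Lemma W_eq0 (x y : R) : 0 < x -> y != 0 -> W (x +i* y) = 0.
Proof.
move=> x0 y0; pose K := (q + Num.bound x)%N.
have q2 : 0 < q%:R / 2 :> R by rewrite divr_gt0// ltr0n.
have xK : x < K%:R by apply: (lt_le_trans (archi_boundP (ltW x0))); rewrite ler_nat leq_addl.
have qK : q%:R / 2 < K%:R :> R.
  have : q%:R <= K%:R :> R by rewrite ler_nat leq_addr.
  by lra.
have qK' : (q <= K)%N by exact: leq_addr.
have aW z : 0 < z < K%:R -> real_analytic_C (fun z => W (z +i* y)) z.
  move=> zb; have /andP[z0 zK] := zb.
  have aid : real_analytic_C (fun z => z +i* y) z.
    by split; [exact: real_analytic_id|exact: real_analytic_cst].
  have aZ : real_analytic_C (fun z => Z (z +i* y)) z.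
    (* The hypothesis y != 0 keeps the line away from the pole q / 2. *)
    apply: analytic_at_horizontal; apply: hZ.2; rewrite half_natC.
    by apply: contra y0 => /eqP[_ ->].
  have aG := real_analytic_mellin y (band_Gum R K) zb.
  have aT : real_analytic_C (fun z => mellin theta_reg (z +i* y)) z.
    apply: (real_analytic_mellin y (band_theta_reg qK')).
    by rewrite zK andbT; lra.
  apply: real_analytic_CB; last exact: real_analytic_Ccst.
  apply: real_analytic_CM; first by apply: real_analytic_CB => //; exact: real_analytic_Ccst.
  apply: real_analytic_CB => //; apply: real_analytic_CM => //.
  by apply: real_analytic_CD => //; exact: real_analytic_Ccst.
have xb : 0 < x < K%:R by rewrite x0.
apply: complexP => /=.
  apply: (@real_analytic_identity _ (fun z => Re (W (z +i* y))) 0 (q%:R / 2) K%:R q2 qK) xb.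
    by move=> z /aW[].
  by move=> z /andP[qz _]; rewrite W_eq0_right.
apply: (@real_analytic_identity _ (fun z => Im (W (z +i* y))) 0 (q%:R / 2) K%:R q2 qK) xb.
  by move=> z /aW[].
by move=> z /andP[qz _]; rewrite W_eq0_right.
Qed.

Lemma derive1_epstein0 : L1 (tr_limit b : R -> R) -> derive1 Z 0 = (intR (tr_limit b))%:C.
Proof.
move=> i1; have q0 : q%:R != 0 :> R by rewrite pnatr_eq0 -lt0n.
pose s n : C := (n.+1%:R^-1 +i* n.+1%:R^-1).
have t0 : (fun n : nat => n.+1%:R^-1 : R) @ \oo --> 0 by exact: cvg_harmonic.
have s0 : s @ \oo --> (0 : C) by apply/cvg_complexP; split; exact: t0.
have sn0 n : s n != 0 by apply/eqP => -[] /eqP; rewrite invr_eq0 pnatr_eq0.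
have s0' : s @ \oo --> (0 : C)^'.
  move=> A hA; have [N _ hN] := s0 _ hA; exists N => // n /= Nn; apply: (hN n Nn); exact: sn0.
have aZ : analytic_at Z 0.
  apply: hZ.2; rewrite half_natC eq_sym; apply/eqP => -[] /eqP.
  by rewrite mulf_eq0 (negbTE q0) invr_eq0 pnatr_eq0.
have dZ := cvg_comp _ _ s0' (analytic_at_derive1 aZ).
set Z' := derive1 Z 0 in dZ *.
pose D n : C := (s n)^-1 *: (Z (s n + 0) - Z 0).
have {}dZ : D @ \oo --> Z' by exact: dZ.
have ZD n : Z (s n) = Z 0 + s n * D n.
  rewrite /D /GRing.scale/= addr0 mulrA divff ?sn0// mul1r; ring.
have ZZ : (fun n => Z (s n)) @ \oo --> Z 0.
  rewrite (funext ZD) -[X in _ --> X]addr0 -[X in _ --> _ + X](mul0r Z').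
  by apply: cvgD; [exact: cvg_cst|exact: (cvgM s0 dZ)].
pose G n : C := s n * mellin (@Gum R) (s n).
have GE n : G n = s n * mellin (@Gum0 R) (s n) + 1.
  by rewrite /G mellin_Gum//= mulrDr divff ?sn0.
have G1 : G @ \oo --> (1 : C).
  rewrite (funext GE) -[X in _ --> X]add0r -[X in _ --> X + _](mul0r ((intR (@Gum0 R))%:C)).
  apply: cvgD; last exact: cvg_cst.
  apply: (cvgM s0); apply: (mellin_diag_cvg _ _ (band_Gum0 R 1)); rewrite ?oppr_lt0 ?ltr0n//.
pose E n : C := mellin theta_reg (s n) + (theta_cst R b)%:C / (s n - (q%:R / 2)%:C).
have q2 : 0 - (q%:R / 2)%:C != 0 :> R[i].
  by rewrite sub0r oppr_eq0; apply/eqP => -[] /eqP; rewrite mulf_eq0 (negbTE q0) invr_eq0 pnatr_eq0.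
have EH : E @ \oo --> ((intR (tr_limit b))%:C : C).
  (* The cancellation of c: the polar term at s = 0 is - 2 c / q. *)
  have -> : (intR (tr_limit b))%:C = (intR theta_reg)%:C + (theta_cst R b)%:C / (0 - (q%:R / 2)%:C) :> R[i].
    rewrite (intR_theta_reg i1) sub0r invrN mulrN -rmorphV/=; last by rewrite unitfE mulf_neq0// invr_eq0 pnatr_eq0.
    by rewrite -rmorphM/= -rmorphB/=; congr (_ %:C); field.
  apply: cvgD.
    apply: (mellin_diag_cvg _ _ (band_theta_reg (leqnn q))); rewrite ?oppr_lt0 ?ltr0n//.
  apply: cvgM; first exact: cvg_cst.
  have h1 : (fun n => s n - (q%:R / 2)%:C : C) @ \oo --> (0 - (q%:R / 2)%:C : C).
    exact: (cvgB s0 (cvg_cst _)).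
  exact: (cvgV q2 h1).
(* The equation W = 0 divided by s - q / 2 and multiplied by s, which removes the pole of Gamma at
   0. *)
have key n : G n * (Z (s n) + 1) = s n * E n.
  have := @W_eq0 n.+1%:R^-1 n.+1%:R^-1; rewrite invr_gt0 ltr0n => /(_ isT).
  rewrite invr_eq0 pnatr_eq0 => /(_ isT); rewrite -/(s n) /W => h.
  have n0 : s n - (q%:R / 2)%:C != 0.
    by apply/eqP => -[_] /eqP; rewrite oppr0 addr0 invr_eq0 pnatr_eq0.
  rewrite /G /E -mulrA; congr (_ * _).
  apply: (mulfI n0); rewrite [RHS]mulrDr [X in _ = _ + X]mulrC divfK//.
  move/eqP: h; rewrite subr_eq0 => /eqP <-; ring.
(* In [key] the left-hand side tends to Z 0 + 1, and the right-hand side to 0 because E stays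
   bounded. *)
have Z0 : Z 0 = -1.
  have l1 : (fun n => G n * (Z (s n) + 1)) @ \oo --> 1 * (Z 0 + 1).
    have h1 : (fun n => Z (s n) + 1 : C) @ \oo --> (Z 0 + 1 : C) by exact: (cvgD ZZ (cvg_cst _)).
    exact: (cvgM G1 h1).
  have l2 : (fun n => G n * (Z (s n) + 1)) @ \oo --> 0 * ((intR (tr_limit b))%:C : C).
    by rewrite (funext key); exact: (cvgM s0 EH).
  have := cvg_unique (@norm_hausdorff _ C) l1 l2.
  by rewrite mul1r mul0r => h; apply/eqP; rewrite -addr_eq0 h.
(* With Z 0 = - 1 the factor Z + 1 is s times the difference quotient, and s cancels. *)
have key2 n : G n * D n = E n.
  apply: (mulfI (sn0 n)); rewrite -key ZD Z0; ring.
have l1 : (fun n => G n * D n) @ \oo --> 1 * Z' by exact: (cvgM G1 dZ).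
rewrite (funext key2) mul1r in l1.
exact: (cvg_unique (@norm_hausdorff _ C) l1 EH).
Qed.

End derivative_at_zero.

Theorem theorem1p3 (R : realType) (d p : nat) (hp : (1 <= p <= d - 1)%N)
    (a : p.-tuple nat) (b : (d - p).-tuple nat)
    (ha : forall i, (0 < tnth a i)%N) (hb : forall i, (0 < tnth b i)%N)
    (Z : R[i]^o -> R[i]^o) (hZ : epstein_continuation (tnth b) Z) :
  char_poly (laplacian_mx R (tnth a)) =
    \prod_(j : torus (tnth a)) ('X - (torus_eigenvalue R j)%:P) /\
  (fun n : nat =>
     (ln (det_star (laplacian_mx R (Lambda0 a b n)))
      - (n%:R ^+ (d - p) * diag_det R (tnth b) *
           (\sum_(j : torus (tnth a))
              \int[lebesgue_measure]_(t in `]0, +oo[)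
                ((expR (- t) - bessel_I0 (2 * t) ^+ (d - p) *
                    expR (- ((2 * (d - p)%:R + torus_eigenvalue R j) * t))) / t))
         + 2 * ln n%:R))%:C
     + derive1 Z 0 : R[i]^o) @ \oo --> (0 : R[i]^o).
Proof.
have pd : (p <= d)%N by lia.
have q0 : (0 < d - p)%N by lia.
split; first exact: char_poly_laplacian.
have [lim1 lim2] := @tr_defect_intR_cvg R _ _ (tnth a) (tnth b) ha hb q0.
rewrite (derive1_epstein0 hb q0 hZ lim1).
(* For n > 0 the remainder is exactly the integral of [tr_defect], so the limit comes from that
   integral alone. *)
have E n : (0 < n)%N ->
   ln (det_star (laplacian_mx R (Lambda0 a b n))) -
   (n%:R ^+ (d - p) * diag_det R (tnth b) *
      (\sum_(j : torus (tnth a))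
         \int[lebesgue_measure]_(t in `]0, +oo[)
            ((expR (- t) - bessel_I0 (2 * t) ^+ (d - p) *
              expR (- ((2 * (d - p)%:R + torus_eigenvalue R j) * t))) / t))
    + 2 * ln n%:R) = intR (tr_defect (tnth a) (tnth b) n).
  move=> n0; under eq_bigr do rewrite Rintegral_line.
  have tE t : \prod_(i < d) cycle_heat (Lambda0 a b n i) t =
      fin_heat (tnth a) t * \prod_(i < d - p) cycle_heat (tnth b i * n) t :> R.
    exact: (prod_Lambda0 a b n (fun m => cycle_heat m t) pd).
  rewrite (ln_det_star_defect q0 n0 (Lambda0_gt0 pd ha hb n0) tE).
  have -> : n%:R ^+ (d - p) * diag_det R (tnth b) = \prod_(i < d - p) (tnth b i * n)%N%:R.
    rewrite /diag_det det_diag; under [in RHS]eq_bigr do rewrite natrM mulrC.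
    rewrite big_split/= prodr_const card_ord; congr (_ * _).
    by apply: eq_bigr => i _; rewrite mxE.
  ring.
(* The derivative at 0 is now a real number, so the imaginary part is identically 0. *)
apply/cvg_complexP; split => /=; last by rewrite addr0; exact: cvg_cst.
have lim3 : (fun n => intR (tr_defect (tnth a) (tnth b) n) + intR (tr_limit (tnth b) : R -> R)) @ \oo --> (0 : R).
  rewrite -(addNr (intR (tr_limit (tnth b) : R -> R))).
  by apply: cvgD => //; exact: cvg_cst.
apply: cvg_trans lim3; apply: near_eq_cvg; exists 1%N => // n /= n0.
by rewrite -(E n n0).
Qed.
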